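(* Let $(\Gamma,G)$ be a matched pair of a countable discrete group $\Gamma$ and a compact group $G$, with associated action $\alpha$ of $\Gamma$ on $G$, let $\mathbb{G}$ be the bicrossed product, and let $G^\alpha=\{g\in G:\alpha_\gamma(g)=g\ \forall\gamma\in\Gamma\}$. The following holds: \begin{enumerate} \item If $\widehat{\mathbb{G}}$ has property $(T)$, then $\Gamma$ has property $(T)$ and $G^\alpha$ is finite. \item If $\widehat{\mathbb{G}}$ has property $(T)$ and $\alpha$ is compact, then $\Gamma$ has property $(T)$ and $G$ is finite. (Here, in place of compactness of $\alpha$, one only needs to assume that the closure of the image of $\Gamma$ in the group of homeomorphisms of $G$ is compact for some Hausdorff group topology for which the evaluation map at $e$ is continuous.) \item If $\Gamma$ has property $(T)$ and $G$ is finite, then $\widehat{\mathbb{G}}$ has property $(T)$. \end{enumerate}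
   Context: Compact groups are Hausdorff and second countable; $e$ denotes the identity element. Matched pair $(\Gamma,G)$: $\Gamma$ and $G$ are closed subgroups of a locally compact group $H$ with $\Gamma\cap G=\{e\}$ and complement of $\Gamma G$ of Haar measure zero. Since $G$ is compact, $\Gamma G=H$, and $\gamma g=\alpha_\gamma(g)\beta_g(\gamma)$ defines a continuous left action $\alpha$ of $\Gamma$ on the topological space $G$ (by homeomorphisms, with $\alpha_\gamma(e)=e$) and a continuous right action $\beta$ of $G$ on the set $\Gamma$ (with finite orbits $\gamma\cdot G$). The bicrossed product $\mathbb{G}$ is the compact quantum group with $C_m(\mathbb{G})$ equal to the full crossed product of $C(G)$ by $\Gamma$ (generated by a copy $\alpha(C(G))$ of $C(G)$ and unitaries $u_\gamma$ with $u_\gamma\alpha(F)u_\gamma^*=\alpha(F\circ\alpha_{\gamma^{-1}})$), with comultiplication given by $\Delta_{\mathbb{G}}\circ\alpha=(\alpha\otimes\alpha)\circ\Delta_G$, where $\Delta_G(F)(g,h)=F(gh)$, and $\Delta_{\mathbb{G}}(u_\gamma)=\sum_{r\in\gamma\cdot G}u_\gamma\alpha(v_{\gamma,r})\otimes u_r$, where $v_{\gamma,r}\in C(G)$ is the indicator function of $\{g\in G:\beta_g(\gamma)=r\}$; its counit satisfies $\varepsilon_{\mathbb{G}}(u_\gamma\alpha(F))=F(e)$. The discrete dual $\widehat{\mathbb{G}}$ has property $(T)$ if every representation $\pi:C_m(\mathbb{G})\to\mathcal B(H)$ admitting unit vectors $\xi_n\in H$ with $\|\pi(x)\xi_n-\varepsilon_{\mathbb{G}}(x)\xi_n\|\to0$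 for all $x\in C_m(\mathbb{G})$ admits a nonzero $\xi\in H$ with $\pi(x)\xi=\varepsilon_{\mathbb{G}}(x)\xi$ for all $x\in C_m(\mathbb{G})$. Compactness of $\alpha$ refers to compactness of the closure of the image of $\Gamma$, under $\gamma\mapsto\alpha_\gamma$, in the group of homeomorphisms of $G$. No particular topology on this group needs to be fixed: as stated in (2), it is enough that this holds for some Hausdorff group topology for which evaluation at $e$ is continuous. *)

(* Defs.v *)
From HB Require Import structures.
From mathcomp Require Import all_boot all_order all_algebra.
From mathcomp Require Import all_classical all_reals all_analysis.
From mathcomp.real_closed Require Import complex.

Set Implicit Arguments.
Unset Strict Implicit.
Unset Printing Implicit Defensive.

Import Order.TTheory GRing.Theory Num.Theory.
Import numFieldNormedType.Exports.
Local Open Scope classical_set_scope.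
Local Open Scope ring_scope.

(* [R[i]] with the topology given by its modulus. *)
Notation cplx R := (complex R)^o.

HB.mixin Record isTopologicalGroup G & PointedTopological G & Group G := {
  mulg_continuous : continuous (fun p : G * G => (p.1 * p.2)%g) ;
  invg_continuous : continuous (fun x : G => (x^-1)%g)
}.

(* The distinguished point only serves to make the Borel sigma-algebra of
   [G] available; it plays no other role. *)
#[short(type="topGroupType")]
HB.structure Definition TopologicalGroup :=
  {G of PointedTopological G & Group G & isTopologicalGroup G}.

Definition closed_subgroup_embedding (K H : topGroupType) (i : K -> H) : Prop :=
  [/\ {morph i : x y / (x * y)%g}, injective i, continuous i,
      closed (range i) &
      forall U : set K, open U -> exists2 V : set H, open V & U = i @^-1` V].

Notation borel H := (g_sigma_algebraType (@open H)).

Record haar_measure (R : realType) (H : topGroupType)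
    (mu : {measure set (borel H) -> \bar R}) : Prop := HaarMeasure {
  haar_nonzero : mu setT <> 0%E ;
  haar_invariant : forall (x : H) (A : set H), measurable (A : set (borel H)) ->
    mu [set (x * y)%g | y in A] = mu A ;
  haar_compact_finite : forall K : set H, compact K -> (mu K < +oo)%E ;
  haar_outer_regular : forall A : set H, measurable (A : set (borel H)) ->
    mu A = ereal_inf [set mu U | U in [set U : set H | open U /\ A `<=` U]] ;
  haar_inner_regular : forall U : set H, open U ->
    mu U = ereal_sup [set mu K | K in [set K : set H | compact K /\ K `<=` U]]
}.

Record matched_pair (R : realType) (Gam G : topGroupType) := MatchedPair {
  mp_group : topGroupType ;
  mp_hausdorff : hausdorff_space mp_group ;
  mp_locally_compact : locally_compact [set: mp_group] ;
  mp_inl : Gam -> mp_group ;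
  mp_inr : G -> mp_group ;
  mp_inl_closed : closed_subgroup_embedding mp_inl ;
  mp_inr_closed : closed_subgroup_embedding mp_inr ;
  mp_trivial_meet : range mp_inl `&` range mp_inr = [set 1%g] ;
  mp_null_complement :
    exists2 mu : {measure set (borel mp_group) -> \bar R}, haar_measure mu &
      mu.-negligible
        (~` [set (mp_inl c * mp_inr g)%g | c in [set: Gam] & g in [set: G]])
}.

(* [gamma g = alpha_gamma(g) beta_g(gamma)]; as [Gam] and [G] meet trivially,
   this determines [alpha] and [beta]. *)
Definition mp_actions (R : realType) (Gam G : topGroupType)
    (mp : matched_pair R Gam G) (alpha : Gam -> G -> G) (beta : G -> Gam -> Gam)
    : Prop :=
  forall c g,
    (mp_inl mp c * mp_inr mp g = mp_inr mp (alpha c g) * mp_inl mp (beta g c))%g.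

HB.mixin Record isHilbert (R : realType) H & CompleteNormedModule R[i] H := {
  ip : H -> H -> R[i] ;
  ip_linear : forall (c : R[i]) (x y z : H),
    ip (c *: x + y) z = c * ip x z + ip y z ;
  ip_conj : forall x y : H, ip x y = (ip y x)^* ;
  ip_norm : forall x : H, ip x x = `|x| ^+ 2
}.

#[short(type="hilbertType")]
HB.structure Definition Hilbert (R : realType) :=
  {H of CompleteNormedModule R[i] H & isHilbert R H}.

Definition bounded_operator (R : realType) (H : hilbertType R) (S : H -> H) :=
  linear S /\ continuous S.

Definition adjoint_operators (R : realType) (H : hilbertType R) (S S' : H -> H) :=
  forall x y : H, ip (S x) y = ip x (S' y).

HB.mixin Record isCStarAlgebra (R : realType) A
    & CompleteNormedModule R[i] A := {
  cmul : A -> A -> A ;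
  cone : A ;
  cstar : A -> A ;
  cmulA : associative cmul ;
  cmul1l : left_id cone cmul ;
  cmul1r : right_id cone cmul ;
  cmul_linearl : forall (c : R[i]) (x y z : A),
    cmul (c *: x + y) z = c *: cmul x z + cmul y z ;
  cmul_linearr : forall (c : R[i]) (x y z : A),
    cmul z (c *: x + y) = c *: cmul z x + cmul z y ;
  cstarK : involutive cstar ;
  cstar_antilinear : forall (c : R[i]) (x y : A),
    cstar (c *: x + y) = c^* *: cstar x + cstar y ;
  cstarM : forall x y : A, cstar (cmul x y) = cmul (cstar y) (cstar x) ;
  cnormM : forall x y : A, `|cmul x y| <= `|x| * `|y| ;
  cnorm_star : forall x : A, `|cmul (cstar x) x| = `|x| ^+ 2
}.

#[short(type="cstarType")]
HB.structure Definition CStarAlgebra (R : realType) :=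
  {A of CompleteNormedModule R[i] A & isCStarAlgebra R A}.

Arguments cone {R} s.

Declare Scope cstar_scope.
Delimit Scope cstar_scope with cstar.
Notation "x ** y" := (cmul x y) (at level 40, left associativity) : cstar_scope.
Notation "x ^†" := (cstar x) (at level 1, format "x ^†") : cstar_scope.
Local Open Scope cstar_scope.

Record star_hom (R : realType) (A B : cstarType R) (f : A -> B) : Prop := StarHom {
  sh_linear : linear f ;
  sh_mul : {morph f : x y / x ** y} ;
  sh_one : f (cone A) = cone B ;
  sh_star : {morph f : x / x^†}
}.

Record star_character (R : realType) (A : cstarType R) (e : A -> R[i]) : Prop :=
    StarCharacter {
  sc_linear : forall (c : R[i]) (x y : A), e (c *: x + y) = c * e x + e y ;
  sc_mul : forall x y : A, e (x ** y) = e x * e y ;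
  sc_one : e (cone A) = 1 ;
  sc_star : forall x : A, e (x^†) = (e x)^*
}.

(* Representations are unital, i.e. nondegenerate. *)
Record representation (R : realType) (A : cstarType R) (H : hilbertType R)
    (pi : A -> H -> H) : Prop := Representation {
  rep_bounded : forall x, bounded_operator (pi x) ;
  rep_linear : forall (c : R[i]) (x y : A) (xi : H),
    pi (c *: x + y) xi = c *: pi x xi + pi y xi ;
  rep_mul : forall x y : A, pi (x ** y) = pi x \o pi y ;
  rep_one : pi (cone A) = id ;
  rep_star : forall x : A, adjoint_operators (pi x) (pi (x^†))
}.

Definition faithful (R : realType) (A : cstarType R) (H : hilbertType R)
    (pi : A -> H -> H) : Prop :=
  forall x : A, (forall xi, pi x xi = 0) -> x = 0.

(* The C*-subalgebra generated by [S] is the whole of [A]. *)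
Definition generates (R : realType) (A : cstarType R) (S : set A) : Prop :=
  forall B : set A, S `<=` B -> closed B -> B (cone A) ->
    (forall (c : R[i]) x y, B x -> B y -> B (c *: x + y)) ->
    (forall x y, B x -> B y -> B (x ** y)) ->
    (forall x, B x -> B (x^†)) ->
    B = setT.

(* Maps out of C(X) are represented by maps out of [X -> cplx R], whose values
   are only constrained, and only used, at continuous functions. *)
Record function_hom (R : realType) (X : topologicalType) (A : cstarType R)
    (a : (X -> cplx R) -> A) : Prop := FunctionHom {
  fh_linear : forall (c : R[i]) (F F' : X -> cplx R),
    continuous F -> continuous F' ->
    a (fun x => c * F x + F' x) = c *: a F + a F' ;
  fh_mul : forall F F' : X -> cplx R, continuous F -> continuous F' ->
    a (fun x => F x * F' x) = a F ** a F' ;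
  fh_one : a (fun=> 1) = cone A ;
  fh_star : forall F : X -> cplx R, continuous F ->
    a (fun x => (F x)^*) = (a F)^†
}.

Record function_rep (R : realType) (X : topologicalType) (H : hilbertType R)
    (pi : (X -> cplx R) -> H -> H) : Prop := FunctionRep {
  fr_bounded : forall F : X -> cplx R, continuous F -> bounded_operator (pi F) ;
  fr_linear : forall (c : R[i]) (F F' : X -> cplx R) (xi : H),
    continuous F -> continuous F' ->
    pi (fun x => c * F x + F' x) xi = c *: pi F xi + pi F' xi ;
  fr_mul : forall F F' : X -> cplx R, continuous F -> continuous F' ->
    pi (fun x => F x * F' x) = pi F \o pi F' ;
  fr_one : pi (fun=> 1) = id ;
  fr_star : forall F : X -> cplx R, continuous F ->
    adjoint_operators (pi F) (pi (fun x => (F x)^*))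
}.

Record unitary_rep (R : realType) (Gam : groupType) (H : hilbertType R)
    (U : Gam -> H -> H) : Prop := UnitaryRep {
  ur_linear : forall c, linear (U c) ;
  ur_ip : forall c x y, ip (U c x) (U c y) = ip x y ;
  ur_mul : forall c d, U (c * d)%g = U c \o U d ;
  ur_one : U 1%g = id
}.

Definition group_property_T (R : realType) (Gam : groupType) : Prop :=
  forall (H : hilbertType R) (U : Gam -> H -> H), unitary_rep U ->
    (forall (Q : set Gam) (e : R[i]), finite_set Q -> 0 < e ->
       exists2 xi : H, `|xi| = 1 & forall c, Q c -> `|U c xi - xi| < e) ->
    exists2 xi : H, xi <> 0 & forall c, U c xi = xi.

Record covariant_rep (R : realType) (Gam : groupType) (X : topologicalType)
    (alpha : Gam -> X -> X) (H : hilbertType R)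
    (pi : (X -> cplx R) -> H -> H) (U : Gam -> H -> H) : Prop := CovariantRep {
  cr_function : function_rep pi ;
  cr_unitary : unitary_rep U ;
  cr_covariant : forall c (F : X -> cplx R), continuous F ->
    U c \o pi F \o U (c^-1)%g = pi (F \o alpha (c^-1)%g)
}.

Record full_crossed_product (R : realType) (Gam : groupType)
    (X : topologicalType) (alpha : Gam -> X -> X) (A : cstarType R)
    (a : (X -> cplx R) -> A) (u : Gam -> A) : Prop := FullCrossedProduct {
  cp_function : function_hom a ;
  cp_unitaryl : forall c, (u c)^† ** u c = cone A ;
  cp_unitaryr : forall c, u c ** (u c)^† = cone A ;
  cp_mul : forall c d, u (c * d)%g = u c ** u d ;
  cp_covariant : forall c (F : X -> cplx R), continuous F ->
    u c ** a F ** (u c)^† = a (F \o alpha (c^-1)%g) ;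
  cp_generated :
    generates ([set a F | F in [set F : X -> cplx R | continuous F]]
               `|` range u) ;
  cp_universal : forall (H : hilbertType R) (pi : (X -> cplx R) -> H -> H)
      (U : Gam -> H -> H), covariant_rep alpha pi U ->
    exists2 rho : A -> H -> H, representation rho &
      (forall F : X -> cplx R, continuous F -> rho (a F) = pi F) /\
      (forall c, rho (u c) = U c)
}.

Record hilbert_tensor (R : realType) (H K L : hilbertType R)
    (tau : H -> K -> L) : Prop := HilbertTensor {
  ht_linearl : forall k, linear (tau ^~ k) ;
  ht_linearr : forall h, linear (tau h) ;
  ht_ip : forall h h' k k', ip (tau h k) (tau h' k') = ip h h' * ip k k' ;
  ht_total : forall M : set L, closed M ->
    (forall (c : R[i]) x y, M x -> M y -> M (c *: x + y)) ->
    (forall h k, M (tau h k)) -> M = setT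
}.

(* [T], with elementary tensors [t x y], is the C*-algebra generated by
   [pi(A) (x) sigma(B)] on [H (x) K], for faithful [pi] and [sigma]. *)
Definition spatial_tensor (R : realType) (A B T : cstarType R)
    (t : A -> B -> T) : Prop :=
  generates [set t x y | x in [set: A] & y in [set: B]] /\
  exists (H K L : hilbertType R) (tau : H -> K -> L)
    (pi : A -> H -> H) (sigma : B -> K -> K) (rho : T -> L -> L),
    [/\ hilbert_tensor tau,
        representation pi /\ faithful pi,
        representation sigma /\ faithful sigma,
        representation rho /\ faithful rho &
        forall x y h k, rho (t x y) (tau h k) = tau (pi x h) (sigma y k)].

Section BicrossedProduct.
Variables (R : realType) (Gam G : topGroupType).
Variables (alpha : Gam -> G -> G) (beta : G -> Gam -> Gam).

Definition orbit_indicator (c r : Gam) : G -> cplx R :=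
  fun g => if beta g c == r then 1 else 0.

Record bicrossed_product := BicrossedProduct {
  bc_algebra :> cstarType R ;
  bc_fun : (G -> cplx R) -> bc_algebra ;
  bc_u : Gam -> bc_algebra ;
  bc_crossed_product : full_crossed_product alpha bc_fun bc_u ;
  bc_tensor : cstarType R ;
  bc_t : bc_algebra -> bc_algebra -> bc_tensor ;
  bc_spatial_tensor : spatial_tensor bc_t ;
  bc_comul : bc_algebra -> bc_tensor ;
  bc_comul_hom : star_hom bc_comul ;
  (* [theta] is the tensor square of [bc_fun] on C(G) (x) C(G) = C(G * G). *)
  bc_comul_fun :
    exists theta : (G * G -> cplx R) -> bc_tensor,
      [/\ function_hom theta,
          forall F F' : G -> cplx R, continuous F -> continuous F' ->
            theta (fun p => F p.1 * F' p.2) = bc_t (bc_fun F) (bc_fun F') &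
          forall F : G -> cplx R, continuous F ->
            bc_comul (bc_fun F) = theta (fun p => F (p.1 * p.2)%g)] ;
  bc_comul_u : forall c,
    bc_comul (bc_u c) =
      \sum_(r \in [set beta g c | g in [set: G]])
        bc_t (bc_u c ** bc_fun (orbit_indicator c r)) (bc_u r) ;
  bc_counit : bc_algebra -> R[i] ;
  bc_counit_character : star_character bc_counit ;
  (* [s] is the slice map: the counit tensored with the identity. *)
  bc_counitl : exists2 s : bc_tensor -> bc_algebra, star_hom s &
    (forall x y, s (bc_t x y) = bc_counit x *: y) /\ cancel bc_comul s ;
  bc_counitr : exists2 s : bc_tensor -> bc_algebra, star_hom s &
    (forall x y, s (bc_t x y) = bc_counit y *: x) /\ cancel bc_comul s ;
  bc_counitE : forall c (F : G -> cplx R), continuous F ->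
    bc_counit (bc_u c ** bc_fun F) = F 1%g
}.

Definition dual_property_T (QG : bicrossed_product) : Prop :=
  forall (H : hilbertType R) (pi : QG -> H -> H), representation pi ->
    (exists2 xi : nat -> H, forall n, `|xi n| = 1 &
       forall x : QG,
         (fun n => `|pi x (xi n) - bc_counit x *: xi n| : cplx R) @ \oo
           --> (0 : cplx R)) ->
    exists2 xi : H, xi <> 0 & forall x : QG, pi x xi = bc_counit x *: xi.

End BicrossedProduct.

Definition homeomorphism (X : topologicalType) (f : X -> X) : Prop :=
  exists f' : X -> X, [/\ continuous f, continuous f', cancel f f' & cancel f' f].

(* [j] identifies the topological group [T] with the group of homeomorphisms of
   [G]; the topology of [T] is thus a group topology on the latter. *)
Record homeo_group_topology (G T : topGroupType) (j : T -> G -> G) : Prop :=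
    HomeoGroupTopology {
  hgt_mul : forall s t, j (s * t)%g = j s \o j t ;
  hgt_inj : injective j ;
  hgt_range : range j = [set f | homeomorphism f] ;
  hgt_hausdorff : hausdorff_space T ;
  hgt_eval : continuous (fun s => j s 1%g)
}.

Definition compact_action (Gam G : topGroupType) (alpha : Gam -> G -> G) : Prop :=
  exists (T : topGroupType) (j : T -> G -> G),
    homeo_group_topology j /\ compact (closure (j @^-1` range alpha)).

(* Main.v *)
From HB Require Import structures.
Require Import Defs.
From mathcomp Require Import all_boot all_order all_algebra finmap.
From mathcomp Require Import all_classical all_reals all_analysis measurable_realfun.
From mathcomp.real_closed Require Import complex.
From mathcomp Require Import ring lra.

Set Implicit Arguments.
Unset Strict Implicit.
Unset Printing Implicit Defensive.

Import Order.TTheory GRing.Theory Num.Theory.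
Import numFieldNormedType.Exports.
Local Open Scope classical_set_scope.
Local Open Scope complex_scope.
Local Open Scope ring_scope.
Local Open Scope cstar_scope.

(** Representations of the full crossed product are covariant pairs of a
    representation of [C(G)] and a unitary representation of [Gam], and the counit
    is evaluation at the identity on [C(G)] and [1] on [Gam]. Property (T) of the
    dual thus says that a covariant pair with unit vectors that are almost fixed by
    [Gam] and almost concentrated at the identity of [G] has a nonzero vector that is
    fixed by [Gam] and concentrated at the identity
    ([dual_property_T_covariant]). Passing from these generators to all elements of
    the algebra uses that representations and characters are contractive
    ([rep_contractive], [character_le]).

    Letting [C(G)] act by evaluation at the identity turns every unitary
    representation of [Gam] into a covariant pair, because the identity is fixed by
    [alpha]; so [Gam] has property (T) ([dual_property_T_group]).

    A finite Borel measure [nu] on [G] that is invariant under [alpha] gives another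
    covariant pair, on [L2(nu)]. The normalized indicator functions of invariant sets
    of positive measure that shrink to the identity are fixed by [Gam] and almost
    concentrated at the identity, while a vector concentrated at the identity vanishes
    unless the identity is an atom. Hence such a [nu] has an atom at the identity
    ([test_measure]). Two measures are fed into this.

    - If [alpha] had infinitely many fixed points, it would have fixed points [h n],
      different from the identity and tending to it, since [p^-1 g] is fixed when [p]
      and [g] are. A sum of point masses at the [h n] has no atom at the identity
      ([fixed_points_finite]).

    - The Haar measure of the group containing [Gam] and [G] restricts to a finite
      measure on [G] that is nonzero and invariant under left translations. On the
      piece of [G] where [beta g c = r], [alpha c] is the restriction of
      [x |-> c x r^-1], so that invariance under [alpha] amounts to invariance under
      right translations by [Gam]. This follows from the uniqueness of finite left
      invariant measures on [G] of given mass, as [G] and [G r^-1] are fundamental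
      domains for left translation by [Gam] ([haarG_alpha]). If [alpha] is compact,
      then its closure is a compact space for pointwise convergence, and a covering
      argument together with the cocycle identity
      [alpha c (g h) = alpha c g * alpha (beta g c) h] shows that
      every neighbourhood of the identity contains an invariant set of positive
      measure ([invariant_nbhd_charged]). The atom at the identity given by
      [test_measure] then makes all points of [G] atoms of equal mass, and [G] is
      finite ([haarG_atom_finite]).

    Conversely, let [Gam] have property (T) and let [G] be finite. The indicator
    function of the identity belongs to [C(G)] and is mapped to a projection [P] that
    commutes with [Gam]. Vectors almost invariant for the counit are almost in the
    range of [P], so property (T) of [Gam], applied on that range, gives an invariant
    vector there, and [C(G)] acts on the range of [P] by evaluation at the identity
    ([group_property_T_dual]).

    Both [L2(nu)] and the range of [P] are built as completions of semi-inner
    products ([completion]). *)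

(** * Real-valued norms and semi-inner products *)

Section RealNorm.
Variable R : realType.
Local Notation C := (R[i]).

(** The norms of modules over [R[i]] are complex numbers; [nrm] is their real value,
    so that estimates take place in a totally ordered field. *)
Definition nrm (V : normedZmodType C) (x : V) : R := complex.Re `|x|.

Lemma nrmE (V : normedZmodType C) (x : V) : `|x| = (nrm x)%:C.
Proof. by rewrite /nrm RRe_real// ger0_real. Qed.

Lemma nrm_ge0 (V : normedZmodType C) (x : V) : 0 <= nrm x.
Proof. by rewrite -ler0c -nrmE. Qed.

Lemma nrmD (V : normedZmodType C) (x y : V) : nrm (x + y) <= nrm x + nrm y.
Proof. by rewrite -lecR rmorphD/= -!nrmE ler_normD. Qed.

Lemma nrmN (V : normedZmodType C) (x : V) : nrm (- x) = nrm x.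
Proof. by rewrite /nrm normrN. Qed.

Lemma nrm0 (V : normedZmodType C) : nrm (0 : V) = 0.
Proof. by rewrite /nrm normr0. Qed.

Lemma nrm_eq0 (V : normedZmodType C) (x : V) : nrm x = 0 -> x = 0.
Proof. by move=> h; apply/normr0_eq0; rewrite nrmE h. Qed.

Lemma nrmB (V : normedZmodType C) (x y : V) : nrm (x - y) = nrm (y - x).
Proof. by rewrite /nrm distrC. Qed.

Lemma nrmZ (V : normedModType C) (c : C) (x : V) : nrm (c *: x) = nrm c * nrm x.
Proof. by apply: complexI; rewrite rmorphM/= -!nrmE normrZ. Qed.

Lemma nrmM (x y : C) : nrm (x * y) = nrm x * nrm y.
Proof. by apply: complexI; rewrite rmorphM/= -!nrmE normrM. Qed.

Lemma nrm_conj (x : C) : nrm x^* = nrm x.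
Proof. by rewrite /nrm norm_conjC. Qed.

Lemma nrm_real (x : R) : 0 <= x -> nrm x%:C = x.
Proof. by move=> x0; rewrite /nrm ger0_norm ?ler0c. Qed.

Lemma nrm1 : nrm (1 : C) = 1.
Proof. by rewrite /nrm normr1. Qed.

End RealNorm.

Section SemiInner.
Variables (R : realType) (V : lmodType R[i]).

(** The form is only constrained on a linear subspace [S]: bounded measurable
    functions can then be handled inside the module of all functions. *)
Record semi_inner (S : set V) (s : V -> V -> R[i]) : Prop := SemiInner {
  si_0 : S 0 ;
  si_lin : forall (c : R[i]) x y, S x -> S y -> S (c *: x + y) ;
  si_linl : forall (c : R[i]) x y z, S x -> S y -> S z ->
    s (c *: x + y) z = c * s x z + s y z ;
  si_conj : forall x y, S x -> S y -> s x y = (s y x)^* ;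
  si_ge0 : forall x, S x -> 0 <= s x x }.

Variables (S : set V) (s : V -> V -> R[i]).
Hypothesis Ss : semi_inner S s.

Lemma si_D x y : S x -> S y -> S (x + y).
Proof. by move=> Sx Sy; rewrite -[x]scale1r; apply: (si_lin Ss). Qed.

Lemma si_Z c x : S x -> S (c *: x).
Proof.
by move=> Sx; rewrite -[_ *: _]addr0; apply: (si_lin Ss) => //; exact: si_0 Ss.
Qed.

Lemma si_B x y : S x -> S y -> S (x - y).
Proof. by move=> Sx Sy; apply: si_D => //; rewrite -scaleN1r; apply: si_Z. Qed.

Lemma si_Dl x y z : S x -> S y -> S z -> s (x + y) z = s x z + s y z.
Proof. by move=> *; rewrite -{1}[x]scale1r (si_linl Ss)// mul1r. Qed.

Lemma si_0l z : S z -> s 0 z = 0.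
Proof.
move=> Sz; have S0 := si_0 Ss.
by apply: (addrI (s 0 z)); rewrite -si_Dl// !addr0.
Qed.

Lemma si_Zl c x z : S x -> S z -> s (c *: x) z = c * s x z.
Proof.
by move=> Sx Sz; rewrite -[_ *: _]addr0 (si_linl Ss) ?si_0l ?addr0//; exact: si_0 Ss.
Qed.

Lemma si_Bl x y z : S x -> S y -> S z -> s (x - y) z = s x z - s y z.
Proof.
move=> Sx Sy Sz; rewrite -scaleN1r si_Dl ?si_Zl ?mulN1r//; exact: si_Z.
Qed.

Lemma si_Dr x y z : S x -> S y -> S z -> s z (x + y) = s z x + s z y.
Proof.
move=> Sx Sy Sz; rewrite (si_conj Ss) ?si_Dl ?rmorphD/=//; last exact: si_D.
by rewrite -!(si_conj Ss).
Qed.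

Lemma si_Zr c x z : S x -> S z -> s z (c *: x) = c^* * s z x.
Proof.
move=> Sx Sz; rewrite (si_conj Ss) ?si_Zl ?rmorphM/=//; last exact: si_Z.
by rewrite -(si_conj Ss).
Qed.

Lemma si_Br x y z : S x -> S y -> S z -> s z (x - y) = s z x - s z y.
Proof.
move=> Sx Sy Sz; rewrite -scaleN1r si_Dr ?si_Zr ?rmorphN ?rmorph1 ?mulN1r//.
exact: si_Z.
Qed.

Definition snorm2 x : R := complex.Re (s x x).

Lemma snorm2E x : S x -> s x x = (snorm2 x)%:C.
Proof. by move=> Sx; rewrite /snorm2 RRe_real// ger0_real// (si_ge0 Ss). Qed.

Lemma snorm2_ge0 x : S x -> 0 <= snorm2 x.
Proof. by move=> Sx; rewrite -ler0c -snorm2E// (si_ge0 Ss). Qed.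

Lemma snorm2D x y : S x -> S y ->
  snorm2 (x + y) = snorm2 x + snorm2 y + complex.Re (s x y) *+ 2.
Proof.
move=> Sx Sy; rewrite /snorm2 si_Dl ?si_Dr//; try exact: si_D.
rewrite (si_conj Ss Sy Sx) !raddfD/=.
suff -> : complex.Re (s x y)^* = complex.Re (s x y) by rewrite mulr2n; ring.
by case: (s x y).
Qed.

Lemma snorm2Z c x : S x -> snorm2 (c *: x) = nrm c ^+ 2 * snorm2 x.
Proof.
move=> Sx; apply: complexI; rewrite -snorm2E ?si_Zl ?si_Zr//; try exact: si_Z.
by rewrite rmorphM rmorphXn/= -nrmE -snorm2E// mulrA normCK.
Qed.

Lemma CauchySchwarz x y : S x -> S y -> nrm (s x y) ^+ 2 <= snorm2 x * snorm2 y.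
Proof.
move=> Sx Sy; set Z := nrm (s x y) ^+ 2.
(* The seminorm of [y - r <y, x> x] squared, for real [r]; optimal at [r = 1 / <x, x>]. *)
have h (r : R) : 0 <= r ^+ 2 * Z * snorm2 x - 2 * r * Z + snorm2 y.
  have := snorm2_ge0 (si_D (si_Z (- (r%:C * (s x y)^*)) Sx) Sy).
  rewrite snorm2D// ?snorm2Z//; last exact: si_Z.
  rewrite nrmN nrmM nrm_conj exprMn si_Zl// mulNr -[_%:C * _ * _]mulrA [_^* * _]mulrC -normCK.
  have -> : nrm r%:C ^+ 2 = r ^+ 2.
    have [r0|r0] := leP 0 r; first by rewrite nrm_real.
    by rewrite -[r]opprK rmorphN/= nrmN nrm_real ?sqrrN// oppr_ge0 ltW.
  rewrite nrmE -rmorphXn -rmorphM -rmorphN/= -/Z => /le_trans; apply.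
  by rewrite le_eqVlt; apply/orP; left; apply/eqP; rewrite mulr2n; ring.
have Z0 : 0 <= Z by exact: sqr_ge0.
have a0 := snorm2_ge0 Sx; have b0 := snorm2_ge0 Sy.
have [a_gt0|] := ltP 0 (snorm2 x).
  have := h (snorm2 x)^-1.
  have -> : (snorm2 x)^-1 ^+ 2 * Z * snorm2 x - 2 * (snorm2 x)^-1 * Z + snorm2 y =
            (snorm2 x * snorm2 y - Z) / snorm2 x by field; rewrite gt_eqF.
  by rewrite pmulr_lge0 ?invr_gt0// subr_ge0.
move=> a_le0; have a_eq0 : snorm2 x = 0 by apply/eqP; rewrite eq_le a_le0.
have [Z_gt0|//] := ltP 0 Z; last by rewrite a_eq0 mul0r.
(* If [<x, x> = 0], the bound is affine in [r], and a large [r] contradicts it. *)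
have := h ((snorm2 y + 1) / Z); rewrite a_eq0 mulr0 add0r mul0r.
have -> : - (2 * ((snorm2 y + 1) / Z) * Z) + snorm2 y = - snorm2 y - 2 by field; rewrite gt_eqF.
by lra.
Qed.

Definition snorm x : R := Num.sqrt (snorm2 x).

Lemma snorm_ge0 x : 0 <= snorm x. Proof. exact: sqrtr_ge0. Qed.

Lemma snorm_sqr x : S x -> snorm x ^+ 2 = snorm2 x.
Proof. by move=> Sx; rewrite sqr_sqrtr// snorm2_ge0. Qed.

Lemma CauchySchwarz_snorm x y : S x -> S y -> nrm (s x y) <= snorm x * snorm y.
Proof.
move=> Sx Sy; rewrite -ler_sqr ?nnegrE ?nrm_ge0 ?mulr_ge0 ?snorm_ge0//.
by rewrite exprMn !snorm_sqr// CauchySchwarz.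
Qed.

Lemma snormD x y : S x -> S y -> snorm (x + y) <= snorm x + snorm y.
Proof.
move=> Sx Sy; rewrite -ler_sqr ?nnegrE ?addr_ge0 ?snorm_ge0//.
rewrite snorm_sqr; last exact: si_D.
rewrite snorm2D// -!snorm_sqr//.
have : complex.Re (s x y) <= snorm x * snorm y.
  apply: le_trans (CauchySchwarz_snorm Sx Sy).
  rewrite -lecR -nrmE; apply: le_trans (normc_ge_Re _).
  by rewrite lecR ler_norm.
by rewrite mulr2n; lra.
Qed.

Lemma snormZ c x : S x -> snorm (c *: x) = nrm c * snorm x.
Proof.
move=> Sx; rewrite /snorm snorm2Z// sqrtrM ?sqr_ge0// sqrtr_sqr ger0_norm//.
exact: nrm_ge0.
Qed.

Lemma snormB x y : S x -> S y -> snorm (x - y) = snorm (y - x).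
Proof.
move=> Sx Sy; rewrite -[x - y]opprB -[- (y - x)]scaleN1r snormZ ?nrmN ?nrm1 ?mul1r//.
exact: si_B.
Qed.

Lemma snorm0 : snorm 0 = 0.
Proof. by rewrite /snorm /snorm2 si_0l ?sqrtr0//; exact: si_0 Ss. Qed.

End SemiInner.

Section HilbertBasics.
Variables (R : realType) (H : hilbertType R).

Lemma ip_semi : semi_inner (@setT H) (@ip R H).
Proof.
split=> //.
- by move=> *; exact: ip_linear.
- by move=> *; exact: ip_conj.
- by move=> x _; rewrite ip_norm exprn_ge0.
Qed.

Lemma nrm_snorm2 (x : H) : snorm2 (@ip R H) x = nrm x ^+ 2.
Proof. by rewrite /snorm2 ip_norm nrmE -rmorphXn. Qed.

Lemma nrm_snorm (x : H) : snorm (@ip R H) x = nrm x.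
Proof. by rewrite /snorm nrm_snorm2 sqrtr_sqr ger0_norm// nrm_ge0. Qed.

Lemma ip_le (x y : H) : nrm (ip x y) <= nrm x * nrm y.
Proof. by rewrite -!nrm_snorm; exact: (CauchySchwarz_snorm ip_semi). Qed.

End HilbertBasics.

(** * Null sequences and complex limits *)

Section Vanish.
Variable R : realType.

(** A one-sided condition, without absolute value: it expresses convergence to zero
    for the sequences of norms and distances to which it is applied. *)
Definition vanish (u : nat -> R) := forall e, 0 < e -> \forall n \near \oo, u n < e.

Lemma vanish_le u v : (forall n, u n <= v n) -> vanish v -> vanish u.
Proof.
move=> uv hv e e0; near=> n; apply: le_lt_trans (uv n) _; near: n; exact: hv.
Unshelve. all: by end_near. Qed.

Lemma vanishD u v : vanish u -> vanish v -> vanish (fun n => u n + v n).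
Proof.
move=> hu hv e e0; have e2 : 0 < e / 2 by rewrite divr_gt0.
near=> n; rewrite [e]splitr ltrD//; near: n; [exact: hu|exact: hv].
Unshelve. all: by end_near. Qed.

Lemma vanishM c u : 0 <= c -> vanish u -> vanish (fun n => c * u n).
Proof.
move=> c0 hu e e0; have ec : 0 < e / (c + 1) by rewrite divr_gt0// ltr_wpDl.
have c1 : 0 < c + 1 by rewrite ltr_wpDl.
have h := hu _ ec; near=> n.
have un : u n < e / (c + 1) by near: n.
have [u0|u0] := leP 0 (u n).
  rewrite (@le_lt_trans _ _ ((c + 1) * u n))//; first by rewrite ler_wpM2r// lerDl.
  by rewrite mulrC -ltr_pdivlMr.
by rewrite (le_lt_trans _ e0)// mulr_ge0_le0// ltW.
Unshelve. all: by end_near. Qed.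

Lemma vanish_cst c : vanish (fun=> c) -> c <= 0.
Proof.
move=> h; rewrite leNgt; apply/negP => c0.
by have [N _ /(_ N)/=] := h _ c0; rewrite leqnn ltxx => /(_ isT).
Qed.

Lemma vanish_ge0_le u v c : (forall n, c <= u n + v n) -> vanish u -> vanish v -> c <= 0.
Proof. by move=> h hu hv; apply: vanish_cst; apply: vanish_le h (vanishD hu hv). Qed.

Lemma vanish0 : vanish (fun=> 0).
Proof. by move=> e e0; near=> n. Unshelve. all: by end_near. Qed.

Lemma vanish_cvg u : (forall n, 0 <= u n) -> u @ \oo --> (0 : R) <-> vanish u.
Proof.
move=> u0; split=> [/cvgrPdist_lt h e e0|h].
  near=> n; have : `|0 - u n| < e by near: n; exact: h.
  by rewrite sub0r normrN ger0_norm.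
apply/cvgrPdist_lt => e e0; near=> n; rewrite sub0r normrN ger0_norm//.
by near: n; exact: h.
Unshelve. all: by end_near. Qed.

Definition clim (u : nat -> R[i]) l := vanish (fun n => nrm (u n - l)).

Lemma climD u v l m : clim u l -> clim v m -> clim (fun n => u n + v n) (l + m).
Proof.
move=> hu hv; apply: vanish_le (vanishD hu hv) => n.
by rewrite opprD addrACA nrmD.
Qed.

Lemma climM c u l : clim u l -> clim (fun n => c * u n) (c * l).
Proof.
move=> hu; apply: vanish_le (vanishM (nrm_ge0 c) hu) => n.
by rewrite -mulrBr nrmM.
Qed.

Lemma clim_conj u l : clim u l -> clim (fun n => (u n)^*) l^*.
Proof.
by apply: vanish_le => n; rewrite -rmorphB nrm_conj.
Qed.

Lemma clim_uniq u l m : clim u l -> clim u m -> l = m.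
Proof.
move=> hl hm; apply/subr0_eq/nrm_eq0/le_anti; rewrite nrm_ge0 andbT.
apply: vanish_ge0_le hl hm => n.
by rewrite [nrm (u n - l)]nrmB -[l - m](subrKA (u n)) nrmD.
Qed.

Lemma clim_near u v l : vanish (fun n => nrm (u n - v n)) -> clim u l -> clim v l.
Proof.
move=> huv hu; apply: vanish_le (vanishD huv hu) => n.
by rewrite [nrm (u n - v n)]nrmB -(subrKA (u n) (v n)) nrmD.
Qed.

Lemma nrm_Re (z : R[i]) : `|complex.Re z| <= nrm z.
Proof. by rewrite -lecR -nrmE normc_ge_Re. Qed.

Lemma nrm_Im (z : R[i]) : `|complex.Im z| <= nrm z.
Proof.
have -> : nrm z = nrm (z * 'i%C).
  rewrite nrmM; suff -> : nrm ('i%C : R[i]) = 1 by rewrite mulr1.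
  by rewrite /nrm normc_def /= expr0n expr1n add0r sqrtr1.
by rewrite -normrN -ReiNIm nrm_Re.
Qed.

Lemma nrm_ReIm (z : R[i]) : nrm z <= `|complex.Re z| + `|complex.Im z|.
Proof.
rewrite {1}[z]complexE (le_trans (nrmD _ _))// nrmM.
have -> : nrm ('i%C : R[i]) = 1 by rewrite /nrm normc_def /= expr0n expr1n add0r sqrtr1.
have h (x : R) : nrm x%:C = `|x|.
  by rewrite /nrm normc_def /= expr0n addr0 sqrtr_sqr.
by rewrite mul1r !h.
Qed.

Lemma ball_nrm (V : normedModType R[i]) (x y : V) (e : R) :
  ball x (e%:C) y = (nrm (x - y) < e) :> Prop.
Proof. by rewrite -ball_normE /ball_/= nrmE ltcR. Qed.

Lemma real_cauchy (u : nat -> R) :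
  (forall e, 0 < e -> exists N, forall m, (N <= m)%N -> `|u m - u N| < e) ->
  exists l, vanish (fun n => `|u n - l|).
Proof.
move=> h; have /cvg_ex[l hl] : cvgn u.
  apply/cauchy_cvgP; apply: cauchy_exP => e /= e0.
  have [N hN] := h _ e0; exists (u N); exists N => // n /= Nn.
  by rewrite /ball /= distrC; exact: hN.
exists l => e e0; move/cvgrPdist_lt : hl => /(_ e e0) hl.
by near=> n; rewrite distrC; near: n.
Unshelve. all: by end_near. Qed.

Lemma clim_cauchy (u : nat -> R[i]) :
  (forall e, 0 < e -> exists N, forall m, (N <= m)%N -> nrm (u m - u N) < e) ->
  exists l, clim u l.
Proof.
move=> h.
have [a ha] : exists l, vanish (fun n => `|complex.Re (u n) - l|).
  apply: real_cauchy => e /h[N hN]; exists N => m /hN; apply: le_lt_trans.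
  by rewrite -raddfB nrm_Re.
have [b hb] : exists l, vanish (fun n => `|complex.Im (u n) - l|).
  apply: real_cauchy => e /h[N hN]; exists N => m /hN; apply: le_lt_trans.
  by rewrite -raddfB nrm_Im.
exists (Complex a b); apply: vanish_le (vanishD ha hb) => n.
by apply: le_trans (nrm_ReIm _) _; rewrite !raddfB.
Qed.

End Vanish.

(** * Hilbert completion of a semi-inner product *)

Section Completion.
Variables (R : realType) (V : lmodType R[i]) (S : set V) (s : V -> V -> R[i]).
Hypothesis Ss : semi_inner S s.
Local Notation C := (R[i]).
Local Notation snorm := (snorm s).

Definition scauchy (v : nat -> V) :=
  (forall n, S (v n)) /\
  forall e, 0 < e -> exists N, forall m, (N <= m)%N -> snorm (v m - v N) < e.

(** In the completion, the limit of [v] is encoded by the functional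
    [w |-> lim s (v n) w]. It is set to zero off [S] to be determined by the limit. *)
Definition represents (v : nat -> V) (phi : V -> C) :=
  [/\ scauchy v, forall w, S w -> clim (fun n => s (v n) w) (phi w) &
      forall w, ~ S w -> phi w = 0].

Lemma snorm_tri x y z : S x -> S y -> S z -> snorm (x - z) <= snorm (x - y) + snorm (y - z).
Proof. by move=> Sx Sy Sz; rewrite -(subrKA y) (snormD Ss)//; exact: (si_B Ss). Qed.

Lemma scauchy_lin c v w : scauchy v -> scauchy w ->
  scauchy (fun n => c *: v n + w n).
Proof.
move=> [Sv hv] [Sw hw]; split=> [n|e e0]; first exact: (si_lin Ss).
have c1 : 0 < nrm c + 1 by rewrite ltr_wpDl// nrm_ge0.
have e2 : 0 < e / 4 by rewrite divr_gt0.
have [N hN] := hv _ (divr_gt0 e2 c1); have [M hM] := hw _ e2.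
have hv2 m : (N <= m)%N -> nrm c * snorm (v m - v N) <= e / 4.
  move=> /hN/ltW h; rewrite (@le_trans _ _ ((nrm c + 1) * snorm (v m - v N)))//.
    by rewrite ler_wpM2r ?snorm_ge0// lerDl.
  by rewrite mulrC -ler_pdivlMr.
exists (maxn N M) => m; rewrite geq_max => /andP[Nm Mm].
rewrite opprD addrACA -scalerBr.
have SB a b : S (v a - v b) by exact: (si_B Ss).
have SB' a b : S (w a - w b) by exact: (si_B Ss).
apply: le_lt_trans (snormD Ss (si_Z Ss _ (SB _ _)) (SB' _ _)) _; rewrite (snormZ Ss)//.
have h1 : nrm c * snorm (v m - v (maxn N M)) <= e / 4 + e / 4.
  rewrite (@le_trans _ _ (nrm c * (snorm (v m - v N) + snorm (v N - v (maxn N M)))))//.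
    by rewrite ler_wpM2l ?nrm_ge0// snorm_tri.
  by rewrite mulrDr lerD ?hv2// (snormB Ss)// hv2// leq_maxl.
have h2 : snorm (w m - w (maxn N M)) < e / 4 + e / 4.
  apply: le_lt_trans (snorm_tri (Sw _) (Sw M) (Sw _)) _.
  by rewrite ltrD ?hM// (snormB Ss)// hM// leq_maxr.
by lra.
Qed.

Lemma scauchy_bounded v : scauchy v -> exists2 B, 0 <= B & forall n, snorm (v n) <= B.
Proof.
move=> [Sv /(_ 1 ltr01)[N hN]].
exists (\sum_(i < N) snorm (v i) + (snorm (v N) + 1)).
  by rewrite addr_ge0 ?sumr_ge0 ?addr_ge0// ?snorm_ge0// => i _; exact: snorm_ge0.
move=> n; have [nN|Nn] := ltnP n N.
  rewrite (bigD1 (Ordinal nN))//= -addrA lerDl addr_ge0 ?sumr_ge0 ?addr_ge0 ?snorm_ge0//.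
  by move=> i _; exact: snorm_ge0.
rewrite (@le_trans _ _ (snorm (v N) + 1))//.
  rewrite -[v n](subrK (v N)) (le_trans (snormD Ss _ _))//; first exact: (si_B Ss).
  by rewrite addrC lerD2l ltW// hN.
by rewrite lerDr sumr_ge0// => i _; exact: snorm_ge0.
Qed.

Lemma si_dist x y z t : S x -> S y -> S z -> S t ->
  nrm (s x y - s z t) <= snorm (x - z) * snorm y + snorm z * snorm (y - t).
Proof.
move=> Sx Sy Sz St; rewrite -(subrKA (s z y)) -(si_Bl Ss)// -(si_Br Ss)//.
rewrite (le_trans (nrmD _ _))// lerD// (CauchySchwarz_snorm Ss)//; exact: (si_B Ss).
Qed.

Lemma clim_ip v w : scauchy v -> scauchy w ->
  exists l, clim (fun n => s (v n) (w n)) l.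
Proof.
move=> hv hw; have [A A0 hA] := scauchy_bounded hv.
have [B B0 hB] := scauchy_bounded hw.
case: hv hw => Sv hv [Sw hw]; apply: clim_cauchy => e e0.
have e4 : 0 < e / 4 by rewrite divr_gt0.
have A1 : 0 < A + 1 by rewrite ltr_wpDl.
have B1 : 0 < B + 1 by rewrite ltr_wpDl.
have [N hN] := hv _ (divr_gt0 e4 B1); have [M hM] := hw _ (divr_gt0 e4 A1).
have key a b c d D : 0 <= c <= D -> 0 <= a -> 0 <= b -> a < e / 4 / (D + 1) ->
   b < e / 4 / (D + 1) -> d <= a + b -> d * c < e / 2.
  move=> /andP[c0 cD] a0 b0 ha hb hd.
  have D1 : 0 < D + 1 by lra.
  have {}ha : a * (D + 1) < e / 4 by rewrite -ltr_pdivlMr.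
  have {}hb : b * (D + 1) < e / 4 by rewrite -ltr_pdivlMr.
  have h1 : (a + b - d) * c >= 0 by rewrite mulr_ge0// subr_ge0.
  have h2 : (a + b) * (D + 1 - c) >= 0 by apply: mulr_ge0; lra.
  by lra.
exists (maxn N M) => m; rewrite geq_max => /andP[Nm Mm].
apply: le_lt_trans (si_dist (Sv _) (Sw _) (Sv _) (Sw _)) _.
set K := maxn N M.
have h1 : snorm (v m - v K) * snorm (w m) < e / 2.
  apply: (key (snorm (v m - v N)) (snorm (v K - v N)) _ _ B); rewrite ?snorm_ge0 ?hB//.
  - exact: hN.
  - by rewrite hN// leq_maxl.
  - by rewrite (snormB Ss (Sv K) (Sv N)) snorm_tri.
have h2 : snorm (v K) * snorm (w m - w K) < e / 2.
  rewrite mulrC; apply: (key (snorm (w m - w M)) (snorm (w K - w M)) _ _ A); rewrite ?snorm_ge0 ?hA//.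
  - exact: hM.
  - by rewrite hM// leq_maxr.
  - by rewrite (snormB Ss (Sw K) (Sw M)) snorm_tri.
by lra.
Qed.

Lemma scauchy_cst x : S x -> scauchy (fun=> x).
Proof. by move=> Sx; split=> // e e0; exists 0%N => m _; rewrite subrr (snorm0 Ss). Qed.

Lemma scauchy_represents v : scauchy v -> exists phi, represents v phi.
Proof.
move=> hv; have h w : exists l, S w -> clim (fun n => s (v n) w) l.
  have [Sw|] := pselect (S w); last by exists 0.
  by have [l hl] := clim_ip hv (scauchy_cst Sw); exists l.
exists (fun w => if `[< S w >] then xget 0 [set l | S w -> clim (fun n => s (v n) w) l] else 0).
split=> // w Sw; last by rewrite asboolF.
rewrite asboolT//; case: xgetP => [l _|nl]; first exact.
by have [l hl] := h w; case: (nl l).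
Qed.

Lemma represents_uniq v phi psi : represents v phi -> represents v psi -> phi = psi.
Proof.
move=> [_ h1 h2] [_ h3 h4]; apply/funext => w.
have [Sw|nSw] := pselect (S w); last by rewrite h2 ?h4.
exact: clim_uniq (h1 _ Sw) (h3 _ Sw).
Qed.

Lemma represents_lin c v w (phi psi : V -> C^o) : represents v phi -> represents w psi ->
  represents (fun n => c *: v n + w n) (c *: phi + psi).
Proof.
move=> [cv h1 h2] [cw h3 h4]; split; first exact: scauchy_lin.
  move=> x Sx; have := climD (climM c (h1 _ Sx)) (h3 _ Sx).
  by apply: vanish_le => n; rewrite (si_linl Ss)//; [case: cv|case: cw].
by move=> x Sx; rewrite !fctE h2// h4// scaler0 addr0.
Qed.

Lemma represents0 : represents (fun=> 0) (0 : V -> C^o).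
Proof.
split=> //; first exact: scauchy_cst (si_0 Ss).
by move=> w Sw; apply: vanish_le (@vanish0 R) => n; rewrite (si_0l Ss)// subr0 nrm0.
Qed.

(** The functional determines the limit: if [d] is a Cauchy sequence and
    [s (d n) w] tends to zero for every [w], then
    [s (d n) (d n) = s (d n) (d N) + s (d n) (d n - d N)] is small, by weak
    convergence for the first term and Cauchy-Schwarz for the second. *)
Lemma represents_eq v w phi : represents v phi -> represents w phi ->
  vanish (fun n => snorm (v n - w n)).
Proof.
move=> hv hw; have := represents_lin (-1) hw hv.
rewrite scaleN1r addNr => -[cd d0 _] e e0.
have Sd : forall n, S (v n - w n).
  by move=> n; apply: (si_B Ss); [case: hv => -[]|case: hw => -[]].
have E n : -1 *: w n + v n = v n - w n by rewrite scaleN1r addrC.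
have [B B0 hB] := scauchy_bounded cd; have B1 : 0 < B + 1 by lra.
have e2 : 0 < e ^+ 2 / 2 by rewrite divr_gt0// exprn_gt0.
have [_ /(_ _ (divr_gt0 e2 B1))[N hN]] := cd.
have SN : S (-1 *: w N + v N) by rewrite E.
have h := d0 _ SN _ e2.
near=> n.
have Nn : (N <= n)%N by near: n; exact: nbhs_infty_ge.
rewrite -ltr_sqr ?nnegrE ?snorm_ge0 ?(ltW e0)// (snorm_sqr Ss)//.
have h1 : nrm (s (v n - w n) (v N - w N)) < e ^+ 2 / 2.
  by rewrite -!E -[s _ _]subr0; near: n; exact: h.
have h2 : nrm (s (v n - w n) ((v n - w n) - (v N - w N))) < e ^+ 2 / 2.
  apply: le_lt_trans (CauchySchwarz_snorm Ss (Sd _) (si_B Ss (Sd _) (Sd _))) _.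
  have := hB n; rewrite E => hBn.
  have := hN n Nn; rewrite !E; set t := snorm (_ - _ - _).
  rewrite ltr_pdivlMr// => ht.
  have t0 : 0 <= t by exact: snorm_ge0.
  have := snorm_ge0 s (v n - w n); nra.
have : snorm2 s (v n - w n) <= nrm (s (v n - w n) (v n - w n)).
  by rewrite (snorm2E Ss)// nrm_real// (snorm2_ge0 Ss).
rewrite -[X in s (v n - w n) X](subrK (v N - w N)) (si_Dr Ss)//; last exact: (si_B Ss).
by have := nrmD (s (v n - w n) ((v n - w n) - (v N - w N))) (s (v n - w n) (v N - w N)); lra.
Unshelve. all: by end_near. Qed.
End Completion.

Section CompletionType.
Variables (R : realType) (V : lmodType R[i]) (S : set V) (s : V -> V -> R[i]).
Hypothesis Ss : semi_inner S s.
Local Notation C := (R[i]).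

Lemma represents_near v w phi : represents S s v phi -> scauchy S s w ->
  vanish (fun n => snorm s (v n - w n)) -> represents S s w phi.
Proof.
move=> [[Sv hv] h1 h2] [Sw hw] vw; split=> // x Sx.
apply: clim_near (h1 _ Sx); apply: vanish_le (vanishM (snorm_ge0 s x) vw) => n.
by rewrite -(si_Bl Ss)// mulrC (CauchySchwarz_snorm Ss)//; exact: (si_B Ss).
Qed.

Lemma clim_ip_near v w v' w' l : scauchy S s v -> scauchy S s w ->
  scauchy S s v' -> scauchy S s w' ->
  vanish (fun n => snorm s (v n - v' n)) -> vanish (fun n => snorm s (w n - w' n)) ->
  clim (fun n => s (v n) (w n)) l -> clim (fun n => s (v' n) (w' n)) l.
Proof.
move=> hv hw hv' hw' vv ww; apply: clim_near.
have [A A0 hA] := scauchy_bounded Ss hw.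
have [B B0 hB] := scauchy_bounded Ss hv'.
apply: vanish_le (vanishD (vanishM A0 vv) (vanishM B0 ww)) => n.
apply: le_trans (si_dist Ss (proj1 hv n) (proj1 hw n) (proj1 hv' n) (proj1 hw' n)) _.
by rewrite mulrC lerD// ler_wpM2r// ?snorm_ge0.
Qed.

Definition completable of semi_inner S s : {pred V -> C^o} :=
  fun phi => `[< exists v, represents S s v phi >].

Lemma completable_submod : submod_closed (completable Ss).
Proof.
split; first by apply/asboolP; exists (fun=> 0); exact: represents0.
move=> c phi psi /asboolP[v hv] /asboolP[w hw]; apply/asboolP.
by exists (fun n => c *: v n + w n); exact: represents_lin.
Qed.

HB.instance Definition _ := GRing.isSubmodClosed.Build C (V -> C^o) (completable Ss)
  completable_submod.

(** Elements are functionals rather than classes of Cauchy sequences, so that the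
    completion is a submodule of a function space and needs no quotient. *)
Record completion := Completion {
  cfun_of :> V -> C^o ; cfun_ofP : cfun_of \in completable Ss }.

HB.instance Definition _ := [isSub for cfun_of].
HB.instance Definition _ := [Choice of completion by <:].
HB.instance Definition _ := [SubChoice_isSubLmodule of completion by <:].

Definition crep (x : completion) : nat -> V :=
  projT1 (cid (asboolP _ (cfun_ofP x))).

Definition reps v (x : completion) := represents S s v (cfun_of x).

Lemma crepP x : reps (crep x) x.
Proof. by rewrite /reps /crep; case: cid. Qed.

Lemma reps_scauchy v x : reps v x -> scauchy S s v.
Proof. by case. Qed.

Lemma repsS v x n : reps v x -> S (v n).
Proof. by case=> -[]. Qed.

Lemma scauchy_reps v : scauchy S s v -> exists x, reps v x.
Proof.
move=> /(scauchy_represents Ss)[phi hphi].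
have h : phi \in completable Ss by apply/asboolP; exists v.
by exists (Completion h).
Qed.

Lemma reps_uniq v x y : reps v x -> reps v y -> x = y.
Proof. by move=> hx hy; apply: val_inj; exact: represents_uniq hx hy. Qed.

Lemma reps_lin c v w x y : reps v x -> reps w y -> reps (fun n => c *: v n + w n) (c *: x + y).
Proof. exact: represents_lin. Qed.

Lemma repsB v w x y : reps v x -> reps w y -> reps (fun n => v n - w n) (x - y).
Proof.
move=> hx hy; have := reps_lin (-1) hy hx.
rewrite (_ : (fun n => _) = (fun n => v n - w n)).
  by rewrite scaleN1r addrC.
by apply/funext => n; rewrite scaleN1r addrC.
Qed.

Lemma reps_eq v w x : reps v x -> reps w x -> vanish (fun n => snorm s (v n - w n)).
Proof. exact: represents_eq. Qed.

Lemma reps_near v w x : reps v x -> scauchy S s w ->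
  vanish (fun n => snorm s (v n - w n)) -> reps w x.
Proof. exact: represents_near. Qed.

Definition cip (x y : completion) : C :=
  xget 0 [set l | clim (fun n => s (crep x n) (crep y n)) l].

(** The inner product may be computed with any representing sequences; all its
    properties, and those of extended operators, are obtained from this by passing
    to the limit. *)
Lemma reps_cip v w x y : reps v x -> reps w y -> clim (fun n => s (v n) (w n)) (cip x y).
Proof.
move=> hv hw; have hx := crepP x; have hy := crepP y.
apply: (clim_ip_near (reps_scauchy hx) (reps_scauchy hy) (reps_scauchy hv)
  (reps_scauchy hw) (reps_eq hx hv) (reps_eq hy hw)).
rewrite /cip; case: xgetP => [l _|nl]; first exact.
by have [l hl] := clim_ip Ss (reps_scauchy hx) (reps_scauchy hy); case: (nl l).
Qed.

Lemma cip_semi : semi_inner setT cip.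
Proof.
split=> //.
- move=> c x y z _ _ _; have hx := crepP x; have hy := crepP y; have hz := crepP z.
  apply: clim_uniq (reps_cip (reps_lin c hx hy) hz) _.
  have := climD (climM c (reps_cip hx hz)) (reps_cip hy hz).
  by apply: vanish_le => n; rewrite (si_linl Ss)//; [exact: repsS hx|exact: repsS hy|exact: repsS hz].
- move=> x y _ _; have hx := crepP x; have hy := crepP y.
  apply: clim_uniq (reps_cip hx hy) _; have := clim_conj (reps_cip hy hx).
  by apply: vanish_le => n; rewrite (si_conj Ss)//; [exact: repsS hx|exact: repsS hy].
- move=> x _; have hx := crepP x.
  have h := reps_cip hx hx.
  set z := cip x x in h *.
  have hr n : s (crep x n) (crep x n) = (snorm2 s (crep x n))%:C.
    by rewrite (snorm2E Ss)//; exact: repsS hx.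
  have h0 n : 0 <= snorm2 s (crep x n) by rewrite (snorm2_ge0 Ss)//; exact: repsS hx.
  have : complex.Im z = 0.
    apply/eqP; rewrite -normr_le0; apply: vanish_cst; apply: vanish_le h => n.
    by apply: le_trans (nrm_Im _); rewrite hr raddfB/= sub0r normrN.
  have : 0 <= complex.Re z.
    rewrite -oppr_le0; apply: vanish_cst; apply: vanish_le h => n.
    apply: le_trans (nrm_Re _); rewrite hr raddfB/=.
    by apply: le_trans (ler_norm _); rewrite lerDr.
  by rewrite lecE/= => -> ->; rewrite eqxx.
Qed.

Lemma reps_snorm2 v x : reps v x -> vanish (fun n => `|snorm2 s (v n) - snorm2 cip x|).
Proof.
move=> hv; have := reps_cip hv hv; apply: vanish_le => n.
by apply: le_trans (nrm_Re _); rewrite raddfB.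
Qed.

Lemma reps_snorm_le v x b N : reps v x -> 0 <= b ->
  (forall n, (N <= n)%N -> snorm s (v n) <= b) -> snorm cip x <= b.
Proof.
move=> hv b0 hb; rewrite -ler_sqr ?nnegrE ?snorm_ge0// (snorm_sqr cip_semi)//.
rewrite leNgt; apply/negP; rewrite -subr_gt0 => /(reps_snorm2 hv) h.
near \oo => n.
have Nn : (N <= n)%N by near: n; exact: nbhs_infty_ge.
have : `|snorm2 s (v n) - snorm2 cip x| < snorm2 cip x - b ^+ 2 by near: n.
rewrite -(snorm_sqr Ss (repsS n hv)) distrC => /(le_lt_trans (ler_norm _)).
by rewrite ltrD2l ltrN2 ltNge ler_sqr ?nnegrE ?snorm_ge0// hb.
Unshelve. all: by end_near. Qed.

Lemma completion_eval_le (x : completion) (w : V) : S w -> nrm (x w) <= snorm cip x * snorm s w.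
Proof.
move=> Sw; have [cw [y hy]] := (scauchy_cst Ss Sw, scauchy_reps (scauchy_cst Ss Sw)).
have hx := crepP x.
have -> : x w = cip x y.
  by case: (hx) => _ /(_ _ Sw) h _; apply: clim_uniq h _; exact: reps_cip hx hy.
apply: le_trans (CauchySchwarz_snorm cip_semi _ _) _ => //.
by rewrite ler_wpM2l ?snorm_ge0// (reps_snorm_le (N := 0) hy)// snorm_ge0.
Qed.

Lemma cip_definite (x : completion) : snorm cip x = 0 -> x = 0.
Proof.
move=> h; apply: val_inj; apply/funext => w /=.
have [Sw|nSw] := pselect (S w); last by case: (crepP x) => _ _ ->.
by apply: nrm_eq0; apply/le_anti; rewrite nrm_ge0 andbT -[leRHS](mul0r (snorm s w)) -h completion_eval_le.
Qed.

Definition cnorm (x : completion) : C := (snorm cip x)%:C.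

Lemma cnormD x y : cnorm (x + y) <= cnorm x + cnorm y.
Proof. by rewrite /cnorm -rmorphD lecR (snormD cip_semi). Qed.

Lemma cnormZ c x : cnorm (c *: x) = `|c| * cnorm x.
Proof. by rewrite /cnorm (snormZ cip_semi)// rmorphM/= -nrmE. Qed.

Lemma cnorm_eq0 x : cnorm x = 0 -> x = 0.
Proof. by move=> h; apply: cip_definite; apply: complexI; rewrite -/(cnorm x) h. Qed.

HB.instance Definition _ := Lmodule_isNormed.Build C completion cnormD cnormZ cnorm_eq0.

Lemma cnrmE (x : completion) : nrm x = snorm cip x.
Proof. by []. Qed.

Lemma cdense (x : completion) e : 0 < e ->
  exists2 v, S v & exists2 y, reps (fun=> v) y & nrm (x - y) < e.
Proof.
move=> e0; have hx := crepP x; have [Sv hv] := reps_scauchy hx.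
have e2 : 0 < e / 2 by rewrite divr_gt0.
have [N hN] := hv _ e2.
have [y hy] := scauchy_reps (scauchy_cst Ss (Sv N)).
exists (crep x N) => //; exists y => //.
have h := repsB hx hy.
rewrite cnrmE; apply: (@le_lt_trans _ _ (e / 2)); last by rewrite gtr_pMr// invf_lt1// ltr1n.
apply: (reps_snorm_le (N := N) h); first exact: ltW.
by move=> n Nn; rewrite ltW// hN.
Qed.

Lemma creps_dist v w x y : reps (fun=> v) x -> reps (fun=> w) y -> nrm (x - y) = snorm s (v - w).
Proof.
move=> hx hy; have /reps_snorm2 h := repsB hx hy.
rewrite cnrmE /snorm; congr Num.sqrt; apply/eqP; rewrite eq_sym -subr_eq0 -normr_le0.
exact: vanish_cst.
Qed.

(* Bookkeeping of triangle inequalities in the proof of completeness. *)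
Let quarter (a b c d f g h e : R) : a < d -> b < f -> c <= g + b -> g < d + f ->
  d < e / 4 -> f < e / 4 -> h <= a + c -> h < e.
Proof. lra. Qed.

Let half (a b d e h : R) : a < d -> b <= e / 2 -> d < e / 4 -> 0 < e -> h <= b + a -> h < e.
Proof. lra. Qed.

Let half2 (a b d e h : R) : a < e / 2 -> b < d -> d < e / 2 -> h <= a + b -> h < e.
Proof. lra. Qed.

Let quarter2 (a b c e : R) : 0 < e -> a < e / 4 -> b < e / 4 -> c <= a + b -> c <= e / 2.
Proof. lra. Qed.

(** A Cauchy filter is followed by a sequence [x n] in the completion; elements [v n]
    of [S] at distance less than [1/(n+1)] of the [x n] form a Cauchy sequence, whose
    limit is the limit of the filter. *)
Lemma completion_complete (F : set_system completion) :
  ProperFilter F -> cauchy F -> cvg F.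
Proof.
move=> FF /cauchyP Fc.
have F1 k : exists x : completion, F (ball x (k.+1%:R^-1 : R)%:C).
  by apply: Fc; rewrite -[0]/(0%:C) ltcR invr_gt0.
have /choice[x hx] := F1.
have F2 k : exists v, S v /\ exists2 y, reps (fun=> v) y & nrm (x k - y) < k.+1%:R^-1.
  have k0 : 0 < k.+1%:R^-1 :> R by rewrite invr_gt0.
  by have [v Sv hv] := cdense (x k) k0; exists v.
have /choice[v hv] := F2.
have Sv k : S (v k) by case: (hv k).
have hxx k l : nrm (x k - x l) < k.+1%:R^-1 + l.+1%:R^-1.
  have [y [hk hl]] := filter_ex (filterI (hx k) (hx l)).
  rewrite !ball_nrm in hk hl.
  rewrite -(subrKA y); apply: le_lt_trans (nrmD _ _) _.
  by rewrite ltrD// nrmB.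
have small e : 0 < e -> exists N, forall m, (N <= m)%N -> m.+1%:R^-1 < e :> R.
  move=> e0; have [N _ hN] : \forall n \near \oo, n.+1%:R^-1 < e :> R.
    exact: near_infty_natSinv_lt (PosNum e0).
  by exists N => m Nm; apply: hN.
have vc : scauchy S s v.
  split=> // e e0; have e4 : 0 < e / 4 by rewrite divr_gt0.
  have [N hN] := small _ e4; exists N => m Nm.
  have [_ [ym hym dm]] := hv m; have [_ [yN hyN dN]] := hv N.
  rewrite -(creps_dist hym hyN).
  apply: (@quarter (nrm (x m - ym)) (nrm (x N - yN)) (nrm (x m - yN)) _ _ (nrm (x m - x N)) _ e
    dm dN _ (hxx m N) (hN _ Nm) (hN _ (leqnn N))).
    by rewrite -(subrKA (x N)) nrmD.
  by rewrite -(subrKA (x m)) [nrm (x m - ym)]nrmB nrmD.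
have [z hz] := scauchy_reps vc.
have xz e : 0 < e -> exists N, forall m, (N <= m)%N -> nrm (z - x m) < e.
  move=> e0; have e4 : 0 < e / 4 by rewrite divr_gt0.
  have [N1 hN1] := small _ e4; have [N2 hN2] := vc.2 _ e4.
  exists (maxn N1 N2) => m; rewrite geq_max => /andP[N1m N2m].
  have [_ [y hy d]] := hv m.
  apply: (@half (nrm (x m - y)) (nrm (z - y)) _ e _ d _ (hN1 _ N1m) e0); last first.
    by rewrite -(subrKA y) [nrm (x m - y)]nrmB nrmD.
  have h := repsB hz hy.
  rewrite cnrmE; apply: (reps_snorm_le (N := N2) h) => [|n N2n].
    by rewrite divr_ge0// ltW.
  apply: (@quarter2 _ _ _ e e0 (hN2 _ N2n) (hN2 _ N2m)).
  by rewrite [snorm s (v m - _)](snormB Ss)//; exact: (snorm_tri Ss).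
apply/cvg_ex; exists z; apply/cvg_ballP => e; rewrite ltcE/= => /andP[/eqP Ime e0].
have -> : e = (complex.Re e)%:C by rewrite [LHS]complexE Ime mulr0 addr0.
set r := complex.Re e in e0 *.
have r2 : 0 < r / 2 by rewrite divr_gt0.
have [N1 hN1] := xz _ r2; have [N2 hN2] := small _ r2.
have := hx (maxn N1 N2); apply: filterS => y; rewrite !ball_nrm => hy.
apply: (@half2 _ _ _ r _ (hN1 _ (leq_maxl N1 N2)) hy (hN2 _ (leq_maxr N1 N2))).
by rewrite -(subrKA (x (maxn N1 N2))) nrmD.
Qed.

HB.instance Definition _ := Uniform_isComplete.Build completion completion_complete.

Lemma cip_linear : forall (c : C) (x y z : completion),
  cip (c *: x + y) z = c * cip x z + cip y z.
Proof. by move=> *; exact: (si_linl cip_semi). Qed.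

Lemma cip_conj x y : cip x y = (cip y x)^*.
Proof. by apply: (si_conj cip_semi). Qed.

Lemma cip_norm (x : completion) : cip x x = `|x| ^+ 2.
Proof. by rewrite nrmE cnrmE -rmorphXn/= (snorm_sqr cip_semi)// -(snorm2E cip_semi). Qed.

HB.instance Definition _ := isHilbert.Build R completion cip_linear cip_conj cip_norm.

End CompletionType.

(** * Extension of bounded operators to the completion *)

Section BoundedOperators.
Variables (R : realType) (V W : normedModType R[i]).

Lemma bounded_continuous (f : V -> W) (K : R) : linear f ->
  (forall x, nrm (f x) <= K * nrm x) -> continuous f.
Proof.
move=> lf hf; pose A := GRing.isLinear.Build _ _ _ _ f lf.
pose g : {linear V -> W} := HB.pack f A.
apply: (@bounded_linear_continuous _ _ _ g).
apply/linear_boundedP; near=> r => x.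
have : (`|K|)%:C <= r by near: r; apply: nbhs_pinfty_ge; apply/complex_realP; exists `|K|.
rewrite !nrmE => Kr; apply: le_trans (_ : (`|K| * nrm x)%:C <= _).
  by rewrite lecR (le_trans (hf x))// ler_wpM2r ?nrm_ge0// ler_norm.
by rewrite rmorphM ler_wpM2r// ler0c nrm_ge0.
Unshelve. all: by end_near. Qed.

Lemma continuous_bounded (f : V -> W) : linear f -> continuous f ->
  exists2 K : R, 0 <= K & forall x, nrm (f x) <= K * nrm x.
Proof.
move=> lf cf; pose A := GRing.isLinear.Build _ _ _ _ f lf.
pose g : {linear V -> W} := HB.pack f A.
have /linear_bounded_continuous/linear_boundedP h : continuous g by [].
have [r r0 hr] : exists2 r : R[i], 0 < r & forall x, `|g x| <= r * `|x|.
  have [r r0 hr] := pinfty_ex_gt0 h; exists r => //.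
move: r0; rewrite ltcE/= => /andP[/eqP Imr r0].
exists (complex.Re r); first exact: ltW.
have Er : r = (complex.Re r)%:C by rewrite [LHS]complexE Imr mulr0 addr0.
by move=> x; have := hr x; rewrite {1}Er !nrmE -rmorphM lecR.
Qed.

End BoundedOperators.

Section Extension.
Variables (R : realType) (V : lmodType R[i]) (S : set V) (s : V -> V -> R[i]).
Hypothesis Ss : semi_inner S s.
Local Notation H := (completion Ss).

Record bounded_on (T : V -> V) (K : R) : Prop := BoundedOn {
  bo_S : forall x, S x -> S (T x) ;
  bo_lin : forall c x y, S x -> S y -> T (c *: x + y) = c *: T x + T y ;
  bo_ge0 : 0 <= K ;
  bo_le : forall x, S x -> snorm s (T x) <= K * snorm s x }.

(** Extension by continuity; it is meaningful for operators that are bounded on [S]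
    in the sense of [bounded_on]. *)
Definition cext (T : V -> V) (x : H) : H := xget 0 [set y | reps (T \o crep x) y].

Lemma bounded_on_B T K x y : bounded_on T K -> S x -> S y -> T (x - y) = T x - T y.
Proof. by move=> hT Sx Sy; rewrite addrC -scaleN1r (bo_lin hT)// scaleN1r addrC. Qed.

Lemma bounded_on_scauchy T K v : bounded_on T K -> scauchy S s v -> scauchy S s (T \o v).
Proof.
move=> hT [Sv hv]; have K0 := bo_ge0 hT; split=> [n|e e0]; first exact: bo_S hT _ (Sv n).
have K1 : 0 < K + 1 by lra.
have [N hN] := hv _ (divr_gt0 e0 K1); exists N => m Nm /=.
rewrite -(bounded_on_B hT)//; apply: le_lt_trans (bo_le hT (si_B Ss (Sv _) (Sv _))) _.
apply: le_lt_trans (_ : (K + 1) * snorm s (v m - v N) < _).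
  by rewrite ler_wpM2r ?snorm_ge0// lerDl.
by rewrite mulrC -ltr_pdivlMr// hN.
Qed.

Lemma reps_cext T K v x : bounded_on T K -> reps v x -> reps (T \o v) (cext T x).
Proof.
move=> hT hv; have hx := crepP x.
have h : reps (T \o crep x) (cext T x).
  rewrite /cext; case: xgetP => // nl.
  by have [y hy] := scauchy_reps Ss (bounded_on_scauchy hT (reps_scauchy hx)); case: (nl y).
apply: reps_near h _ _; first exact: bounded_on_scauchy hT (reps_scauchy hv).
apply: vanish_le (vanishM (bo_ge0 hT) (reps_eq hx hv)) => n /=.
have [Sx Sv] := (repsS n hx, repsS n hv).
by rewrite -(bounded_on_B hT)// (bo_le hT)//; exact: (si_B Ss).
Qed.

Lemma cext_linear T K : bounded_on T K -> linear (cext T).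
Proof.
move=> hT c x y; have [hx hy] := (crepP x, crepP y).
apply: (reps_uniq (reps_cext hT (reps_lin c hx hy))).
have := reps_lin c (reps_cext hT hx) (reps_cext hT hy).
congr (represents _ _ _ _); apply/funext => n /=.
by rewrite (bo_lin hT)//; [exact: repsS hx|exact: repsS hy].
Qed.

Lemma cext_le T K x : bounded_on T K -> nrm (cext T x) <= K * nrm x.
Proof.
move=> hT; have hx := crepP x; have K0 := bo_ge0 hT.
rewrite -ler_sqr ?nnegrE ?nrm_ge0 ?mulr_ge0 ?nrm_ge0// exprMn !cnrmE.
rewrite !(snorm_sqr (cip_semi Ss))//.
have h1 := reps_snorm2 (reps_cext hT hx).
have h2 := vanishM (sqr_ge0 K) (reps_snorm2 hx).
rewrite -subr_le0; apply: vanish_ge0_le h1 h2 => n /=.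
have Sx := repsS n hx.
have : snorm2 s (T (crep x n)) <= K ^+ 2 * snorm2 s (crep x n).
  rewrite -(snorm_sqr Ss (bo_S hT Sx)) -(snorm_sqr Ss Sx) -exprMn ler_sqr ?nnegrE ?mulr_ge0 ?snorm_ge0//.
  exact: bo_le hT _ Sx.
set a := snorm2 s (T _); set b := snorm2 s (crep x n) => ab.
have := ler_norm (- (a - snorm2 (@cip _ _ _ _ Ss) (cext T x))).
have : K ^+ 2 * (b - snorm2 (@cip _ _ _ _ Ss) x) <= K ^+ 2 * `|b - snorm2 (@cip _ _ _ _ Ss) x|.
  by rewrite ler_wpM2l ?sqr_ge0// ler_norm.
rewrite normrN; lra.
Qed.

Lemma cext_bounded T K : bounded_on T K -> bounded_operator (cext T).
Proof.
move=> hT; have lT := cext_linear hT; split=> //.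
by apply: (bounded_continuous lT) => x; exact: cext_le hT.
Qed.

Lemma cext_adjoint T K T' K' : bounded_on T K -> bounded_on T' K' ->
  (forall x y, S x -> S y -> s (T x) y = s x (T' y)) ->
  adjoint_operators (cext T) (cext T').
Proof.
move=> hT hT' h x y; have [hx hy] := (crepP x, crepP y).
apply: clim_uniq (reps_cip (reps_cext hT hx) hy) _.
have := reps_cip hx (reps_cext hT' hy).
by apply: vanish_le => n /=; rewrite h//; [exact: repsS hx|exact: repsS hy].
Qed.

Lemma bounded_on_comp T K T' K' : bounded_on T K -> bounded_on T' K' ->
  bounded_on (T \o T') (K * K').
Proof.
move=> hT hT'; split=> /=.
- by move=> y Sy; apply: (bo_S hT); exact: (bo_S hT').
- by move=> c y z Sy Sz; rewrite (bo_lin hT')// (bo_lin hT)//; exact: (bo_S hT').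
- by rewrite mulr_ge0 ?(bo_ge0 hT) ?(bo_ge0 hT').
- move=> y Sy; apply: le_trans (bo_le hT (bo_S hT' Sy)) _.
  by rewrite -mulrA ler_wpM2l ?(bo_ge0 hT)// (bo_le hT').
Qed.

Lemma cext_comp T K T' K' x : bounded_on T K -> bounded_on T' K' ->
  cext T (cext T' x) = cext (T \o T') x.
Proof.
move=> hT hT'; have hx := crepP x.
have h : reps ((T \o T') \o crep x) (cext T (cext T' x)).
  exact: reps_cext hT (reps_cext hT' hx).
exact: reps_uniq h (reps_cext (bounded_on_comp hT hT') hx).
Qed.

Lemma cext_id T x : (forall y, S y -> T y = y) -> cext T x = x.
Proof.
move=> h; have hx := crepP x.
have hT : bounded_on T 1.
  split=> //; first by move=> y Sy; rewrite h.
    by move=> c y z Sy Sz; rewrite !h//; exact: (si_lin Ss).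
  by move=> y Sy; rewrite h// mul1r.
apply: (reps_uniq (reps_cext hT hx)).
rewrite (_ : T \o crep x = crep x)//; apply/funext => n /=; rewrite h//.
exact: repsS hx.
Qed.

Lemma cext_lin c T T' T'' K K' K'' x : bounded_on T K -> bounded_on T' K' ->
  bounded_on T'' K'' -> (forall y, S y -> T'' y = c *: T y + T' y) ->
  cext T'' x = c *: cext T x + cext T' x.
Proof.
move=> hT hT' hT'' h; have hx := crepP x.
apply: (reps_uniq (reps_cext hT'' hx)).
have := reps_lin c (reps_cext hT hx) (reps_cext hT' hx).
by congr (represents _ _ _ _); apply/funext => n /=; rewrite h//; exact: repsS hx.
Qed.

End Extension.

(** * Contractivity of representations and characters *)

Lemma normed_cauchy (R : realType) (V : completeNormedModType R[i]) (u : nat -> V) :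
  (forall e : R, 0 < e -> exists N, forall m, (N <= m)%N -> nrm (u m - u N) < e) ->
  exists l, vanish (fun n => nrm (u n - l)).
Proof.
move=> h; have /cvg_ex[l hl] : cvgn u.
  apply/cauchy_cvgP; apply: cauchy_exP => e; rewrite ltcE/= => /andP[/eqP Ime e0].
  have -> : e = (complex.Re e)%:C by rewrite [LHS]complexE Ime mulr0 addr0.
  have [N hN] := h _ e0; exists (u N); exists N => // n /= Nn.
  by rewrite ball_nrm nrmB; exact: hN.
exists l => e e0; have e0' : 0 < e%:C by rewrite -[0]/(0%:C) ltcR.
move/cvgrPdist_lt : hl => /(_ _ e0') hl.
near=> n; rewrite nrmB -ltcR -nrmE; near: n; exact: hl.
Unshelve. all: by end_near. Qed.

Section Algebra.
Variables (R : realType) (A : cstarType R).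
Local Notation C := (R[i]).
Implicit Types x y z : A.
Local Notation I := (cone A).

Lemma cmul0l x : (0 : A) ** x = 0.
Proof.
have := cmul_linearl 1%R (0 : A) 0 x; rewrite !scale1r addr0 => h.
by apply: (addrI (0 ** x)); rewrite addr0 -h.
Qed.

Lemma cmulDl x y z : (x + y) ** z = x ** z + y ** z.
Proof. by have := cmul_linearl 1%R x y z; rewrite !scale1r. Qed.
Lemma cmulDr x y z : z ** (x + y) = z ** x + z ** y.
Proof. by have := cmul_linearr 1%R x y z; rewrite !scale1r. Qed.
Lemma cmulNl x z : (- x) ** z = - (x ** z).
Proof. by apply/eqP; rewrite -addr_eq0 -cmulDl addNr cmul0l. Qed.
Lemma cmulZl (c : C) x z : (c *: x) ** z = c *: (x ** z).
Proof. by rewrite -[c *: x]addr0 cmul_linearl cmul0l addr0. Qed.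
Lemma cmul0r x : x ** (0 : A) = 0.
Proof.
have := cmul_linearr 1%R (0 : A) 0 x; rewrite !scale1r addr0 => h.
by apply: (addrI (x ** 0)); rewrite addr0 -h.
Qed.
Lemma cmulNr x z : z ** (- x) = - (z ** x).
Proof. by apply/eqP; rewrite -addr_eq0 -cmulDr addNr cmul0r. Qed.
Lemma cmulZr (c : C) x z : z ** (c *: x) = c *: (z ** x).
Proof. by rewrite -[c *: x]addr0 cmul_linearr cmul0r addr0. Qed.

Lemma nrm_cmul x y : nrm (x ** y) <= nrm x * nrm y.
Proof. by rewrite -lecR rmorphM/= -!nrmE cnormM. Qed.

Lemma nrm_cstar_sq x : nrm (x^† ** x) = nrm x ^+ 2.
Proof. by apply: complexI; rewrite rmorphXn/= -!nrmE cnorm_star. Qed.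

Lemma nrm_cstar x : nrm (x^†) = nrm x.
Proof.
suff h y : nrm y <= nrm (y^†) by apply/le_anti; rewrite h -{2}[x]cstarK h.
have [->|y0] := eqVneq (nrm y) 0%R; first exact: nrm_ge0.
have y1 : (0 < nrm y)%R by rewrite lt_neqAle eq_sym y0 nrm_ge0.
by rewrite -(ler_pM2r y1) -expr2 -nrm_cstar_sq nrm_cmul.
Qed.

(** The inverse is the sum of the powers of [z], which are bounded by [|1| |z|^n]. *)
Lemma neumann z : (nrm z < 1)%R -> exists b, b ** (I - z) = I.
Proof.
move=> z1; set r := nrm z in z1; have r0 : (0 <= r)%R := nrm_ge0 z.
have r1 : (0 < 1 - r)%R by rewrite subr_gt0.
pose q n := iter n (cmul z) I; pose p n := \sum_(k < n) q k.
have q_le n : (nrm (q n) <= nrm I * r ^+ n)%R.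
  elim: n => [|n IH]; first by rewrite expr0 mulr1.
  by rewrite /q /= (le_trans (nrm_cmul _ _))// exprS mulrCA ler_wpM2l.
have qz n : q n ** z = q n.+1.
  elim: n => [|n IH]; first by rewrite /q /= cmul1l cmul1r.
  by rewrite /q /= -cmulA -/(q n) IH.
have pz n : p n ** (I - z) = I - q n.
  elim: n => [|n IH]; first by rewrite /p big_ord0 cmul0l /q/= subrr.
  rewrite /p big_ord_recr/= cmulDl -/(p n) IH cmulDr cmul1r cmulNr qz.
  by rewrite addrA subrK.
have p_le N k : (nrm (p (N + k)%N - p N) <= nrm I / (1 - r) * (r ^+ N - r ^+ (N + k)))%R.
  elim: k => [|k IH]; first by rewrite addn0 !subrr nrm0 mulr0.
  rewrite addnS /p big_ord_recr/= -/(p (N + k)%N) addrAC.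
  rewrite (le_trans (nrmD _ _))// (le_trans (lerD IH (q_le _)))//.
  by rewrite le_eqVlt; apply/orP; left; apply/eqP; rewrite exprS; field; lra.
have qv : vanish (fun n => nrm I * r ^+ n)%R.
  apply: vanishM (nrm_ge0 _) _; apply/vanish_cvg => [n|]; first exact: exprn_ge0.
  by apply: cvg_expr; rewrite ger0_norm.
have [b hb] : exists b, vanish (fun n => nrm (p n - b)).
  apply: normed_cauchy => e e0; have := vanishM (ltW (_ : 0 < (1 - r)^-1)%R) qv.
  rewrite invr_gt0 => /(_ r1)/(_ _ e0)[N _ hN]; exists N => m Nm.
  rewrite -(subnKC Nm); apply: le_lt_trans (p_le _ _) _.
  apply: le_lt_trans (hN N _) => //=; rewrite mulrA [(_^-1 * _)%R]mulrC.
  by rewrite ler_wpM2l ?divr_ge0 ?nrm_ge0 ?(ltW r1)// gerBl exprn_ge0.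
exists b; apply/subr0_eq/nrm_eq0/le_anti; rewrite nrm_ge0 andbT.
apply: vanish_ge0_le (vanishM (nrm_ge0 (I - z)) hb) qv => n.
rewrite mulrC nrmB; apply: (le_trans _ (lerD (nrm_cmul _ _) (q_le n))).
rewrite cmulDl cmulNl pz; apply: le_trans (nrmD _ _).
by rewrite [_ + q n]addrAC subrK.
Qed.

Lemma resolvent (l : C) x : (nrm x < nrm l)%R -> exists b, b ** (l *: I - x) = I.
Proof.
move=> xl; have l0 : (0 < nrm l)%R := le_lt_trans (nrm_ge0 x) xl.
have ln0 : l != 0 by apply: contraTneq l0 => ->; rewrite nrm0 ltxx.
have h : (nrm (l^-1 *: x) < 1)%R.
  rewrite nrmZ -(ltr_pM2l l0) mulrA -nrmM divff// nrm1 mul1r mulr1//.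
have [b hb] := neumann h; exists (l^-1 *: b).
rewrite cmulZl -cmulZr scalerBr scalerA mulVf// scale1r//.
Qed.

(** If [|e x| > |x|], then [e x - x] is invertible, but [e] maps it to zero. *)
Lemma character_le (e : A -> C) x : star_character e -> (nrm (e x) <= nrm x)%R.
Proof.
move=> he; rewrite leNgt; apply/negP => /resolvent[b /(congr1 e)].
have eB (c : C) y z : e (c *: y - z) = (c * e y - e z)%R.
  have e0 : e 0 = 0.
    have := sc_linear he 1%R 0 0; rewrite scale1r mul1r addr0 => h.
    by apply: (addrI (e 0)); rewrite addr0 -h.
  rewrite (sc_linear he) -scaleN1r -[-1 *: z]addr0 (sc_linear he) mulN1r.
  by rewrite e0 addr0.
rewrite (sc_mul he) eB (sc_one he) mulr1 subrr mulr0 => /eqP.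
by rewrite eq_sym oner_eq0.
Qed.

Section Representation.
Variables (H : hilbertType R) (pi : A -> H -> H).
Hypothesis hpi : representation pi.

Let piZ c x xi : pi (c *: x) xi = c *: pi x xi.
Proof.
have h0 : pi 0 xi = 0.
  have := rep_linear hpi 1%R 0 0 xi; rewrite !scale1r addr0 => h.
  by apply: (addrI (pi 0 xi)); rewrite addr0 -h.
by rewrite -[c *: x]addr0 (rep_linear hpi) h0 addr0.
Qed.

Let piB x y xi : pi (x - y) xi = pi x xi - pi y xi.
Proof. by rewrite addrC -scaleN1r (rep_linear hpi) scaleN1r addrC. Qed.

(** Let [l] be the least constant such that [|pi x xi|^2 <= l |xi|^2]. Were [l] larger
    than [|x|^2], the element [l - x^† x] would be invertible, so [l - pi (x^† x)]
    would be bounded below; as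
    [|(l - pi (x^† x)) xi|^2 <= 2 l (l |xi|^2 - |pi x xi|^2)],
    this would keep [|pi x xi|^2] away from [l |xi|^2], contradicting minimality. *)
Lemma rep_contractive x xi : (nrm (pi x xi) <= nrm x * nrm xi)%R.
Proof.
have [lx cx] := rep_bounded hpi x.
have lin0 : pi x 0 = 0.
  by have := lx (-1)%R 0 0; rewrite scaler0 addr0 scaleN1r addNr.
pose P (r : R) := (0 <= r)%R /\ forall xi, (nrm (pi x xi) ^+ 2 <= r * nrm xi ^+ 2)%R.
have [K K0 hK] := continuous_bounded lx cx.
have hinf : has_inf [set r | P r].
  split; last by exists 0%R => r [].
  exists (K ^+ 2)%R; split; first exact: sqr_ge0.
  by move=> v; rewrite -exprMn ler_sqr ?nnegrE ?nrm_ge0 ?mulr_ge0 ?nrm_ge0.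
pose l := inf [set r | P r].
have l0 : (0 <= l)%R by apply: lb_le_inf; [case: hinf|move=> r []].
have hl v : (nrm (pi x v) ^+ 2 <= l * nrm v ^+ 2)%R.
  have [v0|v0] := eqVneq v 0; first by rewrite v0 lin0 !nrm0 expr0n mulr0.
  have v1 : (0 < nrm v ^+ 2)%R.
    by rewrite exprn_gt0// lt_neqAle nrm_ge0 andbT eq_sym; apply: contra v0 => /eqP/nrm_eq0 ->.
  rewrite -ler_pdivrMr//; apply: lb_le_inf; first by case: hinf.
  by move=> r [_ hr]; rewrite ler_pdivrMr.
have [|lx2] := leP l (nrm x ^+ 2).
  move=> h; rewrite -ler_sqr ?nnegrE ?nrm_ge0 ?mulr_ge0 ?nrm_ge0// exprMn.
  by rewrite (le_trans (hl _))// ler_wpM2r ?sqr_ge0.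
exfalso.
have lpos : (0 < l)%R := le_lt_trans (sqr_ge0 _) lx2.
have hs v : (nrm (pi (x^†) v) ^+ 2 <= l * nrm v ^+ 2)%R.
  have := ip_le (pi x (pi (x^†) v)) v.
  rewrite (rep_star hpi) ip_norm nrmE -rmorphXn nrm_real ?sqr_ge0// => h1.
  have := hl (pi (x^†) v).
  set a := nrm (pi (x^†) v) in h1 *; set t := nrm (pi x _) in h1 * => h2.
  have a0 : (0 <= a)%R := nrm_ge0 _; have t0 : (0 <= t)%R := nrm_ge0 _.
  have := nrm_ge0 v; set n := nrm v in h1 * => n0.
  have [a00|ane] := eqVneq a 0%R; first by rewrite a00 expr0n mulr_ge0 ?sqr_ge0.
  have a1 : (0 < a ^+ 2)%R by rewrite exprn_gt0// lt_neqAle eq_sym ane.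
  rewrite -(ler_pM2r a1) -expr2.
  apply: (@le_trans _ _ ((t * n) ^+ 2)%R).
    by rewrite ler_sqr ?nnegrE ?sqr_ge0 ?mulr_ge0.
  have h3 : (t ^+ 2 * n ^+ 2 <= l * a ^+ 2 * n ^+ 2)%R by rewrite ler_wpM2r ?sqr_ge0.
  by rewrite exprMn (le_trans h3)// mulrAC.
have y_lt : (nrm (x^† ** x) < nrm (l%:C : C))%R by rewrite nrm_cstar_sq nrm_real.
have [b hb] := resolvent y_lt.
have [lb cb] := rep_bounded hpi b.
have [M M0 hM] := continuous_bounded lb cb.
have key v : (nrm v ^+ 2 <= (M + 1) ^+ 2 * (2 * l) * (l * nrm v ^+ 2 - nrm (pi x v) ^+ 2))%R.
  pose w := l%:C *: v - pi (x^†) (pi x v).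
  have Ev : v = pi b w.
    rewrite -[LHS](_ : pi (cone A) v = _); last by rewrite (rep_one hpi).
    by rewrite -hb (rep_mul hpi)/= piB piZ (rep_one hpi) (rep_mul hpi).
  have bw : (nrm (pi b w) <= (M + 1) * nrm w)%R.
    by rewrite (le_trans (hM _))// ler_wpM2r ?nrm_ge0// lerDl.
  have ww : (nrm w ^+ 2 <= 2 * l * (l * nrm v ^+ 2 - nrm (pi x v) ^+ 2))%R.
    rewrite -[(nrm w ^+ 2)%R]nrm_snorm2 /w -[- pi (x^†) (pi x v)]scaleN1r (snorm2D (ip_semi H))// !(snorm2Z (ip_semi H))//.
    rewrite (si_Zl (ip_semi H))// (si_Zr (ip_semi H))//.
    rewrite nrmN nrm1 expr1n mul1r nrm_real// !nrm_snorm2.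
    have -> : ip v (pi (x^†) (pi x v)) = (nrm (pi x v) ^+ 2)%:C.
      by rewrite -(rep_star hpi) ip_norm nrmE rmorphXn.
    rewrite rmorphN1 mulN1r mulrN -rmorphM raddfN/=.
    have := hs (pi x v); have := hl v.
    set a := nrm (pi x v); set c := nrm (pi (x^†) _); set n := nrm v.
    rewrite mulr2n => h1 h2; have : (0 <= l * (l * n ^+ 2 - a ^+ 2))%R.
      by rewrite mulr_ge0// subr_ge0.
    by nra.
  apply: (@le_trans _ _ (((M + 1) * nrm w) ^+ 2)%R).
    by rewrite {1}Ev ler_sqr ?nnegrE ?nrm_ge0 ?mulr_ge0 ?nrm_ge0 ?addr_ge0.
  by rewrite exprMn -mulrA ler_wpM2l ?sqr_ge0.
have D0 : (0 < (M + 1) ^+ 2 * (2 * l))%R by rewrite mulr_gt0 ?exprn_gt0 ?mulr_gt0//; lra.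
set D := ((M + 1) ^+ 2 * (2 * l))%R in key D0.
have Pm : P (Num.max 0 (l - D^-1)).
  split; first by rewrite le_max lexx.
  move=> v; apply: (@le_trans _ _ ((l - D^-1) * nrm v ^+ 2)%R); last first.
    by rewrite ler_wpM2r ?sqr_ge0// le_max lexx orbT.
  by rewrite mulrBl lerBrDl addrC -lerBrDl mulrC ler_pdivrMr// mulrC.
have : (l <= Num.max 0 (l - D^-1))%R by apply: ge_inf => //; case: hinf.
by rewrite le_max leNgt lpos/= lerBrDl gerDr leNgt invr_gt0 D0.
Qed.

End Representation.
End Algebra.

(** * Property (T) of the dual and covariant representations *)

Section AlmostInvariant.
Variables (R : realType) (A : cstarType R) (e : A -> R[i]) (H : hilbertType R).
Variables (pi : A -> H -> H) (xi : nat -> H) (K : R).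
Hypotheses (he : star_character e) (hpi : representation pi).
Hypotheses (K0 : 0 <= K) (xi_le : forall n, nrm (xi n) <= K).

Definition almost_invariant x := vanish (fun n => nrm (pi x (xi n) - e x *: xi n)).

Lemma almost_invariantD (c : R[i]) x y : almost_invariant x -> almost_invariant y ->
  almost_invariant (c *: x + y).
Proof.
move=> hx hy; apply: vanish_le (vanishD (vanishM (nrm_ge0 c) hx) hy) => n.
rewrite (rep_linear hpi) (sc_linear he) -nrmZ; apply: le_trans (nrmD _ _).
by rewrite scalerBr scalerDl scalerA opprD addrACA.
Qed.

Lemma almost_invariantM x y : almost_invariant x -> almost_invariant y ->
  almost_invariant (x ** y).
Proof.
move=> hx hy.
apply: vanish_le (vanishD (vanishM (nrm_ge0 x) hy) (vanishM (nrm_ge0 (e y)) hx)) => n.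
rewrite -nrmZ; apply: (le_trans _ (lerD (rep_contractive hpi _ _) (lexx _))).
apply: le_trans (nrmD _ _); rewrite (rep_mul hpi)/= (sc_mul he).
have lx := (rep_bounded hpi x).1.
have -> : pi x (pi y (xi n) - e y *: xi n) = pi x (pi y (xi n)) - e y *: pi x (xi n).
  by rewrite addrC -scaleNr lx scaleNr addrC.
by rewrite scalerBr scalerA [e y * e x]mulrC addrA subrK.
Qed.

Lemma almost_invariant1 : almost_invariant (cone A).
Proof.
by apply: vanish_le (@vanish0 R) => n; rewrite (rep_one hpi) (sc_one he) scale1r subrr nrm0.
Qed.

Lemma almost_invariant_closed x : 
  (forall d : R, 0 < d -> exists2 y, almost_invariant y & nrm (x - y) < d) ->
  almost_invariant x.
Proof.
move=> hx d d0; have K1 : 0 < K + 1 by rewrite ltr_wpDl.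
have d4 : 0 < d / 4 / (K + 1) by rewrite !divr_gt0.
have [y hy xy] := hx _ d4; have d2 : 0 < d / 2 by rewrite divr_gt0.
near=> n.
have hn : nrm (pi y (xi n) - e y *: xi n) < d / 2 by near: n; exact: hy.
have -> : pi x (xi n) - e x *: xi n =
  pi (x - y) (xi n) + (pi y (xi n) - e y *: xi n) - e (x - y) *: xi n.
  have -> : x - y = -1 *: y + x by rewrite scaleN1r addrC.
  rewrite (rep_linear hpi) (sc_linear he) mulN1r scaleN1r scalerDl scaleNr.
  by rewrite [- pi y _ + _]addrC subrKA opprD opprK subrKA.
have h1 : nrm (pi (x - y) (xi n)) <= d / 4.
  rewrite (le_trans (rep_contractive hpi _ _))//.
  rewrite (@le_trans _ _ (nrm (x - y) * (K + 1)))//.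
    by rewrite ler_wpM2l ?nrm_ge0// (le_trans (xi_le n))// lerDl.
  by rewrite -ler_pdivlMr// ltW.
have h2 : nrm (e (x - y) *: xi n) <= d / 4.
  rewrite nrmZ (@le_trans _ _ (nrm (x - y) * (K + 1)))//.
    by rewrite ler_pM ?nrm_ge0 ?character_le// (le_trans (xi_le n))// lerDl.
  by rewrite -ler_pdivlMr// ltW.
apply: le_lt_trans (nrmD _ _) _; rewrite nrmN.
have := nrmD (pi (x - y) (xi n)) (pi y (xi n) - e y *: xi n).
set a := nrm (_ + _); move: a h1 h2 hn => a.
move: (nrm (pi (x - y) _)) (nrm (e _ *: _)) (nrm (_ - _)) => p q r.
lra.
Unshelve. all: by end_near. Qed.

(** The elements [x] on which [pi] and [e] almost agree along [xi] form a closed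
    subalgebra, by contractivity. As this condition on [x] does not obviously
    pass to [x^†], it is imposed on both. *)
Lemma almost_invariant_generated (S : set A) : generates S ->
  (forall x, S x -> almost_invariant x /\ almost_invariant (x^†)) ->
  forall x, almost_invariant x.
Proof.
move=> gS hS; pose B := [set x | almost_invariant x /\ almost_invariant (x^†)].
suff BT : B = setT by move=> x; have [] : B x by rewrite BT.
apply: gS => //.
- move=> x Bx.
  have near_x d : 0 < d -> exists2 y, B y & nrm (x - y) < d.
    move=> d0; have d0' : 0 < d%:C by rewrite -[0]/(0%:C) ltcR.
    have [y [By]] := Bx _ (nbhsx_ballx x _ d0').
    by rewrite ball_nrm => xy; exists y.
  split; apply: almost_invariant_closed => d /near_x[y [By By'] xy]; first by exists y.
  exists (y^†) => //; have -> : x^† - y^† = (x - y)^†; last by rewrite nrm_cstar.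
  have -> : x - y = -1 *: y + x by rewrite scaleN1r addrC.
  by rewrite cstar_antilinear rmorphN1 scaleN1r addrC.
- split; first exact: almost_invariant1.
  suff -> : (cone A)^† = cone A by exact: almost_invariant1.
  by rewrite -[LHS]cmul1l -{1}[cone A]cstarK -cstarM cmul1l cstarK.
- move=> c x y [h1 h2] [h3 h4]; split; first exact: almost_invariantD.
  by rewrite cstar_antilinear; exact: almost_invariantD.
- move=> x y [h1 h2] [h3 h4]; split; first exact: almost_invariantM.
  by rewrite cstarM; exact: almost_invariantM.
- by move=> x [h1 h2]; split; rewrite ?cstarK.
Qed.

End AlmostInvariant.

Section BicrossedProduct.
Variables (R : realType) (Gam G : topGroupType).
Variables (alpha : Gam -> G -> G) (beta : G -> Gam -> Gam).
Variable QG : bicrossed_product R alpha beta.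
Local Notation a := (@bc_fun _ _ _ _ _ QG).
Local Notation u := (@bc_u _ _ _ _ _ QG).
Local Notation eps := (@bc_counit _ _ _ _ _ QG).
Local Notation cp := (bc_crossed_product QG).

Lemma bc_u1 : u 1%g = cone QG.
Proof.
have h := cp_mul cp 1%g 1%g; rewrite mulg1 in h.
by rewrite -[LHS]cmul1l -(cp_unitaryl cp 1%g) -cmulA -h.
Qed.

Lemma bc_uV c : u c^-1%g = (u c)^†.
Proof.
by rewrite -[LHS]cmul1r -(cp_unitaryr cp c) cmulA -(cp_mul cp) mulVg bc_u1 cmul1l.
Qed.

Lemma counit_u c : eps (u c) = 1.
Proof.
have c1 : continuous (fun _ : G => 1 : cplx R) by move=> x; exact: cst_continuous.
have := bc_counitE QG c c1.
by rewrite (fh_one (cp_function cp)) cmul1r.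
Qed.

Lemma counit_fun (F : G -> cplx R) : continuous F -> eps (a F) = F 1%g.
Proof. by move=> cF; have := bc_counitE QG 1%g cF; rewrite bc_u1 cmul1l. Qed.

Lemma conj_continuous (F : G -> cplx R) : continuous F -> continuous (fun x => (F x)^* : cplx R).
Proof.
move=> cF x; apply/cvgrPdist_lt => d d0; have := cF x; move/cvgrPdist_lt => /(_ d d0).
by apply: filterS => y; rewrite -rmorphB norm_conjC.
Qed.

(** The sequence [xi] need not be normalized: it is also used with a constant
    sequence, for exactly invariant vectors. *)
Lemma almost_invariant_counit (H : hilbertType R) (pi : QG -> H -> H) (xi : nat -> H) K :
  representation pi -> 0 <= K -> (forall n, nrm (xi n) <= K) ->
  (forall F : G -> cplx R, continuous F ->
     vanish (fun n => nrm (pi (a F) (xi n) - F 1%g *: xi n))) ->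
  (forall c, vanish (fun n => nrm (pi (u c) (xi n) - xi n))) ->
  forall x, vanish (fun n => nrm (pi x (xi n) - eps x *: xi n)).
Proof.
move=> hpi K0 hK hF hc.
apply: (almost_invariant_generated (bc_counit_character QG) hpi K0 hK (cp_generated cp)).
have ha F : continuous F -> almost_invariant eps pi xi (a F).
  by move=> cF; apply: vanish_le (hF _ cF) => n; rewrite counit_fun.
have hu c : almost_invariant eps pi xi (u c).
  by apply: vanish_le (hc c) => n; rewrite counit_u scale1r.
move=> x [[F cF <-]|[c _ <-]]; split=> //; first exact: ha.
- by rewrite -(fh_star (cp_function cp))//; apply: ha; exact: conj_continuous.
- by rewrite -bc_uV.
Qed.

(** By the universal property of the full crossed product, property (T) of the dual
    can be tested on covariant pairs, and on the generators of the algebra. *)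
Lemma dual_property_T_covariant (H : hilbertType R) pi U : dual_property_T QG ->
  @covariant_rep R Gam G alpha H pi U ->
  (exists2 xi : nat -> H, forall n, nrm (xi n) = 1 &
    (forall F : G -> cplx R, continuous F ->
       vanish (fun n => nrm (pi F (xi n) - F 1%g *: xi n))) /\
    (forall c, vanish (fun n => nrm (U c (xi n) - xi n)))) ->
  exists xi : H, [/\ xi <> 0,
    forall F : G -> cplx R, continuous F -> pi F xi = F 1%g *: xi &
    forall c, U c xi = xi].
Proof.
move=> T hcov [xi xi1 [hF hc]].
have [rho hrho [rhoF rhou]] := cp_universal cp hcov.
have hx : forall x, vanish (fun n => nrm (rho x (xi n) - eps x *: xi n)).
  apply: (almost_invariant_counit hrho ler01) => [n|F cF|c]; first by rewrite xi1.
    by apply: vanish_le (hF F cF) => n; rewrite rhoF.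
  by apply: vanish_le (hc c) => n; rewrite rhou.
have [|v v0 hv] := T H rho hrho.
  exists xi => [n|x]; first by rewrite nrmE xi1.
  apply/cvgrPdist_lt => d; rewrite ltcE/= => /andP[/eqP Imd d0].
  have -> : d = (complex.Re d)%:C by rewrite [LHS]complexE Imd mulr0 addr0.
  have := hx x _ d0; apply: filterS => n.
  by rewrite sub0r normrN normr_id nrmE ltcR.
exists v; split=> // [F cF|c].
  by rewrite -rhoF// hv counit_fun.
by rewrite -rhou hv counit_u scale1r.
Qed.

End BicrossedProduct.

(** * Borel sets and topological groups *)

Section Borel.

Lemma borel_open (X : ptopologicalType) (U : set X) : open U -> measurable (U : set (borel X)).
Proof. exact: sub_sigma_algebra. Qed.

Lemma borel_closed (X : ptopologicalType) (U : set X) :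
  closed U -> measurable (U : set (borel X)).
Proof.
by move=> cU; rewrite -[U]setCK; apply: measurableC; apply: borel_open; exact: closed_openC.
Qed.

Lemma borel_continuous (X Y : ptopologicalType) (f : X -> Y) : continuous f ->
  measurable_fun setT (f : borel X -> borel Y).
Proof.
move=> cf; apply: (@measurability _ _ (borel X) (borel Y) setT f (@open Y)) => //.
move=> _ [U oU <-]; rewrite setTI; apply: borel_open.
by apply: open_comp => // x _; exact: cf.
Qed.

Lemma borel_continuous_real (R : realType) (X : ptopologicalType) (f : X -> R) :
  continuous f -> measurable_fun setT (f : borel X -> R).
Proof.
move=> cf; apply: (measurability _ (RGenOpens.measurableE R)).
move=> _ [_ [a [b ->]] <-]; rewrite setTI; apply: borel_open.
by apply: open_comp => [x _|]; [exact: cf|exact: interval_open].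
Qed.

End Borel.

Lemma countable_enum (T : choiceType) (A : set T) a0 : countable A -> A a0 ->
  exists g : nat -> T, (forall n, A (g n)) /\ forall a, A a -> exists n, g n = a.
Proof.
move=> /countable_injP[f fI] Aa0.
exists (fun n => xget a0 [set a | A a /\ f a = n]); split=> [n|a Aa].
  by case: xgetP => // a _ [].
exists (f a); case: xgetP => [b _ [Ab /fI]|/(_ a)[]//]; first by rewrite !inE; exact.
Qed.

Section TopGroup.
Variable X : topGroupType.
Implicit Types (x y : X) (W O : set X).

Lemma mulg_cvg (T : Type) (F : set_system T) (FF : Filter F) (f g : T -> X) x y :
  f @ F --> x -> g @ F --> y -> (fun t => (f t * g t)%g) @ F --> (x * y)%g.
Proof.
move=> fx gy.
exact (@continuous2_cvg T X X X F FF f g (fun a b : X => (a * b)%g) x y (@mulg_continuous X (x, y)) fx gy).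
Qed.

Lemma invg_cvg (T : Type) (F : set_system T) (FF : Filter F) (f : T -> X) x :
  f @ F --> x -> (fun t => (f t)^-1%g) @ F --> x^-1%g.
Proof. by move=> fx; apply: continuous_cvg => //; exact: invg_continuous. Qed.

Lemma mulg_contl x : continuous (fun y : X => (x * y)%g).
Proof. by move=> y; apply: mulg_cvg; [exact: cvg_cst|exact: cvg_id]. Qed.

Lemma mulg_contr x : continuous (fun y : X => (y * x)%g).
Proof. by move=> y; apply: mulg_cvg; [exact: cvg_id|exact: cvg_cst]. Qed.

Lemma nbhs_div W : nbhs (1%g : X) W ->
  exists2 O, open_nbhs (1%g : X) O & forall x y, O x -> O y -> W (x^-1 * y)%g.
Proof.
move=> W1; have h : (fun p : X * X => (p.1^-1 * p.2)%g) @ (1%g, 1%g) --> (1%g : X).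
  have h1 : (fun p : X * X => p.1) @ (1%g, 1%g) --> (1%g : X) by exact: cvg_fst.
  have h2 : (fun p : X * X => p.2) @ (1%g, 1%g) --> (1%g : X) by exact: cvg_snd.
  by have := mulg_cvg _ (invg_cvg _ h1) h2; rewrite invg1 mulg1; apply.
have [[A B] [/= A1 B1] AB] := h _ W1.
have : nbhs (1%g : X) (A `&` B) by apply: filterI; [exact: A1|exact: B1].
rewrite nbhsE => -[ O oO OAB]; exists O => // x y Ox Oy.
by apply: (AB (x, y)); split; [case: (OAB _ Ox)|case: (OAB _ Oy)].
Qed.

Lemma nbhs_mul W : nbhs (1%g : X) W ->
  exists2 O, nbhs (1%g : X) O & forall x y, O x -> O y -> W (x * y)%g.
Proof.
move=> W1; have h : (fun p : X * X => (p.1 * p.2)%g) @ (1%g, 1%g) --> (1%g : X).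
  have h1 : (fun p : X * X => p.1) @ (1%g, 1%g) --> (1%g : X) by exact: cvg_fst.
  have h2 : (fun p : X * X => p.2) @ (1%g, 1%g) --> (1%g : X) by exact: cvg_snd.
  by have := mulg_cvg _ h1 h2; rewrite mulg1; apply.
have [[A B] [/= A1 B1] AB] := h _ W1.
exists (A `&` B); first exact: filterI.
by move=> x y [Ax _] [_ By]; exact: (AB (x, y)).
Qed.

Lemma open_lcoset x O : open O -> open [set y | O (x^-1 * y)%g].
Proof. by move=> oO; apply: open_comp => // y _; exact: mulg_contl. Qed.

Hypotheses (cptX : compact [set: X]) (hX : hausdorff_space X).

Lemma nbhs_closed W : nbhs (1%g : X) W -> exists2 O, nbhs (1%g : X) O & closed O /\ O `<=` W.
Proof.
move=> W1.
have [ O O1 OW] := compact_regular hX cptX (filterT (F := nbhs (1%g : X))) W1.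
exists (closure O); first by apply: filterS O1; exact: subset_closure.
by split=> //; exact: closed_closure.
Qed.

Lemma finite_translates O : open_nbhs (1%g : X) O ->
  exists s : seq X, forall x, has (fun y => `[< O (y^-1 * x)%g >]) s.
Proof.
move=> [oO O1]; have := cptX; rewrite compact_cover => /(_ X setT (fun y => [set x | O (y^-1 * x)%g])).
case=> [y _|x _|D _ cD]; first exact: open_lcoset.
  by exists x => //=; rewrite mulVg.
exists (enum_fset D) => x; have [y Dy Oy] := cD x I.
by apply/hasP; exists y => //; apply/asboolP.
Qed.

(** Total boundedness of a compact group for its left uniformity, as a colouring by
    finitely many colours. *)
Lemma finite_classes W : nbhs (1%g : X) W -> exists M (q : X -> 'I_M),
  forall x y, q x = q y -> W (x^-1 * y)%g.
Proof.
move=> /nbhs_div[ O /finite_translates[s hs] OW].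
exists (size s), (fun x => Ordinal (etrans (esym (has_find _ _)) (hs x))) => x y /(congr1 val) /= e.
have := nth_find 1%g (hs x); have := nth_find 1%g (hs y).
rewrite -e; set z := nth _ _ _ => /asboolP Oy /asboolP Ox.
by have := OW _ _ Ox Oy; rewrite invgM invgK -mulgA mulVKg.
Qed.

Hypothesis scX : @second_countable X.

Lemma countable_nbhs_base : exists N : nat -> set X,
  (forall n, nbhs (1%g : X) (N n) /\ closed (N n)) /\
  (forall n m, (n <= m)%N -> N m `<=` N n) /\
  forall W, nbhs (1%g : X) W -> exists n, N n `<=` W.
Proof.
have [B cB [oB bB]] := scX.
have [U0 [BU0 _] _] := bB (1%g : X) setT filterT.
have [f [fB hf]] := countable_enum cB BU0.
have hM k : exists M, [/\ nbhs (1%g : X) M, closed M & f k 1%g -> M `<=` f k].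
  have [fk|nfk] := pselect (f k 1%g); last by exists setT; split=> //; exact: filterT.
  have [ O O1 [cO OW]] := nbhs_closed (open_nbhs_nbhs (conj (oB _ (fB k)) fk)).
  by exists O; split.
have /choice[M hM'] := hM.
pose N := nat_rect (fun=> set X) (M 0%N) (fun n A => A `&` M n.+1).
exists N; split=> [|].
  elim=> [|n [N1 cN]]; first by case: (hM' 0%N).
  by have [M1 cM _] := hM' n.+1; split; [exact: filterI|exact: closedI].
split=> [n m|W W1].
  move=> /subnKC <-; elim: (m - n)%N => [|k IH]; first by rewrite addn0.
  by rewrite addnS => x [/IH].
have [U [BU U1] UW] := bB _ _ W1; have [k fk] := hf _ BU.
exists k; apply: subset_trans UW => x Nx.
have Mx : M k x by case: k Nx {fk} => [|k] // [].
by have [_ _] := hM' k; rewrite fk; apply.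
Qed.
End TopGroup.

(** * Bounded measurable functions as a semi-inner product space *)

Section ComplexIntegral.
Context d (T : measurableType d) (R : realType) (nu : {measure set T -> \bar R}).
Hypothesis nu_fin : (nu setT < +oo)%E.
Local Notation C := (R[i]).

(** Bounded measurable functions: being integrable for every finite measure and stable
    under products, they spare [L2] all integrability conditions. *)
Definition bmreal (h : T -> R) :=
  measurable_fun setT h /\ exists B, forall x, `|h x| <= B.

Definition bmcplx (f : T -> C) :=
  bmreal (fun x => complex.Re (f x)) /\ bmreal (fun x => complex.Im (f x)).

Definition rint (h : T -> R) : R := Rintegral nu setT h.

Definition cint (f : T -> C) : C :=
  Complex (rint (fun x => complex.Re (f x))) (rint (fun x => complex.Im (f x))).

Lemma bmreal_integrable h : bmreal h -> nu.-integrable setT (EFin \o h).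
Proof.
move=> [mh [B hB]]; apply: measurable_bounded_integrable => //.
exists B; split; first exact: num_real.
by move=> M BM x _ /=; rewrite (le_trans (hB x))// ltW.
Qed.

Lemma bmreal_cst c : bmreal (fun=> c).
Proof. by split; [exact: measurable_cst|exists `|c|]. Qed.

Lemma bmrealD f g : bmreal f -> bmreal g -> bmreal (fun x => f x + g x).
Proof.
move=> [mf [A hA]] [mg [B hB]]; split; first exact: measurable_funD.
by exists (A + B) => x; rewrite (le_trans (ler_normD _ _))// lerD.
Qed.

Lemma bmrealM f g : bmreal f -> bmreal g -> bmreal (fun x => f x * g x).
Proof.
move=> [mf [A hA]] [mg [B hB]]; split; first exact: measurable_funM.
by exists (A * B) => x; rewrite normrM ler_pM.
Qed.

Lemma bmrealN f : bmreal f -> bmreal (fun x => - f x).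
Proof.
move=> /(bmrealM (bmreal_cst (-1))); congr bmreal.
by apply/funext => x; rewrite mulN1r.
Qed.

Lemma rintD f g : bmreal f -> bmreal g -> rint (fun x => f x + g x) = rint f + rint g.
Proof. by move=> hf hg; rewrite /rint RintegralD//; exact: bmreal_integrable. Qed.

Lemma rintZ c f : bmreal f -> rint (fun x => c * f x) = c * rint f.
Proof. by move=> hf; rewrite /rint RintegralZl//; exact: bmreal_integrable. Qed.

Lemma rintN f : bmreal f -> rint (fun x => - f x) = - rint f.
Proof.
move=> hf; rewrite -mulN1r -rintZ//; congr rint.
by apply/funext => x; rewrite mulN1r.
Qed.

Lemma rint_le f g : bmreal f -> bmreal g -> (forall x, f x <= g x) -> rint f <= rint g.
Proof.
by move=> hf hg fg; apply: le_Rintegral => //; exact: bmreal_integrable.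
Qed.

Lemma rint_ge0 f : (forall x, 0 <= f x) -> 0 <= rint f.
Proof. by move=> hf; apply: Rintegral_ge0. Qed.

Lemma bmreal_indic A : measurable A -> bmreal (\1_A : T -> R).
Proof.
move=> mA; split; first exact: measurable_indic.
by exists 1 => x; rewrite indicE; case: (_ \in _); rewrite ?normr1 ?normr0.
Qed.

Lemma rint_indic A : measurable A -> rint (\1_A : T -> R) = fine (nu A).
Proof. by move=> mA; rewrite /rint /Rintegral integral_indic// setIT. Qed.

Lemma rint_comp (phi : T -> T) h : measurable_fun setT phi ->
  (forall A, measurable A -> nu (phi @^-1` A) = nu A) -> bmreal h ->
  rint (fun x => h (phi x)) = rint h.
Proof.
move=> mphi hphi hh; rewrite /rint /Rintegral; congr fine.
have := @integral_pushforward _ _ T T R phi mphi nu setT (EFin \o h).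
rewrite preimage_setT => <- //.
- apply: eq_measure_integral => A mA _; exact: hphi.
- by apply/measurable_EFinP; case: hh.
- apply: bmreal_integrable; case: hh => mh [B hB]; split; last by exists B.
  exact: measurableT_comp.
Qed.

Lemma bmcplxD f g : bmcplx f -> bmcplx g -> bmcplx (fun x => f x + g x).
Proof.
move=> [f1 f2] [g1 g2]; split.
  by have := bmrealD f1 g1; congr bmreal; apply/funext => x; rewrite raddfD.
by have := bmrealD f2 g2; congr bmreal; apply/funext => x; rewrite raddfD.
Qed.

Lemma ReM (a b : C) : complex.Re (a * b) =
  complex.Re a * complex.Re b + - (complex.Im a * complex.Im b).
Proof. by case: a; case: b. Qed.

Lemma ImM (a b : C) : complex.Im (a * b) =
  complex.Re a * complex.Im b + complex.Im a * complex.Re b.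
Proof. by case: a; case: b. Qed.

Lemma bmcplxM f g : bmcplx f -> bmcplx g -> bmcplx (fun x => f x * g x).
Proof.
move=> [f1 f2] [g1 g2]; split.
  have := bmrealD (bmrealM f1 g1) (bmrealN (bmrealM f2 g2)).
  by congr bmreal; apply/funext => x; rewrite ReM.
have := bmrealD (bmrealM f1 g2) (bmrealM f2 g1).
by congr bmreal; apply/funext => x; rewrite ImM.
Qed.

Lemma bmcplx_cst c : bmcplx (fun=> c).
Proof. by split; exact: bmreal_cst. Qed.

Lemma bmcplx_conj f : bmcplx f -> bmcplx (fun x => (f x)^*).
Proof.
move=> [f1 f2]; split.
  by have := f1; congr bmreal; apply/funext => x; case: (f x).
by have := bmrealN f2; congr bmreal; apply/funext => x; case: (f x).
Qed.

Lemma cintD f g : bmcplx f -> bmcplx g -> cint (fun x => f x + g x) = cint f + cint g.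
Proof.
move=> [f1 f2] [g1 g2]; rewrite /cint.
transitivity (Complex (rint (fun x => complex.Re (f x)) + rint (fun x => complex.Re (g x)))
  (rint (fun x => complex.Im (f x)) + rint (fun x => complex.Im (g x)))) => //.
rewrite -!rintD//; congr (Complex (rint _) (rint _)).
  by apply/funext => x; rewrite raddfD.
by apply/funext => x; rewrite raddfD.
Qed.

Lemma cintZ c f : bmcplx f -> cint (fun x => c * f x) = c * cint f.
Proof.
move=> [f1 f2].
have Zf a g : bmreal g -> bmreal (fun x => a * g x) by move=> hg; apply: bmrealM (bmreal_cst a) hg.
apply/eqP; rewrite eq_complex ReM ImM /= -!rintZ// -rintN -?rintD; do ?by apply: Zf.
  apply/andP; split; apply/eqP; congr rint; apply/funext => x.
    by rewrite ReM.
  by rewrite ImM.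
by apply: bmrealN; exact: Zf.
Qed.

Lemma cint_conj f : bmcplx f -> cint (fun x => (f x)^*) = (cint f)^*.
Proof.
move=> [f1 f2]; transitivity (Complex (rint (fun x => complex.Re (f x)))
  (- rint (fun x => complex.Im (f x)))) => //.
rewrite -rintN//; congr (Complex (rint _) (rint _)).
  by apply/funext => x; case: (f x).
by apply/funext => x; case: (f x).
Qed.

Lemma cint_comp (phi : T -> T) f : measurable_fun setT phi ->
  (forall A, measurable A -> nu (phi @^-1` A) = nu A) -> bmcplx f ->
  cint (fun x => f (phi x)) = cint f.
Proof.
move=> mphi hphi [f1 f2]; rewrite /cint.
by rewrite (rint_comp mphi hphi f1) (rint_comp mphi hphi f2).
Qed.

Definition L2 (f g : T -> C^o) : C := cint (fun x => f x * (g x)^*).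

Lemma L2_semi : @semi_inner R (T -> C^o) bmcplx L2.
Proof.
split.
- exact: bmcplx_cst.
- by move=> c f g bf bg; apply: bmcplxD => //; apply: bmcplxM => //; exact: bmcplx_cst.
- move=> c f g h bf bg bh; rewrite /L2 -cintZ -?cintD; first last.
  + by apply: bmcplxM => //; exact: bmcplx_conj.
  + by apply: bmcplxM => //; exact: bmcplx_conj.
  + by apply: bmcplxM (bmcplx_cst c) _; apply: bmcplxM => //; exact: bmcplx_conj.
  by congr cint; apply/funext => x; rewrite mulrDl mulrA.
- move=> f g bf bg; rewrite /L2 -cint_conj; last by apply: bmcplxM => //; exact: bmcplx_conj.
  by congr cint; apply/funext => x; rewrite rmorphM/= conjCK mulrC.
- move=> f bf; rewrite /L2 /cint lecE /=; apply/andP; split.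
    rewrite (_ : (fun x => _) = fun=> 0 * 0); last first.
      by apply/funext => x; rewrite -normCK nrmE -rmorphXn mulr0.
    by rewrite (rintZ _ (bmreal_cst 0)) mul0r.
  by apply: rint_ge0 => x; rewrite -normCK nrmE -rmorphXn/= sqr_ge0.
Qed.

Lemma L2_snorm2 f : bmcplx f -> snorm2 L2 f = rint (fun x => nrm (f x) ^+ 2).
Proof.
move=> bf; rewrite /snorm2 /L2 /cint /=; congr rint.
by apply/funext => x; rewrite -normCK nrmE -rmorphXn.
Qed.

Lemma bmreal_nrm2 f : bmcplx f -> bmreal (fun x => nrm (f x) ^+ 2).
Proof.
move=> bf; have [h _] := bmcplxM bf (bmcplx_conj bf); move: h; congr bmreal.
by apply/funext => x; rewrite -normCK nrmE -rmorphXn.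
Qed.

Lemma L2_mul_le f g K : bmcplx f -> bmcplx g -> 0 <= K ->
  (forall x, nrm (f x * g x) <= K * nrm (g x)) ->
  snorm L2 (fun x => f x * g x : C^o) <= K * snorm L2 g.
Proof.
move=> bf bg K0 hK; have bfg := bmcplxM bf bg.
rewrite -ler_sqr ?nnegrE ?mulr_ge0 ?snorm_ge0// exprMn.
rewrite (snorm_sqr L2_semi bfg) (snorm_sqr L2_semi bg) !L2_snorm2//.
rewrite -rintZ; last exact: bmreal_nrm2.
apply: rint_le => [||x]; first exact: bmreal_nrm2.
  by apply: bmrealM (bmreal_cst _) (bmreal_nrm2 bg).
by rewrite -exprMn ler_sqr ?nnegrE ?mulr_ge0 ?nrm_ge0.
Qed.

Lemma bmcplx_bounded f : bmcplx f -> exists2 B, 0 <= B & forall x, nrm (f x) <= B.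
Proof.
move=> [[_ [A hA]] [_ [B hB]]]; exists (`|A| + `|B|); first exact: addr_ge0.
move=> x; rewrite (le_trans (nrm_ReIm _))// lerD//.
  by rewrite (le_trans (hA x))// ler_norm.
by rewrite (le_trans (hB x))// ler_norm.
Qed.

Definition cindic (A : set T) : T -> C^o := fun x => (\1_A x)%:C.

Lemma bmcplx_cindic A : measurable A -> bmcplx (cindic A).
Proof. by move=> mA; split; [exact: bmreal_indic|exact: bmreal_cst]. Qed.

Lemma L2_cindic A : measurable A -> snorm2 L2 (cindic A) = fine (nu A).
Proof.
move=> mA; rewrite (L2_snorm2 (bmcplx_cindic mA)) -rint_indic//; congr rint.
apply/funext => x; rewrite /cindic indicE; case: (_ \in _).
  by rewrite nrm1 expr1n.
by rewrite nrm0 expr0n.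
Qed.

End ComplexIntegral.

(** * Invariant measures tested by property (T) *)

Lemma cext_isometry (R : realType) (V : lmodType R[i]) (S : set V) (s : V -> V -> R[i])
    (Ss : semi_inner S s) T K (x y : completion Ss) : bounded_on S s T K ->
  (forall v w, S v -> S w -> s (T v) (T w) = s v w) ->
  ip (cext T x) (cext T y) = ip x y.
Proof.
move=> hT h; have [hx hy] := (crepP x, crepP y).
apply: clim_uniq (reps_cip (reps_cext hT hx) (reps_cext hT hy)) _.
have := reps_cip hx hy.
by apply: vanish_le => n /=; rewrite h//; [exact: repsS hx|exact: repsS hy].
Qed.

Section ContinuousFunctions.
Variables (R : realType) (G : topGroupType).
Hypotheses (cG : compact [set: G]) (hG : hausdorff_space G).

Lemma continuous_Re (F : G -> cplx R) : continuous F ->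
  continuous (fun x => complex.Re (F x) : R^o).
Proof.
move=> cF x; apply/cvgrPdist_lt => e e0; have e0' : 0 < e%:C by rewrite -[0]/(0%:C) ltcR.
move/cvgrPdist_lt: (cF x) => /(_ _ e0'); apply: filterS => y.
by rewrite nrmE ltcR; apply: le_lt_trans; rewrite -raddfB nrm_Re.
Qed.

Lemma continuous_Im (F : G -> cplx R) : continuous F ->
  continuous (fun x => complex.Im (F x) : R^o).
Proof.
move=> cF x; apply/cvgrPdist_lt => e e0; have e0' : 0 < e%:C by rewrite -[0]/(0%:C) ltcR.
move/cvgrPdist_lt: (cF x) => /(_ _ e0'); apply: filterS => y.
by rewrite nrmE ltcR; apply: le_lt_trans; rewrite -raddfB nrm_Im.
Qed.

Lemma continuous_bmreal (f : G -> R^o) : continuous f -> @bmreal _ (borel G) R f.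
Proof.
move=> cf; split; first exact: borel_continuous_real.
have : compact (f @` setT).
  by apply: continuous_compact => //; exact: continuous_subspaceT.
move=> /compact_bounded[M [_ hM]]; exists (M + 1) => x; apply: (hM (M + 1)).
  by rewrite ltrDl.
by exists x.
Qed.

Lemma continuous_bmcplx (F : G -> cplx R) : continuous F -> @bmcplx _ (borel G) R F.
Proof.
by move=> cF; split; apply: continuous_bmreal; [exact: continuous_Re|exact: continuous_Im].
Qed.

(** Urysohn: a compact Hausdorff space is normal. *)
Lemma bump (N : set G) : nbhs (1%g : G) N -> exists F : G -> cplx R,
  [/\ continuous F, F 1%g = 1, forall x, nrm (F x) <= 1 & forall x, ~ N x -> F x = 0].
Proof.
rewrite nbhsE => -[U [oU U1] UN].
have A1 : closed [set (1%g : G)] by apply: accessible_closed_set1; exact: hausdorff_accessible.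
have /normal_separatorP sep : normal_space G by exact: compact_normal.
have AU : [set (1%g : G)] `&` ~` U = set0 by apply/seteqP; split=> // x [->].
have /(@uniform_separatorP _ R)[f [cf f01 f0 f1]] := sep R _ _ A1 (open_closedC oU) AU.
have nrmR (x : R) : nrm x%:C = `|x| by rewrite /nrm normc_def /= expr0n addr0 sqrtr_sqr.
exists (fun x => (1 - f x)%:C); split.
- move=> x; apply/cvgrPdist_lt => e; rewrite ltcE/= => /andP[/eqP Ime e0].
  have -> : e = (complex.Re e)%:C by rewrite [LHS]complexE Ime mulr0 addr0.
  move/cvgrPdist_lt: (cf x) => /(_ _ e0); apply: filterS => y.
  rewrite nrmE ltcR -rmorphB nrmR -normrN.
  by have -> : 1 - f x - (1 - f y) = - (f x - f y) by ring.
- by rewrite (f0 (f 1%g))//= ?subr0//; exists 1%g.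
- move=> x; have /= := f01 (f x) (imageT _ _); rewrite in_itv/= => /andP[h0 h1].
  by rewrite nrmR ger0_norm ?subr_ge0// gerBl.
- move=> x Nx; rewrite (f1 (f x))//= ?subrr//; exists x => // Ux; exact/Nx/UN.
Qed.

End ContinuousFunctions.

Section TestMeasure.
Variables (R : realType) (Gam G : topGroupType).
Variables (alpha : Gam -> G -> G) (beta : G -> Gam -> Gam).
Variable QG : bicrossed_product R alpha beta.
Hypotheses (cG : compact [set: G]) (hG : hausdorff_space G).
Hypotheses (al1 : forall g, alpha 1%g g = g)
  (alM : forall c d g, alpha (c * d)%g g = alpha c (alpha d g))
  (al_cont : forall c, continuous (alpha c)).
Variable nu : {measure set (borel G) -> \bar R}.
Hypothesis nu_fin : (nu setT < +oo)%E.
Hypothesis nu_inv : forall c A, measurable (A : set (borel G)) -> nu (alpha c @^-1` A) = nu A.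

Local Notation C := (R[i]).
Local Notation V := (G -> C^o).
Local Notation S := (@bmcplx _ (borel G) R).
Local Notation s := (L2 nu).
Let Ss : @semi_inner R V S s := L2_semi nu_fin.
Local Notation H := (completion Ss).

Definition mult_op (F : G -> C) (v : V) : V := fun x => F x * v x.
Definition perm_op (c : Gam) (v : V) : V := fun x => v (alpha c^-1%g x).

Lemma mult_bounded F K : S F -> 0 <= K -> (forall x, nrm (F x) <= K) ->
  bounded_on S s (mult_op F) K.
Proof.
move=> bF K0 hK; split=> //.
- by move=> v bv; exact: bmcplxM.
- by move=> c v w _ _; apply/funext => x; rewrite /mult_op !fctE mulrDr mulrCA.
- move=> v bv; apply: (L2_mul_le nu_fin) => // x.
  by rewrite nrmM ler_wpM2r ?nrm_ge0.
Qed.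

Lemma mult_bounded_ex F : S F -> exists K, bounded_on S s (mult_op F) K.
Proof. by move=> bF; have [K K0 hK] := bmcplx_bounded bF; exists K; exact: mult_bounded. Qed.

Lemma alpha_meas c : measurable_fun setT (alpha c : borel G -> borel G).
Proof. exact: borel_continuous. Qed.

Lemma perm_S c v : S v -> S (perm_op c v).
Proof.
have k h : @bmreal _ (borel G) R h -> @bmreal _ (borel G) R (fun x => h (alpha c^-1%g x)).
  move=> [mh [B hB]]; split; last by exists B.
  exact: (measurableT_comp mh (@alpha_meas _)).
by move=> [h1 h2]; split; [exact: (k _ h1)|exact: (k _ h2)].
Qed.

Lemma perm_iso c v w : S v -> S w -> s (perm_op c v) (perm_op c w) = s v w.
Proof.
move=> bv bw; rewrite /L2 /perm_op.
apply: (cint_comp (T := borel G) nu_fin (phi := alpha c^-1%g) (f := fun x => v x * (w x)^*)).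
- exact: alpha_meas.
- by move=> A mA; exact: nu_inv.
- by apply: bmcplxM => //; exact: bmcplx_conj.
Qed.

Lemma perm_bounded c : bounded_on S s (perm_op c) 1.
Proof.
split=> //; first exact: perm_S.
by move=> v bv; rewrite mul1r /snorm /snorm2 perm_iso.
Qed.

Definition mult_rep (F : G -> C) : H -> H := cext (mult_op F).
Definition perm_rep (c : Gam) : H -> H := cext (perm_op c).

Lemma test_covariant : @covariant_rep R Gam G alpha H mult_rep perm_rep.
Proof.
split.
- split.
  + move=> F /(continuous_bmcplx cG)/mult_bounded_ex[K hK]; exact: cext_bounded hK.
  + move=> c F F' xi /(continuous_bmcplx cG) bF /(continuous_bmcplx cG) bF'.
    have [K hK] := mult_bounded_ex bF; have [K' hK'] := mult_bounded_ex bF'.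
    have [K'' hK''] := mult_bounded_ex (bmcplxD (bmcplxM (@bmcplx_cst _ (borel G) R c) bF) bF').
    apply: (cext_lin _ hK hK' hK'') => v Sv; apply/funext => x.
    by rewrite /mult_op !fctE mulrDl -mulrA.
  + move=> F F' /(continuous_bmcplx cG) bF /(continuous_bmcplx cG) bF'.
    have [K hK] := mult_bounded_ex bF; have [K' hK'] := mult_bounded_ex bF'.
    apply/funext => xi; rewrite /= /mult_rep (cext_comp _ hK hK').
    by congr (cext _ xi); apply/funext => v; apply/funext => x; rewrite /mult_op/= mulrA.
  + apply/funext => xi; apply: cext_id => v _.
    by apply/funext => x; rewrite /mult_op mul1r.
  + move=> F /(continuous_bmcplx cG) bF.
    have [K hK] := mult_bounded_ex bF; have [K' hK'] := mult_bounded_ex (bmcplx_conj bF).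
    apply: (cext_adjoint hK hK') => v w _ _; congr cint; apply/funext => x.
    by rewrite /mult_op rmorphM/= conjCK mulrCA mulrA.
- split.
  + by move=> c; exact: cext_linear (perm_bounded c).
  + by move=> c x y; apply: cext_isometry (perm_bounded c) _ => v w; exact: perm_iso.
  + move=> c d; apply/funext => xi; rewrite /= /perm_rep (cext_comp _ (perm_bounded c) (perm_bounded d)).
    congr (cext _ xi); apply/funext => v; apply/funext => x.
    by rewrite /perm_op/= -alM invgM.
  + apply/funext => xi; apply: cext_id => v _; apply/funext => x.
    by rewrite /perm_op invg1 al1.
- move=> c F /(continuous_bmcplx cG) bF; have [K hK] := mult_bounded_ex bF.
  have bF' : S (F \o alpha c^-1%g) by exact: (perm_S c bF).
  have [K' hK'] := mult_bounded_ex bF'.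
  have E : perm_op c \o (mult_op F \o perm_op c^-1%g) = mult_op (F \o alpha c^-1%g).
    apply/funext => v; apply/funext => x; rewrite /perm_op /mult_op/= invgK.
    by rewrite -[alpha c (alpha _ x)]alM mulgV al1.
  have hM := bounded_on_comp hK (perm_bounded c^-1%g).
  apply/funext => xi; rewrite /= /perm_rep /mult_rep.
  by rewrite (cext_comp _ hK (perm_bounded _)) (cext_comp _ (perm_bounded _) hM) E.
Qed.

Hypothesis scG : @second_countable G.

Lemma nu_fin_num A : measurable (A : set (borel G)) -> nu A \is a fin_num.
Proof.
move=> mA; rewrite ge0_fin_numE//; apply: le_lt_trans nu_fin.
by apply: le_measure => //; rewrite inE.
Qed.

Lemma measurable_identity : measurable ([set 1%g] : set (borel G)).
Proof. by apply: borel_closed; apply: accessible_closed_set1; exact: hausdorff_accessible. Qed.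

(** A vector concentrated at the identity is fixed by multiplication by bump functions
    at the identity. On bounded functions these multiplications tend to zero in norm,
    since the measures of small neighbourhoods of the identity tend to
    [nu [set 1]]; hence they tend to zero on the completion. *)
Lemma mult_rep_shrinks (xi : H) : nu [set 1%g] = 0%E ->
  (forall F : G -> cplx R, continuous F -> mult_rep F xi = F 1%g *: xi) -> xi = 0.
Proof.
move=> nu1 hxi; have [N [hN [decN baseN]]] := countable_nbhs_base cG hG scG.
have mN n : measurable (N n : set (borel G)) by apply: borel_closed; case: (hN n).
have capN : \bigcap_n N n = [set 1%g].
  apply/seteqP; split=> [x Nx|_ -> n _]; last exact: nbhs_singleton (hN n).1.
  apply: contrapT => x1.
  have [|n nx] := baseN (~` [set x]); last exact: (nx x (Nx n I)).
  apply: open_nbhs_nbhs; split; last by move=> h; apply: x1; rewrite -h.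
  by apply: closed_openC; apply: accessible_closed_set1; exact: hausdorff_accessible.
have nuN : vanish (fun n => fine (nu (N n))).
  apply/vanish_cvg => [n|]; first exact: fine_ge0.
  have := @nonincreasing_cvg_mu _ (borel G) R nu N.
  rewrite capN nu1 => h; apply/fine_cvg; apply: h => //.
  - by rewrite ltey_eq nu_fin_num.
  - exact: measurable_identity.
  - by move=> m n mn; apply/subsetPset; exact: decN.
apply/nrm_eq0/le_anti; rewrite nrm_ge0 andbT leNgt; apply/negP => xi_gt0.
have e0 : 0 < nrm xi / 2 by rewrite divr_gt0.
have [v Sv [y hy xy]] := cdense xi e0.
have [B B0 hB] := bmcplx_bounded Sv.
have bound n : nrm xi <= nrm (xi - y) + B * Num.sqrt (fine (nu (N n))).
  have [F [cF F1 Fle F0]] := bump R cG hG (hN n).1.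
  have bF := continuous_bmcplx cG cF.
  have hF := mult_bounded bF ler01 Fle.
  rewrite -[X in nrm X <= _](_ : mult_rep F xi = xi); last by rewrite (hxi F cF) F1 scale1r.
  have -> : mult_rep F xi = mult_rep F (xi - y) + mult_rep F y.
    rewrite -[X in _ + X]scale1r addrC -(cext_linear hF) scale1r.
    by rewrite addrC subrK.
  apply: le_trans (nrmD _ _) _; apply: lerD.
    by rewrite -[leRHS]mul1r; exact: (cext_le (xi - y) hF).
  have hFy := reps_cext hF hy.
  rewrite cnrmE; apply: (reps_snorm_le (N := 0%N) hFy) => [|k _ /=].
    by rewrite mulr_ge0// sqrtr_ge0.
  have bFv := bmcplxM bF Sv.
  have fn0 : 0 <= fine (nu (N n)) by exact: fine_ge0.
  rewrite -ler_sqr ?nnegrE ?mulr_ge0 ?sqrtr_ge0 ?snorm_ge0// exprMn.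
  rewrite (snorm_sqr Ss (bFv : S (mult_op F v))) (sqr_sqrtr fn0) (L2_snorm2 nu (bFv : S (mult_op F v))) -(rint_indic nu (mN n)).
  rewrite -(rintZ nu_fin); last exact: bmreal_indic.
  apply: rint_le => //; first exact: bmreal_nrm2.
    by apply: bmrealM; [exact: bmreal_cst|exact: bmreal_indic].
  move=> x; rewrite indicE; case: (boolP (x \in N n)) => [_|/negP nNx].
    rewrite mulr1 ler_sqr ?nnegrE ?nrm_ge0// nrmM (le_trans _ (hB x))//.
    by rewrite -[leRHS]mul1r ler_wpM2r ?nrm_ge0.
  rewrite /mult_op F0; last by move=> h; apply: nNx; rewrite inE.
  by rewrite mul0r nrm0 expr0n mulr0.
have snorm2_vanish : vanish (fun n => B * Num.sqrt (fine (nu (N n)))).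
  apply: vanishM B0 _ => e e_gt0.
  have := nuN _ (exprn_gt0 2 e_gt0); apply: filterS => n h.
  by rewrite -(ger0_norm (ltW e_gt0)) -sqrtr_sqr ltr_sqrt ?exprn_gt0.
have [n _ hn] := snorm2_vanish _ e0.
have := hn n (leqnn n); rewrite ltNge => /negP; apply.
rewrite -(lerD2l (nrm (xi - y))); apply: le_trans (bound n).
by rewrite [leRHS]splitr lerD2r ltW.
Qed.

(** The normalized indicator functions of the [W n] are invariant under [Gam] and
    almost concentrated at the identity, so that property (T) gives a nonzero vector
    concentrated at the identity, which [mult_rep_shrinks] excludes unless the
    identity is an atom. *)
Lemma test_measure (W : nat -> set G) : dual_property_T QG ->
  (forall n, measurable (W n : set (borel G))) -> (forall n, nu (W n) != 0%E) ->
  (forall n c g, W n (alpha c g) <-> W n g) ->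
  (forall U, nbhs (1%g : G) U -> exists n, forall m, (n <= m)%N -> W m `<=` U) ->
  nu [set 1%g] != 0%E.
Proof.
move=> T mW nuW invW smallW; apply/eqP => nu1.
have nuW_gt0 n : 0 < fine (nu (W n)).
  by rewrite fine_gt0// lt0e nuW measure_ge0/= ltey_eq nu_fin_num.
pose k n := (Num.sqrt (fine (nu (W n))))^-1.
have k0 n : 0 <= k n by rewrite invr_ge0 sqrtr_ge0.
pose w n : V := (k n)%:C *: cindic R (W n : set (borel G)).
have Sw n : S (w n) by apply: (si_Z Ss); exact: bmcplx_cindic.
have sw n : snorm s (w n) = 1.
  rewrite (snormZ Ss); last exact: bmcplx_cindic.
  have E : snorm2 s (cindic R (W n : set (borel G))) = fine (nu (W n)) by exact: L2_cindic.
  by rewrite nrm_real// /snorm E mulVf// gt_eqF// sqrtr_gt0.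
have /choice[xi hxi] : forall n, exists x : H, reps (fun=> w n) x.
  by move=> n; exact: scauchy_reps (scauchy_cst Ss (Sw n)).
have nrmE' (x : H) v : reps (fun=> v) x -> nrm x = snorm s v.
  move=> hx; have := creps_dist hx (represents0 Ss : reps _ (0 : H)).
  by rewrite !subr0.
have [] := dual_property_T_covariant T test_covariant.
  exists xi => [n|]; first by rewrite (nrmE' _ _ (hxi n)) sw.
  split=> [F cF|c].
    have bF := continuous_bmcplx cG cF.
    move=> e e0; have e20 : 0 < e / 2 by rewrite divr_gt0.
    have e2 : 0 < (e / 2)%:C by rewrite -[0]/(0%:C) ltcR.
    have [|n hn] := smallW [set x | nrm (F x - F 1%g) < e / 2].
      move/cvgrPdist_lt : (cF 1%g) => /(_ _ e2); apply: filterS => x.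
      by rewrite distrC nrmE ltcR.
    have [K hK] := mult_bounded_ex bF.
    near=> m; have nm : (n <= m)%N by near: m; exact: nbhs_infty_ge.
    have h := repsB (reps_cext hK (hxi m)) (reps_lin (F 1%g) (hxi m) (represents0 Ss : reps _ (0 : H))).
    rewrite !addr0 in h.
    have -> : nrm (mult_rep F (xi m) - F 1%g *: xi m) = snorm s (fun x => (F x - F 1%g) * w m x).
      have Ef : (fun x => (F x - F 1%g) * w m x) = mult_op F (w m) - F 1%g *: w m :> V.
        by apply/funext => x; rewrite [LHS]mulrBl.
      by rewrite Ef; apply: nrmE'; exact: h.
    rewrite (@le_lt_trans _ _ (e / 2))//; last by rewrite gtr_pMr// invf_lt1// ltr1n.
    rewrite -[leRHS]mulr1 -[X in _ <= _ * X](sw m); apply: (L2_mul_le nu_fin _ (Sw m) (ltW e20)) => [|x].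
      by apply: bmcplxD bF _; exact: (@bmcplx_cst _ (borel G) R (- F 1%g)).
    rewrite nrmM; have [Wx|nWx] := pselect (W m x).
      by rewrite ler_wpM2r ?nrm_ge0// ltW//; exact: hn nm _ Wx.
    by rewrite /w /cindic !fctE indicE memNset// scaler0 nrm0 !mulr0.
  move=> e e0; near=> n; rewrite (_ : perm_rep c (xi n) = xi n) ?subrr ?nrm0//.
  have := reps_cext (perm_bounded c) (hxi n).
  rewrite (_ : perm_op c \o (fun=> w n) = fun=> w n); first by move/reps_uniq; exact.
  apply/funext => j; apply/funext => x /=; rewrite /perm_op /w /cindic !fctE !indicE.
  by congr (_ *: (nat_of_bool _)%:R%:C); apply/idP/idP; rewrite !inE invW.
move=> x [x0 hF _]; apply: x0; exact: mult_rep_shrinks nu1 hF.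
Unshelve. all: by end_near. Qed.

End TestMeasure.

(** * Matched pairs *)

Lemma closed_graph_continuous (X Y : topologicalType) (f : X -> Y) :
  hausdorff_space Y -> compact [set: Y] -> closed [set p : X * Y | f p.1 = p.2] ->
  continuous f.
Proof.
move=> hY cY cf x.
have clf y : cluster (f @ nbhs x) y -> y = f x.
  move=> cy; apply/esym; apply: (cf (x, y)) => B [[A1 A2] /= [xA1 yA2] AB].
  have FA : (f @ nbhs x) (f @` A1) by apply: filterS xA1 => z Az; exists z.
  have [_ [[z Az <-] A2z]] := cy _ _ FA yA2.
  by exists (z, f z); split=> //; apply: AB.
have [y [_ cy]] := cY (f @ nbhs x) _ filterT.
have clE : cluster (f @ nbhs x) = [set f x].
  by apply/seteqP; split=> [z /clf //|_ ->]; rewrite -(clf _ cy).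
exact: compact_cluster_set1 hY cY filterT _ filterT clE.
Qed.

Section MatchedPair.
Variables (R : realType) (Gam G : topGroupType) (mp : matched_pair R Gam G).
Variables (alpha : Gam -> G -> G) (beta : G -> Gam -> Gam).
Hypothesis hab : mp_actions mp alpha beta.
Local Notation i := (mp_inr mp).
Local Notation j := (mp_inl mp).

Lemma inrM g h : i (g * h)%g = (i g * i h)%g.
Proof. by case: (mp_inr_closed mp) => h1 *; exact: h1. Qed.
Lemma inlM g h : j (g * h)%g = (j g * j h)%g.
Proof. by case: (mp_inl_closed mp) => h1 *; exact: h1. Qed.
Lemma inr1 : i 1%g = 1%g.
Proof. by apply: (mulgI (i 1%g)); rewrite -inrM !mulg1. Qed.
Lemma inl1 : j 1%g = 1%g.
Proof. by apply: (mulgI (j 1%g)); rewrite -inlM !mulg1. Qed.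
Lemma inrV g : i g^-1%g = (i g)^-1%g.
Proof. by apply: (mulgI (i g)); rewrite -inrM !mulgV inr1. Qed.
Lemma inlV g : j g^-1%g = (j g)^-1%g.
Proof. by apply: (mulgI (j g)); rewrite -inlM !mulgV inl1. Qed.
Lemma inr_inj : injective i. Proof. by case: (mp_inr_closed mp). Qed.
Lemma inl_inj : injective j. Proof. by case: (mp_inl_closed mp). Qed.
Lemma inr_continuous : continuous i. Proof. by case: (mp_inr_closed mp). Qed.
Lemma inr_closed : closed (range i). Proof. by case: (mp_inr_closed mp). Qed.
Lemma inl_closed : closed (range j). Proof. by case: (mp_inl_closed mp). Qed.

Lemma meet_trivial g c : i g = j c -> g = 1%g /\ c = 1%g.
Proof.
move=> e; have h : (range j `&` range i) (i g) by split; [exists c|exists g].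
move: h; rewrite mp_trivial_meet => /= ig.
by split; [apply: inr_inj; rewrite inr1|apply: inl_inj; rewrite inl1 -e].
Qed.

Lemma inr_inl_uniq g c g' c' : (i g * j c = i g' * j c')%g -> g = g' /\ c = c'.
Proof.
move=> e; have : i (g'^-1 * g)%g = j (c' * c^-1)%g.
  apply: (mulgI (i g')); apply: (mulIg (j c)).
  by rewrite inrM inrV inlM inlV mulVKg -mulgA -mulgA mulVg mulg1.
move=> /meet_trivial[h1 h2]; split.
  by apply: (mulgI g'^-1%g); rewrite h1 mulVg.
by apply: (mulIg c^-1%g); rewrite h2 mulgV.
Qed.

Lemma alpha_beta_mul c d g :
  alpha (c * d)%g g = alpha c (alpha d g) /\
  beta g (c * d)%g = (beta (alpha d g) c * beta g d)%g.
Proof.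
apply: inr_inl_uniq; rewrite -hab !inlM [RHS]mulgA -hab -[LHS]mulgA.
by rewrite [in LHS](hab d g) mulgA.
Qed.

Lemma alphaM c d g : alpha (c * d)%g g = alpha c (alpha d g).
Proof. by case: (alpha_beta_mul c d g). Qed.

Lemma alpha_beta_mulr c g h :
  alpha c (g * h)%g = (alpha c g * alpha (beta g c) h)%g /\
  beta (g * h)%g c = beta h (beta g c).
Proof.
apply: inr_inl_uniq; rewrite -hab !inrM mulgA [in LHS](hab c g) -[LHS]mulgA.
by rewrite [in LHS](hab (beta g c) h) mulgA.
Qed.

(** The failure of [alpha c] to be multiplicative is governed by [beta]. It transports
    information on [alpha c] near [g] to the identity, for all [c] at once,
    since [beta g] permutes [Gam]. *)
Lemma alpha_cocycle c g h : alpha c (g * h)%g = (alpha c g * alpha (beta g c) h)%g.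
Proof. by case: (alpha_beta_mulr c g h). Qed.

Lemma betaM c g h : beta (g * h)%g c = beta h (beta g c).
Proof. by case: (alpha_beta_mulr c g h). Qed.

Lemma alpha1 g : alpha 1%g g = g.
Proof. by have [] := @inr_inl_uniq (alpha 1%g g) (beta g 1%g) g 1%g; rewrite // -hab inl1 mul1g mulg1. Qed.

Lemma alphac1_beta c : alpha c 1%g = 1%g /\ beta 1%g c = c.
Proof. by apply: inr_inl_uniq; rewrite -hab inr1 mul1g mulg1. Qed.

Lemma alpha_1 c : alpha c 1%g = 1%g. Proof. by case: (alphac1_beta c). Qed.

Lemma beta_surj g c : beta g (beta g^-1%g c) = c.
Proof. by rewrite -betaM mulVg; case: (alphac1_beta c). Qed.

Lemma alphaK c : cancel (alpha c) (alpha c^-1%g).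
Proof. by move=> g; rewrite -alphaM mulVg alpha1. Qed.

Lemma alphaKV c : cancel (alpha c^-1%g) (alpha c).
Proof. by move=> g; rewrite -alphaM mulgV alpha1. Qed.

(** The graph of [alpha c] is closed: [alpha c g = g'] means that [g'^-1 c g] belongs
    to [Gam], which is closed. *)
Lemma alpha_continuous c : hausdorff_space G -> compact [set: G] -> continuous (alpha c).
Proof.
move=> hG cG; apply: closed_graph_continuous => //.
have -> : [set p : G * G | alpha c p.1 = p.2] =
    (fun p : G * G => ((i p.2)^-1 * (j c * i p.1))%g) @^-1` range j.
  apply/seteqP; split=> [[g g'] /= <-|[g g'] /= [d _ e]].
    by exists (beta g c) => //; rewrite hab mulKg.
  have [] := @inr_inl_uniq (alpha c g) (beta g c) g' d; rewrite // -hab e mulVKg//.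
apply: closed_comp => [[g g'] _|]; last exact: inl_closed.
apply: mulg_cvg.
  apply: invg_cvg; apply: continuous_cvg; first exact: inr_continuous.
  exact: cvg_snd.
apply: mulg_cvg; first exact: cvg_cst.
apply: continuous_cvg; first exact: inr_continuous.
exact: cvg_fst.
Qed.

Lemma beta_fiber_closed c r : closed [set g | beta g c = r].
Proof.
have -> : [set g | beta g c = r] = (fun g : G => (j c * i g * j r^-1)%g) @^-1` range i.
  apply/seteqP; split=> [g /= <-|g /= [h _ e]].
    by exists (alpha c g) => //; rewrite hab inlV mulgK.
  have [] := @inr_inl_uniq (alpha c g) (beta g c) h r; rewrite // -hab e inlV mulgVK//.
apply: closed_comp => [g _|]; last exact: inr_closed.
apply: mulg_cvg; last exact: cvg_cst.
apply: mulg_cvg; first exact: cvg_cst.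
exact: inr_continuous.
Qed.

Definition fixed_points := [set g : G | forall c : Gam, alpha c g = g].

(** If [p] is fixed, the cocycle identity gives
    [alpha c (p h) = p * alpha (beta p c) h], and [beta p c] ranges over [Gam]. *)
Lemma fixed_points_div p g : fixed_points p -> fixed_points g -> fixed_points (p^-1 * g)%g.
Proof.
move=> hp hg c; have := hg (beta p^-1%g c).
rewrite -[X in alpha _ X = X](mulVKg p) alpha_cocycle hp beta_surj => /mulgI.
exact.
Qed.

End MatchedPair.

(** * Fixed points *)

Lemma infinite_pigeonhole (T : choiceType) (F : finType) (A : set T) (q : T -> F) :
  ~ finite_set A -> exists x y, [/\ A x, A y, x <> y & q x = q y].
Proof.
move=> infA; apply: contrapT => /forallNP nq; apply: infA.
have [->|/set0P[a0 Aa0]] := eqVneq A set0; first exact: finite_set0.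
apply: sub_finite_set (finite_image (fun k => xget a0 [set x | A x /\ q x = k])
  (@finite_finset F setT)).
move=> x Ax; exists (q x) => //; case: xgetP => [y _ [Ay qy]|/(_ x)]; last by case.
by apply: contrapT => xy; apply: (nq y); exists x.
Qed.

Section PointMasses.
Variables (R : realType) (T : ptopologicalType) (h : nat -> T).

Let weight (n : nat) : {nonneg R} := NngNum (divr_ge0 (@ler01 R) (ler0n R (2 ^ n.+1))).

(** The weights make the total mass finite. *)
Definition point_masses : {measure set (borel T) -> \bar R} :=
  mseries (fun n => mscale (weight n) (dirac (h n : borel T))) 0.

Lemma point_massesE (A : set T) :
  point_masses A = (\sum_(n <oo) ((1 / (2 ^ n.+1)%:R)%:E * (h n \in A)%:R%:E))%E.
Proof. by apply: eq_eseriesr => n _; rewrite /= /mscale/= /dirac indicE. Qed.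

Lemma point_masses_fin : (point_masses setT < +oo)%E.
Proof.
apply: (@le_lt_trans _ _ 1%:E); last exact: ltry.
rewrite point_massesE; apply: le_trans (epsilon_trick0 xpredT (@ler01 R)).
by rewrite le_eqVlt; apply/orP; left; apply/eqP; apply: eq_eseriesr => n _; rewrite in_setT mule1.
Qed.

Lemma point_masses0 (A : set T) : (forall n, ~ A (h n)) -> point_masses A = 0%E.
Proof.
by move=> hA; rewrite point_massesE eseries0// => n _ _; rewrite memNset// mule0.
Qed.

Lemma point_masses_gt0 (A : set T) n : A (h n) -> point_masses A != 0%E.
Proof.
move=> An; rewrite gt_eqF//; apply: (@lt_le_trans _ _ (1 / (2 ^ n.+1)%:R)%:E).
  by rewrite lte_fin divr_gt0// ltr0n expn_gt0.
rewrite point_massesE; apply: le_trans _ (nneseries_lim_ge n.+1 _); last first.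
  by move=> k _ _; rewrite mule_ge0// lee_fin divr_ge0.
by rewrite big_nat_recr//= mem_set// mule1 leeDr// sume_ge0//.
Qed.

End PointMasses.

Section FixedPoints.
Variables (R : realType) (Gam G : topGroupType) (mp : matched_pair R Gam G).
Variables (alpha : Gam -> G -> G) (beta : G -> Gam -> Gam).
Hypothesis hab : mp_actions mp alpha beta.
Hypotheses (cG : compact [set: G]) (hG : hausdorff_space G) (scG : @second_countable G).
Variable QG : bicrossed_product R alpha beta.

(** In an infinite set of fixed points, two, [x] and [y], are close to each other by
    compactness, so that [x^-1 * y] is a fixed point close to the identity and
    different from it. The sum of point masses at a sequence of such points is
    invariant and has no atom at the identity, contrary to [test_measure]. *)
Lemma fixed_points_finite : dual_property_T QG -> finite_set (fixed_points alpha).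
Proof.
move=> T; apply: contrapT => infA.
have [N [hN [decN baseN]]] := countable_nbhs_base cG hG scG.
have hh n : exists h, [/\ fixed_points alpha h, N n h & h <> 1%g].
  have [M [q hq]] := finite_classes cG (hN n).1.
  have [x [y [Ax Ay xy qxy]]] := infinite_pigeonhole q infA.
  exists (x^-1 * y)%g; split; [exact (fixed_points_div hab Ax Ay)|exact: hq|].
  by move=> e; apply: xy; apply: (mulgI x^-1%g); rewrite mulVg e.
have /choice[h {}hh] := hh.
have := @test_measure R Gam G alpha beta QG cG hG (alpha1 hab) (alphaM hab)
  (fun c => alpha_continuous hab (c := c) hG cG) (point_masses R h) (point_masses_fin R h).
move=> /(_ _ scG (fun n => [set h n]) T) test.
suff : point_masses R h [set 1%g] != 0%E.
  by rewrite point_masses0 ?eqxx// => n /= e; have [_ _] := hh n; rewrite e.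
apply: test => [c A mA|n|n|n c g|U U1].
- rewrite /= !point_massesE; apply: eq_eseriesr => n _.
  have [fh _ _] := hh n; congr (_ * (nat_of_bool _)%:R%:E)%E.
  by apply/idP/idP; rewrite !inE /= fh.
- by apply: borel_closed; apply: accessible_closed_set1; exact: hausdorff_accessible.
- exact: (@point_masses_gt0 _ _ _ _ n).
- have [fh _ _] := hh n; split=> /= e; last by rewrite e.
  by apply: (can_inj (alphaK hab c)); rewrite e fh.
- have [n nU] := baseN U U1; exists n => m nm _ ->; apply: nU; apply: (decN _ _ nm).
  by have [] := hh m.
Qed.

End FixedPoints.

(** * Uniqueness of invariant measures *)

Section InvariantMeasures.
Variables (R : realType) (G : topGroupType).
Hypothesis scG : @second_countable G.

(** Second countability puts the open sets of [G * G] in the product of the Borel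
    sigma-algebras. *)
Lemma open_mul_measurable (U : set G) : open U ->
  measurable ([set p | U (p.1 * p.2)%g] : set (borel G * borel G)).
Proof.
move=> oU; have [B cB [oB bB]] := scG.
have [U0 [BU0 _] _] := bB (1%g : G) setT filterT.
have [f [fB hf]] := countable_enum cB BU0.
pose D := [set k : nat * nat | forall x y, f k.1 x -> f k.2 y -> U (x * y)%g].
have -> : [set p | U (p.1 * p.2)%g] = \bigcup_(k in D) (f k.1 `*` f k.2).
  apply/seteqP; split=> [[x y] /= Uxy|[x y] [[k l] /= Dk [fx fy]]]; last exact: Dk.
  have [[A1 A2] [/= xA1 yA2] AU] := @mulg_continuous G (x, y) U (open_nbhs_nbhs (conj oU Uxy)).
  have [V1 [BV1 V1x] VA1] := bB x A1 xA1; have [V2 [BV2 V2y] VA2] := bB y A2 yA2.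
  have [k fk] := hf _ BV1; have [l fl] := hf _ BV2.
  exists (k, l); last by split; rewrite /= ?fk ?fl.
  rewrite /D /= fk fl => a b Va Vb; apply: (AU (a, b)); split; [exact: VA1|exact: VA2].
rewrite bigcup_mkcond; apply: countable_bigcupT_measurable => // k.
by case: ifP => // _; apply: measurableX; apply: borel_open; exact: oB.
Qed.

Lemma mul_measurable (A : set G) : measurable (A : set (borel G)) ->
  measurable ([set p | A (p.1 * p.2)%g] : set (borel G * borel G)).
Proof.
move=> mA.
have mm : measurable_fun setT ((fun p => (p.1 * p.2)%g) : borel G * borel G -> borel G).
  apply: (@measurability _ _ _ (borel G) setT _ (@open G)) => //.
  by move=> _ [U oU <-]; rewrite setTI; exact: open_mul_measurable.
by have := mm measurableT A mA; rewrite setTI.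
Qed.

Lemma translate_measurable g (A : set G) : measurable (A : set (borel G)) ->
  measurable ([set x | A (g * x)%g] : set (borel G)).
Proof.
move=> mA; have := borel_continuous (mulg_contl (x := g)) measurableT mA.
by rewrite setTI.
Qed.

(** The image measure, bundled with its measure structure, which depends on the
    measurability of [f]. *)
Definition pushforward_measure (d d' : measure_display) (T1 : measurableType d)
    (T2 : measurableType d') (m : {measure set T1 -> \bar R}) (f : T1 -> T2)
    (mf : measurable_fun setT f) : {measure set T2 -> \bar R} :=
  measure_function_pushforward__canonical__measure_function_Measure m mf.

(** The set of the [(y, x)] such that [y * x] is in [A] is measured in two ways for the
    product of [m'] and [m]: its slices at fixed [y] have measure [m A] by left
    invariance of [m], and its slices at fixed [x] have measure [m' A] by right
    invariance of [m']. *)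
Lemma left_invariant_inversion (m m' : {measure set (borel G) -> \bar R}) A :
  (m setT < +oo)%E -> (m' setT < +oo)%E ->
  (forall g B, measurable (B : set (borel G)) -> m [set x | B (g * x)%g] = m B) ->
  (forall g B, measurable (B : set (borel G)) -> m' [set x | B (x * g)%g] = m' B) ->
  measurable (A : set (borel G)) ->
  (m A * m' setT = m' A * m setT)%E.
Proof.
move=> mfin m'fin mi m'i mA.
pose n : {sigma_finite_measure set (borel G) -> \bar R} := mfrestr measurableT mfin.
pose n' : {sigma_finite_measure set (borel G) -> \bar R} := mfrestr measurableT m'fin.
have nE B : n B = m B by rewrite -[in RHS](setIT B).
have n'E B : n' B = m' B by rewrite -[in RHS](setIT B).
pose M : set (borel G * borel G) := [set p | A (p.1 * p.2)%g].
have mM : measurable M by exact: mul_measurable.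
have <- : ((n' \x n) M = m A * m' setT)%E.
  transitivity (\int[n']_y (cst (m A) y))%E.
    apply: eq_integral => y _; have -> : (n \o xsection M) y = n [set x | A (y * x)%g].
      by congr (n _); apply/seteqP; split=> x; rewrite /xsection/= inE.
    by rewrite nE mi.
  by rewrite integral_cst//; congr (_ * _)%E; exact: n'E.
have <- : ((n' \x^ n) M = m' A * m setT)%E.
  transitivity (\int[n]_x (cst (m' A) x))%E.
    apply: eq_integral => x _; have -> : (n' \o ysection M) x = n' [set y | A (y * x)%g].
      by congr (n' _); apply/seteqP; split=> y; rewrite /ysection/= inE.
    by rewrite n'E m'i.
  by rewrite integral_cst//; congr (_ * _)%E; exact: nE.
by apply: product_measure_unique => // B D mB mD; exact: product_measure2E.
Qed.

(** Both measures are compared, by [left_invariant_inversion], with the image of [m2]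
    under inversion, which is right invariant. *)
Lemma left_invariant_unique (m1 m2 : {measure set (borel G) -> \bar R}) A :
  (m1 setT < +oo)%E -> m1 setT = m2 setT ->
  (forall g B, measurable (B : set (borel G)) -> m1 [set x | B (g * x)%g] = m1 B) ->
  (forall g B, measurable (B : set (borel G)) -> m2 [set x | B (g * x)%g] = m2 B) ->
  measurable (A : set (borel G)) -> m1 A = m2 A.
Proof.
move=> fin1 e12 inv1 inv2 mA.
have [m20|m20] := eqVneq (m2 setT) 0%E.
  have z (m : {measure set (borel G) -> \bar R}) : m setT = 0%E -> m A = 0%E.
    move=> h; apply/eqP; rewrite eq_le measure_ge0 andbT -h.
    by apply: le_measure => //; rewrite inE.
  by rewrite !z// e12.
have mV : measurable_fun setT ((fun x => x^-1%g) : borel G -> borel G).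
  by apply: borel_continuous; exact: invg_continuous.
pose m' := pushforward_measure m2 mV.
have m'E (B : set G) : m' B = m2 [set x | B x^-1%g] by [].
have m'T : m' setT = m2 setT by rewrite m'E.
have m'i g (B : set G) : measurable (B : set (borel G)) -> m' [set x | B (x * g)%g] = m' B.
  move=> mB; rewrite !m'E -[RHS](inv2 g^-1%g).
    by congr (m2 _); apply/seteqP; split=> x /=; rewrite invgM invgK.
  by rewrite -[X in measurable X]setTI; exact (mV measurableT B mB).
have fin' : (m' setT < +oo)%E by rewrite m'T -e12.
have := left_invariant_inversion fin1 fin' inv1 m'i mA.
have := left_invariant_inversion (_ : m2 setT < +oo)%E fin' inv2 m'i mA.
rewrite -e12 => /(_ fin1); rewrite m'T -e12 => h1 h2.
have m1_fin : m1 setT \is a fin_num by rewrite ge0_fin_numE.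
have m1_gt0 : (0 < m1 setT)%E by rewrite lt0e measure_ge0 andbT e12.
by apply/le_anti; rewrite -(lee_pmul2r m1_fin m1_gt0) -[X in _ && X](lee_pmul2r m1_fin m1_gt0) h1 h2 lexx.
Qed.

End InvariantMeasures.

(** * Invariance of the Haar measure *)

Section Pieces.
Variables (R : realType) (d d' : measure_display).
Variables (T : measurableType d) (T' : measurableType d') (I : choiceType).
Hypothesis cI : countable [set: I].
Variables (m : {measure set T -> \bar R}) (m' : {measure set T' -> \bar R}).

(** Countable additivity for pieces indexed by a countable type, such as [Gam], rather
    than by integers. *)
Lemma measure_eq_pieces (A : set T) (A' : set T') (P : I -> set T) (P' : I -> set T') :
  (forall r, measurable (P r)) -> (forall r, measurable (P' r)) ->
  A = \bigcup_r P r -> A' = \bigcup_r P' r ->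
  (forall r s x, P r x -> P s x -> r = s) -> (forall r s x, P' r x -> P' s x -> r = s) ->
  (forall r, m (P r) = m' (P' r)) -> m A = m' A'.
Proof.
move=> mP mP' -> -> dP dP' PP'; have [code codeI] := countable_injP _ cI.
pose Q (U : Type) (F : I -> set U) n := \bigcup_(r in [set r | code r = n]) F r.
have QE (U : Type) (F : I -> set U) n : (exists2 r, Q U F n = F r & code r = n) \/
    (Q U F n = set0 /\ forall r, code r <> n).
  have [[r rn]|nr] := pselect (exists r, code r = n); [left; exists r => //|right].
    apply/seteqP; split=> [x [s /= sn Fx]|x Fx]; last by exists r.
    by have <- : s = r by apply: codeI; rewrite ?inE//= sn.
  split=> [|r rn]; last by apply: nr; exists r.
  by apply/seteqP; split=> // x [r rn _]; apply: nr; exists r.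
have bQ (U : Type) (F : I -> set U) : \bigcup_r F r = \bigcup_n Q U F n.
  by apply/seteqP; split=> [x [r _ Fx]|x [n _ [r _ Fx]]]; [exists (code r) => //; exists r|exists r].
have tQ (U : Type) (F : I -> set U) : (forall r s x, F r x -> F s x -> r = s) ->
    trivIset setT (Q U F).
  move=> dF k l _ _ [x [[r rk Fr] [s sl Fs]]].
  by rewrite -rk -sl (dF _ _ _ Fr Fs).
have mQ : forall n, measurable (Q _ P n).
  by move=> n; have [[r -> _]|[-> _]] := QE _ P n.
have mQ' : forall n, measurable (Q _ P' n).
  by move=> n; have [[r -> _]|[-> _]] := QE _ P' n.
rewrite !bQ !measure_semi_bigcup//; try exact: tQ; try exact: bigcupT_measurable.
apply: eq_eseriesr => n _.
have [[r -> rn]|[-> nr]] := QE _ P n; last first.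
  have [[r _ rn]|[-> _]] := QE _ P' n; first by case: (nr r).
  by rewrite !measure0.
have [[s -> sn]|[_ ns]] := QE _ P' n; last by case: (ns r).
by rewrite PP'; congr (m' (P' _)); apply: codeI; rewrite ?inE//= rn.
Qed.

End Pieces.

Section Haar.
Variables (R : realType) (Gam G : topGroupType) (mp : matched_pair R Gam G).
Variables (alpha : Gam -> G -> G) (beta : G -> Gam -> Gam).
Hypothesis hab : mp_actions mp alpha beta.
Hypotheses (cGam : countable [set: Gam]).
Hypotheses (cG : compact [set: G]) (hG : hausdorff_space G) (scG : @second_countable G).
Local Notation i := (mp_inr mp).
Local Notation j := (mp_inl mp).
Local Notation HH := (mp_group mp).
Variable mu : {measure set (borel HH) -> \bar R}.
Hypothesis hmu : haar_measure mu.
Hypothesis null : mu.-negligible (~` [set (j c * i g)%g | c in [set: Gam] & g in [set: G]]).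

Lemma range_inr_measurable : measurable (range i : set (borel HH)).
Proof. by apply: borel_closed; exact: inr_closed. Qed.

(** The inverse of the embedding of [G], extended by [1] off its range. *)
Definition proj (x : HH) : G := xget 1%g [set g | i g = x].

Lemma proj_i g : proj (i g) = g.
Proof. by apply: xget_unique => // h; exact: inr_inj. Qed.

Lemma proj_preimage (A : set G) : proj @^-1` A `&` range i = i @` A.
Proof.
apply/seteqP; split=> [x [/= Ax [g _ gx]]|x [g Ag <-]].
  by exists g => //; rewrite -(proj_i g) gx.
by split; [rewrite /= proj_i|exists g].
Qed.

Lemma proj_measurable : measurable_fun setT (proj : borel HH -> borel G).
Proof.
apply: (@measurability _ _ (borel HH) (borel G) setT _ (@open G)) => //.
move=> _ [U oU <-]; rewrite setTI.
have [V oV UV] : exists2 V : set HH, open V & U = i @^-1` V.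
  by case: (mp_inr_closed mp) => _ _ _ _; apply.
have -> : proj @^-1` U = (V `&` range i) `|` (~` range i `&` [set _ | U 1%g]).
  apply/seteqP; split=> [x /= Ux|x /=].
    have [[g _ gx]|nx] := pselect (range i x).
      left; split; last by exists g.
      by move: Ux; rewrite -gx proj_i UV.
    right; split=> //; suff <- : proj x = 1%g by [].
    by rewrite /proj; case: xgetP => // g _ /= gx; case: nx; exists g.
  move=> [[Vx [g _ gx]]|[nx U1]]; first by rewrite -gx proj_i UV /= gx.
  suff -> : proj x = 1%g by [].
  by rewrite /proj; case: xgetP => // g _ /= gx; case: nx; exists g.
apply: measurableU; first by apply: measurableI; [exact: borel_open|exact: range_inr_measurable].
apply: measurableI; first by apply: measurableC; exact: range_inr_measurable.
have [U1|nU1] := pselect (U 1%g).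
  by rewrite (_ : [set _ | _] = setT)//; apply/seteqP; split.
by rewrite (_ : [set _ | _] = set0)//; apply/seteqP; split.
Qed.

Lemma image_measurable (A : set G) : measurable (A : set (borel G)) ->
  measurable (i @` A : set (borel HH)).
Proof.
move=> mA; rewrite -proj_preimage; apply: measurableI; last exact: range_inr_measurable.
by have := proj_measurable measurableT mA; rewrite setTI.
Qed.

Definition restrict_measure (m : {measure set (borel HH) -> \bar R}) : {measure set (borel G) -> \bar R} :=
  pushforward_measure (mrestr m range_inr_measurable) proj_measurable.

Lemma restrict_measureE m A : restrict_measure m A = m (i @` A).
Proof. by rewrite -proj_preimage. Qed.

Lemma mulr_measurable (h : HH) :
  measurable_fun setT ((fun x => (x * h)%g) : borel HH -> borel HH).
Proof. by apply: borel_continuous; exact: mulg_contr. Qed.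

Lemma haar_translate (h : HH) A : measurable (A : set (borel HH)) ->
  mu [set x | A (h * x)%g] = mu A.
Proof.
move=> mA; rewrite -(haar_invariant hmu h^-1%g mA); congr (mu _).
apply/seteqP; split=> [x Ax|_ [y Ay <-] /=]; last by rewrite mulVKg.
by exists (h * x)%g => //; rewrite mulKg.
Qed.

(** The measure [A |-> mu (A r^-1)]. *)
Definition haar_shift (r : Gam) := restrict_measure (pushforward_measure mu (@mulr_measurable (j r))).

Lemma haar_shiftE r A : haar_shift r A = mu [set x | (i @` A) (x * j r)%g].
Proof. by rewrite /haar_shift restrict_measureE. Qed.

Definition haarG := restrict_measure mu.

Lemma haarGE A : haarG A = mu (i @` A).
Proof. exact: restrict_measureE. Qed.

Lemma piece_measurable r A : measurable (A : set (borel G)) ->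
  measurable ([set x | (i @` A) (x * j r)%g] : set (borel HH)).
Proof.
by move=> /image_measurable mA; have := mulr_measurable (j r) measurableT mA; rewrite setTI.
Qed.

Lemma haar_shift_left r g B : measurable (B : set (borel G)) ->
  haar_shift r [set x | B (g * x)%g] = haar_shift r B.
Proof.
move=> mB; rewrite !haar_shiftE -[RHS](haar_translate (i g)); last exact: piece_measurable.
congr (mu _); apply/seteqP; split=> x /= [h Bh hx].
  by exists (g * h)%g => //; rewrite inrM hx mulgA.
exists (g^-1 * h)%g; first by rewrite /= mulVKg.
by rewrite inrM inrV hx -mulgA mulKg.
Qed.

Lemma haarG_left g B : measurable (B : set (borel G)) -> haarG [set x | B (g * x)%g] = haarG B.
Proof.
move=> mB; rewrite !haarGE -[RHS](haar_translate (i g)); last exact: image_measurable.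
congr (mu _); apply/seteqP; split=> x /= [h Bh hx].
  by exists (g * h)%g => //; rewrite inrM hx.
by exists (g^-1 * h)%g; [rewrite /= mulVKg|rewrite inrM inrV hx mulKg].
Qed.

Lemma haarG_fin : (haarG setT < +oo)%E.
Proof.
rewrite haarGE; apply: (haar_compact_finite hmu); apply: continuous_compact => //.
by apply: continuous_subspaceT; exact: inr_continuous.
Qed.

(** Both [G] and [G r^-1] are fundamental domains for left translation by [Gam] on
    [Gam G]: cutting [G] into the sets of the [x] with [c x r] in [G], for [c] in
    [Gam], and translating these by [c] gives a partition of [G r^-1]. *)
Lemma haar_shift_total r : haarG setT = haar_shift r setT.
Proof.
rewrite haarGE haar_shiftE.
apply: (@measure_eq_pieces R _ _ (borel HH) (borel HH) Gam cGam mu mu _ _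
  (fun c => [set x | range i x /\ range i (j c * x * j r)%g])
  (fun c => [set x | range i (j c^-1 * x)%g /\ range i (x * j r)%g])).
- move=> c; apply: borel_closed; apply: closedI; first exact: inr_closed.
  apply: closed_comp; last exact: inr_closed.
  by move=> x _; apply: mulg_cvg; [exact: mulg_contl|exact: cvg_cst].
- move=> c; apply: borel_closed; apply: closedI; apply: closed_comp.
  + by move=> x _; exact: mulg_contl.
  + exact: inr_closed.
  + by move=> x _; exact: mulg_contr.
  + exact: inr_closed.
- apply/seteqP; split=> [_ [g _ <-]|x [c _ []]//].
  exists (beta g^-1%g r^-1%g) => //; split; first by exists g.
  exists (alpha r^-1%g g^-1%g)^-1%g => //.
  have := hab r^-1%g g^-1%g => /(congr1 (fun x => x^-1)%g).
  rewrite !invgM -!inrV -!inlV !invgK => e.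
  by rewrite -[RHS]mulgA e mulgA -inlM mulgV inl1 mul1g.
- apply/seteqP; split=> [x [g _ gx]|x [c _ []]//].
  exists (beta g^-1%g r)^-1%g => //; split; last by exists g.
  exists (alpha r g^-1%g)^-1%g => //; have := hab r g^-1%g => /(congr1 (fun x => x^-1)%g).
  rewrite !invgM -!inrV -!inlV !invgK => e.
  have -> : x = (i g * j r^-1)%g by rewrite gx inlV mulgK.
  by rewrite e mulgA -inlM mulgV inl1 mul1g.
- move=> c d x [[g _ <-] [h _ e]] [_ [h' _ e']].
  have : (i (h^-1)%g * j c = i (h'^-1)%g * j d)%g.
    by rewrite !inrV e e' !invgM -!mulgA !mulVg.
  by move=> /(inr_inl_uniq)[].
- move=> c d x [[g _ e] [h _ xr]] [[g' _ e'] _].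
  have : (i g^-1 * j c^-1 = i g'^-1 * j d^-1)%g.
    by rewrite !inrV e e' !inlV !invgM !invgK -!mulgA !mulgV.
  by move=> /(inr_inl_uniq)[_ /invg_inj].
- move=> c; rewrite -[RHS](haar_translate (j c)).
    congr (mu _); apply/seteqP; split=> x /= [xi xr]; split=> //.
      by rewrite inlV mulKg.
    by rewrite inlV mulKg in xi.
  apply: borel_closed; apply: closedI; apply: closed_comp.
  + by move=> x _; exact: mulg_contl.
  + exact: inr_closed.
  + by move=> x _; exact: mulg_contr.
  + exact: inr_closed.
Qed.

Lemma haar_shift_eq r A : measurable (A : set (borel G)) -> haarG A = haar_shift r A.
Proof.
apply: left_invariant_unique => //; [exact: haarG_fin|exact: haar_shift_total| |].
  by move=> g B; exact: haarG_left.
by move=> g B; exact: haar_shift_left.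
Qed.

Lemma fiber_measurable c r : measurable ([set g | beta g c = r] : set (borel G)).
Proof. by apply: borel_closed; exact: beta_fiber_closed hab c r. Qed.

(** On the piece where [beta g c = r], [alpha c] is the restriction of
    [x |-> c x r^-1], which preserves the measure by left invariance and
    [haar_shift_eq]. *)
Lemma haarG_alpha c A : measurable (A : set (borel G)) -> haarG (alpha c @^-1` A) = haarG A.
Proof.
move=> mA.
have mB : measurable (alpha c @^-1` A : set (borel G)).
  by have := borel_continuous (alpha_continuous hab (c := c) hG cG) measurableT mA; rewrite setTI.
have mpre r : measurable (alpha c^-1%g @^-1` [set g | beta g c = r] : set (borel G)).
  have := borel_continuous (alpha_continuous hab (c := c^-1%g) hG cG) measurableT (fiber_measurable c r).
  by rewrite setTI.
apply: (@measure_eq_pieces R _ _ (borel G) (borel G) Gam cGam haarG haarG _ _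
  (fun r => alpha c @^-1` A `&` [set g | beta g c = r])
  (fun r => A `&` alpha c^-1%g @^-1` [set g | beta g c = r])).
- by move=> r; apply: measurableI => //; exact: fiber_measurable.
- by move=> r; apply: measurableI.
- by apply/seteqP; split=> [g Ag|g [r _ []//]]; exists (beta g c).
- by apply/seteqP; split=> [g Ag|g [r _ []//]]; exists (beta (alpha c^-1%g g) c).
- by move=> r s g [_ <-] [_ <-].
- by move=> r s g [_ <-] [_ <-].
- move=> r; rewrite (haar_shift_eq r); last by apply: measurableI => //; exact: fiber_measurable.
  rewrite haar_shiftE haarGE -[RHS](haar_translate (j c)); last first.
    by apply: image_measurable; apply: measurableI.
  congr (mu _); apply/seteqP; split=> x /= [g [Ag br] gx].
    exists (alpha c g); first by split=> //=; rewrite (alphaK hab).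
    have := hab c g; rewrite gx br mulgA => /mulIg; exact/esym.
  move: br => /= br; exists (alpha c^-1%g g); first by split=> //=; rewrite (alphaKV hab).
  have := hab c (alpha c^-1%g g); rewrite br (alphaKV hab) gx -mulgA => /mulgI.
  exact.
Qed.

(** Otherwise the translates of [G] by the countable group [Gam] would be null sets, and
    so would be [Gam G] and the whole group. *)
Lemma haarG_gt0 : haarG setT != 0%E.
Proof.
rewrite haarGE; apply/eqP => mu0; apply: (haar_nonzero hmu).
have [f [_ hf]] := countable_enum cGam (I : [set: Gam] 1%g).
pose A n := [set (j (f n) * x)%g | x in range i].
have mA n : measurable (A n : set (borel HH)).
  rewrite (_ : A n = [set x | range i ((j (f n))^-1 * x)%g]).
    apply: borel_closed; apply: closed_comp; last exact: inr_closed.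
    by move=> x _; exact: mulg_contl.
  apply/seteqP; split=> [_ [x xi <-] /=|x xi]; first by rewrite mulKg.
  by exists ((j (f n))^-1 * x)%g => //; rewrite mulVKg.
have nA : mu.-negligible (\bigcup_n A n).
  apply: negligible_bigcup => n; apply/negligibleP; first exact: mA.
  transitivity (mu (range i)); last exact: mu0.
  exact: haar_invariant hmu (j (f n)) _ range_inr_measurable.
have : mu.-negligible [set: borel HH].
  apply: negligibleS (negligibleU nA null) => x _.
  have [[c _ [g _ <-]]|nx] := pselect ([set (j c * i g)%g | c in [set: Gam] & g in [set: G]] x).
    by left; have [n fn] := hf c I; exists n => //; exists (i g); [exists g|rewrite fn].
  by right.
by move/negligibleP; apply.
Qed.

(** By translation invariance all points have the mass of the identity, and the total
    mass is finite. *)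
Lemma haarG_atom_finite : haarG [set 1%g] != 0%E -> finite_set [set: G].
Proof.
move=> nu1; apply: contrapT => /infiniteP/pcard_leTP/=[f].
have m1 g : measurable ([set g] : set (borel G)).
  by apply: borel_closed; apply: accessible_closed_set1; exact: hausdorff_accessible.
have nug g : haarG [set g] = haarG [set 1%g].
  rewrite -(haarG_left g (m1 g)); congr (haarG _); apply/seteqP; split=> x /= e.
    by apply: (mulgI g); rewrite e mulg1.
  by rewrite e mulg1.
have le_nu (A : set (borel G)) : measurable A -> (haarG A <= haarG setT)%E.
  by move=> mA; apply: le_measure => //; rewrite inE.
have fin A : measurable (A : set (borel G)) -> haarG A \is a fin_num.
  by move=> mA; rewrite ge0_fin_numE//; apply: le_lt_trans (le_nu _ mA) haarG_fin.
have sumE : haarG (\bigcup_n [set f n]) = (\sum_(n <oo) haarG [set 1%g])%E.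
  rewrite measure_semi_bigcup//.
  - by apply: eq_eseriesr => n _; exact: nug.
  - by move=> k l _ _ [x [-> /inj]]; apply; rewrite inE.
  - by apply: bigcupT_measurable.
have p_gt0 : 0 < fine (haarG [set 1%g]).
  by rewrite fine_gt0// lt0e nu1 measure_ge0/= ltey_eq fin.
pose p := fine (haarG [set 1%g]); pose t := fine (haarG setT).
have sum_le n : n%:R * p <= t.
  rewrite -lee_fin /t fineK ?fin//; apply: le_trans (le_nu _ (bigcupT_measurable _ (fun n => m1 (f n)))).
  rewrite sumE; apply: le_trans _ (nneseries_lim_ge n _); last by [].
  have -> : haarG [set 1%g] = p%:E by rewrite fineK// fin.
  by rewrite sumEFin lee_fin sumr_const_nat subn0 mulr_natl.
have := sum_le (Num.bound (t / p)).+1.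
apply/negP; rewrite -ltNge -ltr_pdivrMr//.
apply: lt_le_trans (archi_boundP _) _; first by rewrite divr_ge0// ?fine_ge0// ltW.
by rewrite ler_nat.
Qed.

End Haar.

(** * Equicontinuity of compact actions *)

Lemma cluster_closed (X : topologicalType) (F : set_system X) (C : set X) x :
  closed C -> F C -> cluster F x -> C x.
Proof. by move=> cC FC; rewrite clusterE => /(_ _ FC); rewrite -(closure_id C).1. Qed.

Section Equicontinuity.
Variables (R : realType) (Gam G : topGroupType) (mp : matched_pair R Gam G).
Variables (alpha : Gam -> G -> G) (beta : G -> Gam -> Gam).
Hypothesis hab : mp_actions mp alpha beta.
Hypotheses (cG : compact [set: G]) (hG : hausdorff_space G) (scG : @second_countable G).
Hypothesis hca : compact_action alpha.

Let aC c : continuous (alpha c).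
Proof. exact (alpha_continuous hab hG cG). Qed.

Lemma dense_sequence : exists d : nat -> G, forall U x, open U -> U x -> exists n, U (d n).
Proof.
have [B cB [oB bB]] := scG.
have [U0 [BU0 _] _] := bB (1%g : G) setT filterT.
have [f [fB hf]] := countable_enum cB BU0.
exists (fun n => xget 1%g (f n)) => U x oU Ux.
have [V [BV Vx] VU] := bB x U (open_nbhs_nbhs (conj oU Ux)).
have [n fn] := hf V BV; exists n; case: xgetP => [y _|/(_ x)]; rewrite fn; first exact: VU.
by [].
Qed.

Lemma quotient_cvg (T : Type) (F : set_system T) (FF : Filter F) (f g : T -> G) x y :
  f @ F --> x -> g @ F --> y -> (fun t => ((f t)^-1 * g t)%g) @ F --> (x^-1 * y)%g.
Proof. by move=> fx gy; apply: mulg_cvg => //; exact: invg_cvg. Qed.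

Variables (N : nat -> set G) (d : nat -> G).
Hypotheses (hN : forall n, nbhs (1%g : G) (N n) /\ closed (N n))
  (decN : forall n m, (n <= m)%N -> N m `<=` N n)
  (baseN : forall W, nbhs (1%g : G) W -> exists n, N n `<=` W).
Hypothesis dense_d : forall U x, open U -> U x -> exists n, U (d n).

(** Only finitely many points of the dense sequence [d] are compared, up to a finite
    precision, so that for each [n] finitely many elements of [Gam] represent all
    the others up to this relation. *)
Definition close_at n c c' :=
  forall k, (k <= n)%N -> N n ((alpha c (d k))^-1 * alpha c' (d k))%g.

(** On the compact closure of the image of [Gam], evaluation at [1] is continuous, hence
    so is evaluation at any point [x], because [y |-> y x] is a homeomorphism.
    If the claim failed, pairs that are [n]-close but send [g] far
    apart would accumulate, for [n] going to infinity, at a pair [t], [t'] of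
    homeomorphisms that agree on the dense sequence [d] but not at [g]. *)
Lemma close_at_pointwise W g : nbhs (1%g : G) W -> exists n, forall c c',
  close_at n c c' -> W ((alpha c g)^-1 * alpha c' g)%g.
Proof.
move=> W1; apply: contrapT => /forallNP bad.
have [T [jT [[jTM jTI jTr hT jTev] cK]]] := hca.
have jTc t : continuous (jT t).
  have : range jT (jT t) by exists t.
  by rewrite jTr => -[f' [cf _ _ _]].
have ev_cont x : continuous (fun t => jT t x).
  have : [set f | @homeomorphism G f] (fun y => y * x)%g.
    by exists (fun y => y * x^-1)%g; split; [exact: mulg_contr|exact: mulg_contr|exact: mulgK|exact: mulgVK].
  rewrite -jTr => -[tx _ jtx] t.
  have -> : (fun t => jT t x) = (fun t => jT t 1%g) \o (fun t => (t * tx)%g).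
    by apply/funext => t'; rewrite /= jTM /= jtx mul1g.
  by apply: continuous_comp; [exact: mulg_contr|exact: jTev].
have hs c : exists t, jT t = alpha c.
  have : [set f | @homeomorphism G f] (alpha c).
    exists (alpha c^-1%g); split; [| |exact: alphaK hab c|exact: alphaKV hab c].
      exact: aC.
    exact: aC.
  by rewrite -jTr => -[t _ jt]; exists t.
have /choice[s hs'] := hs.
have bad' n : exists cc : Gam * Gam, close_at n cc.1 cc.2 /\
    ~ W ((alpha cc.1 g)^-1 * alpha cc.2 g)%g.
  apply: contrapT => /forallNP h; apply: (bad n) => c c' z.
  by apply: contrapT => nW; apply: (h (c, c')).
have /choice[cc hcc] := bad'.
pose K := closure (jT @^-1` range alpha).
have Ks c : K (s c) by apply: subset_closure; exists c.
pose st n := (s (cc n).1, s (cc n).2).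
have [[t t'] [_ clt]] : (K `*` K) `&` cluster (st @ \oo) !=set0.
  apply: (compact_setX cK cK); exists 0%N => // n _.
  by split; [exact: (Ks (cc n).1)|exact: (Ks (cc n).2)].
have quot_cont x : continuous (fun p : T * T => ((jT p.1 x)^-1 * jT p.2 x)%g).
  move=> p; apply: quotient_cvg.
    by apply: (@continuous_comp _ _ _ fst (fun t => jT t x)); [exact: cvg_fst|exact: ev_cont].
  by apply: (@continuous_comp _ _ _ snd (fun t => jT t x)); [exact: cvg_snd|exact: ev_cont].
have lim_in x C : closed C ->
    (\forall n \near \oo, C ((alpha (cc n).1 x)^-1 * alpha (cc n).2 x)%g) ->
    C ((jT t x)^-1 * jT t' x)%g.
  move=> cC hC; apply: (@cluster_closed _ (st @ \oo)
    [set p | C ((jT p.1 x)^-1 * jT p.2 x)%g] (t, t')) => //.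
    by apply: closed_comp => // p _; exact: quot_cont.
  by apply: filterS hC => n /=; rewrite !hs'.
have eq_d k : jT t (d k) = jT t' (d k).
  apply: (mulgI (jT t (d k))^-1%g); rewrite mulVg; apply: esym; apply: contrapT => ne.
  have [|m Nm] := baseN (W := ~` [set ((jT t (d k))^-1 * jT t' (d k))%g]).
    apply: open_nbhs_nbhs; split; last by move=> /esym.
    by apply: closed_openC; apply: accessible_closed_set1; exact: hausdorff_accessible.
  apply: (Nm ((jT t (d k))^-1 * jT t' (d k))%g) => //.
  apply: lim_in; first by case: (hN m).
  near=> n; apply: (decN (n := m) (m := n)); first by near: n; exact: nbhs_infty_ge.
  by apply: (hcc n).1; near: n; exact: nbhs_infty_ge.
have eq_t : jT t g = jT t' g.
  apply: (mulgI (jT t g)^-1%g); rewrite mulVg; apply: esym; apply: contrapT => ne.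
  have [] := dense_d (U := [set x | ((jT t x)^-1 * jT t' x)%g <> 1%g]) (x := g) => //.
    apply: (@open_comp _ _ (fun x => ((jT t x)^-1 * jT t' x)%g) (~` [set 1%g])).
      by move=> x _; apply: quotient_cvg; exact: jTc.
    by apply: closed_openC; apply: accessible_closed_set1; exact: hausdorff_accessible.
  by move=> k /=; rewrite eq_d mulVg.
have := lim_in g (~` W°) (open_closedC (open_interior W)).
rewrite eq_t mulVg; apply; last exact: nbhs_singleton (nbhs_interior W1).
by near=> n; move=> /interior_subset; exact: (hcc n).2.
Unshelve. all: by end_near. Qed.

Variable nu : {measure set (borel G) -> \bar R}.
Hypothesis nu_left : forall g B, measurable (B : set (borel G)) ->
  nu [set x | B (g * x)%g] = nu B.

Lemma charged_piece (F : nat -> set G) (A : set G) : (forall n, measurable (F n : set (borel G))) ->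
  A `<=` \bigcup_n F n -> nu A != 0%E -> measurable (A : set (borel G)) ->
  exists n, nu (F n) != 0%E.
Proof.
move=> mF AF nuA mA; apply: contrapT => /forallNP h.
have hn : nu.-negligible (\bigcup_n F n : set (borel G)).
  apply: negligible_bigcup => n; apply/negligibleP; first exact: mF.
  by apply/eqP/negPn/negP; exact: h.
have nA : nu.-negligible (A : set (borel G)) by apply: negligibleS hn; exact: AF.
by move/negP: nuA; apply; apply/eqP; move/negligibleP: nA; exact.
Qed.

(** Refines [A] successively for each [c] of [Phi], keeping a piece of positive measure on
    which [alpha c] varies little. *)
Lemma small_piece (Phi : seq Gam) (A : set G) W : nbhs (1%g : G) W ->
  measurable (A : set (borel G)) -> nu A != 0%E ->
  exists A', [/\ A' `<=` A, measurable (A' : set (borel G)), nu A' != 0%E &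
    forall c, c \in Phi -> forall x y, A' x -> A' y -> W ((alpha c x)^-1 * alpha c y)%g].
Proof.
move=> W1 mA nuA; elim: Phi => [|c Phi [A1 [A1A mA1 nuA1 hA1]]]; first by exists A; split.
have [ O hO OW] := nbhs_div W1.
have [s hs] := finite_translates cG hO.
pose F k := A1 `&` [set x | O ((nth 1%g s k)^-1 * alpha c x)%g].
have mF k : measurable (F k : set (borel G)).
  apply: measurableI => //; apply: borel_open; apply: open_comp.
    move=> x _; apply: mulg_cvg; first exact: cvg_cst.
    exact: aC.
  by case: hO.
have [|k nuF] := charged_piece mF _ nuA1 mA1.
  move=> x A1x; have := hs (alpha c x); set p := (p in has p s) => hp.
  exists (find p s) => //; split=> //.
  by have := nth_find 1%g hp; rewrite /p => /asboolP.
exists (F k); split=> //; first by move=> x [/A1A].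
move=> e; rewrite inE => /predU1P[->|ePhi] x y [A1x Ox] [A1y Oy]; last exact: hA1.
by have := OW _ _ Ox Oy; rewrite invgM invgK -mulgA mulVKg.
Qed.

(** By [close_at_pointwise], [G] is the union of the sets [F n] of the [g] at which
    [n]-close elements of [Gam] have close values; let [F n] be charged by [nu].
    Finitely many elements of [Gam] are enough to represent all elements up to
    [n]-closeness, so that a smaller charged set [A] exists on which every [alpha c]
    varies little. For [g0] and [g] in [A], the cocycle identity then puts
    [alpha c (g0^-1 g)] in [W] for all [c], and left invariance shows that [g0^-1 A]
    is charged. *)
Lemma invariant_nbhd_charged W : nbhs (1%g : G) W -> closed W -> nu setT != 0%E ->
  measurable ([set g | forall c, W (alpha c g)] : set (borel G)) /\
  nu [set g | forall c, W (alpha c g)] != 0%E.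
Proof.
move=> W1 cW nuT.
have mV : measurable ([set g | forall c, W (alpha c g)] : set (borel G)).
  apply: borel_closed.
  rewrite (_ : [set g | _] = \bigcap_c alpha c @^-1` W).
    by apply: closed_bigI => c _; apply: closed_comp => // x _; exact: aC.
  by apply/seteqP; split=> [g h c _|g h c]; exact: h.
split=> //.
have [W2 W21 W2W] := nbhs_mul W1; have [W3 W31 W3W] := nbhs_mul W21.
have [W4 W41 [cW4 W4W]] := nbhs_closed cG hG (filterI W31 W21).
(* Three consecutive small displacements stay in [W]. *)
have mul3 x y z : W4 x -> W4 y -> W4 z -> W (x * y * z)%g.
  move=> /W4W[x3 _] /W4W[y3 _] /W4W[_ z2]; apply: W2W => //; exact: W3W.
pose F n := [set g | forall c c', close_at n c c' -> W4 ((alpha c g)^-1 * alpha c' g)%g].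
have mF n : measurable (F n : set (borel G)).
  apply: borel_closed.
  rewrite (_ : F n = \bigcap_(p in [set p : Gam * Gam | close_at n p.1 p.2])
    (fun g => ((alpha p.1 g)^-1 * alpha p.2 g)%g) @^-1` W4).
    apply: closed_bigI => p _; apply: closed_comp => // x _.
    by apply: quotient_cvg; exact: aC.
  by apply/seteqP; split=> [g h [c c'] /= /h|g h c c' z]; last exact: (h (c, c')).
have [|n nuF] := charged_piece mF _ nuT measurableT.
  by move=> g _; have [n hn] := close_at_pointwise g W41; exists n.
have [M [q hq]] := finite_classes cG (hN n).1.
pose cls c := [ffun k : 'I_n.+1 => q (alpha c (d k))].
have clsZ c c' : cls c = cls c' -> close_at n c c'.
  move=> /ffunP e k; rewrite -ltnS => kn; apply: hq.
  by have := e (Ordinal kn); rewrite !ffunE.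
pose rep t := xget 1%g [set c | cls c = t].
have repE c : cls (rep (cls c)) = cls c by rewrite /rep; case: xgetP => [x _ ->|/(_ c)[]].
have [A [AF mA nuA hA]] := small_piece [seq rep t | t <- enum {ffun 'I_n.+1 -> 'I_M}] W41 (mF n) nuF.
have [g0 Ag0] : A !=set0.
  by apply/set0P; apply: contra nuA => /eqP ->; rewrite measure0.
have AV : A `<=` [set g | forall c, W (alpha c (g0^-1 * g)%g)].
  move=> g Ag c; pose c0 := beta g0^-1%g c; pose phi := rep (cls c0).
  have -> : alpha c (g0^-1 * g)%g = ((alpha c0 g0)^-1 * alpha c0 g)%g.
    have := alpha_cocycle hab c0 g0 (g0^-1 * g)%g.
    by rewrite mulVKg {2}/c0 (beta_surj hab) => ->; rewrite mulKg.
  have -> : ((alpha c0 g0)^-1 * alpha c0 g = ((alpha c0 g0)^-1 * alpha phi g0) *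
      ((alpha phi g0)^-1 * alpha phi g) * ((alpha phi g)^-1 * alpha c0 g))%g.
    by rewrite -!mulgA !mulVKg.
  apply: mul3.
  - by apply: (AF _ Ag0); apply: clsZ; rewrite repE.
  - by apply: hA => //; apply: map_f; rewrite mem_enum.
  - by apply: (AF _ Ag); apply: clsZ; rewrite repE.
rewrite -(nu_left g0^-1%g mV) gt_eqF//.
apply: (@lt_le_trans _ _ (nu A)); first by rewrite lt0e nuA measure_ge0.
apply: le_measure; [by rewrite inE| |exact: AV].
by rewrite inE; exact: translate_measurable mV.
Qed.

End Equicontinuity.

(** * Property (T) of the group, and finite G *)

Section GroupPart.
Variables (R : realType) (Gam G : topGroupType).
Variables (alpha : Gam -> G -> G) (beta : G -> Gam -> Gam).
Hypothesis cGam : countable [set: Gam].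
Hypothesis alpha_1 : forall c, alpha c 1%g = 1%g.
Variable QG : bicrossed_product R alpha beta.

Lemma evaluation_covariant (H : hilbertType R) (U : Gam -> H -> H) : unitary_rep U ->
  @covariant_rep R Gam G alpha H (fun F xi => F 1%g *: xi) U.
Proof.
move=> hU; split=> //.
- split=> /=.
  + move=> F _; split; last exact: scaler_continuous.
    by move=> c x y; rewrite scalerDr !scalerA mulrC.
  + by move=> c F F' xi _ _; rewrite scalerDl scalerA.
  + by move=> F F' _ _; apply/funext => xi /=; rewrite scalerA.
  + by apply/funext => xi; rewrite scale1r.
  + move=> F _ x y.
    by rewrite (si_Zl (ip_semi H))// (si_Zr (ip_semi H))// conjCK.
- move=> c F _; apply/funext => xi /=.
  have lU := ur_linear hU c; have UK : U c (U c^-1%g xi) = xi.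
    by have := congr1 (@^~ xi) (ur_mul hU c c^-1%g); rewrite mulgV (ur_one hU).
  have U0 : U c 0 = 0 by have := lU (-1)%R 0 0; rewrite scaler0 addr0 scaleN1r addNr.
  by rewrite alpha_1 -[_ *: U c^-1%g xi]addr0 lU U0 addr0 UK.
Qed.

Lemma dual_property_T_group : dual_property_T QG -> group_property_T R Gam.
Proof.
move=> T H U hU hai.
have [f [_ hf]] := countable_enum cGam (I : [set: Gam] 1%g).
have h n : exists xi : H, nrm xi = 1%R /\
    forall k, (k <= n)%N -> (nrm (U (f k) xi - xi) < n.+1%:R^-1)%R.
  have [||xi xi1 hxi] := hai (f @` `I_n.+1) (n.+1%:R^-1)%:C.
  - by apply: finite_image; exact: finite_II.
  - by rewrite -[0%R]/(0%:C) ltcR invr_gt0.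
  exists xi; split; first by rewrite /nrm xi1.
  by move=> k kn; have := hxi (f k); rewrite nrmE ltcR; apply; exists k.
have /choice[xi hxi] := h.
have [|v [v0 _ hv]] := dual_property_T_covariant T (evaluation_covariant hU).
  exists xi => [n|]; first by case: (hxi n).
  split=> [F _|c]; first by apply: vanish_le (@vanish0 R) => n; rewrite subrr nrm0.
  move=> e e0; have [k <-] := hf c I.
  have small := near_infty_natSinv_lt (PosNum e0).
  near=> n; apply: (@lt_trans _ _ (n.+1%:R^-1)%R); last by near: n; exact: small.
  by apply: (hxi n).2; near: n; exact: nbhs_infty_ge.
by exists v.
Unshelve. all: by end_near. Qed.

End GroupPart.

Section FinitePart.
Variables (R : realType) (Gam G : topGroupType).
Variables (alpha : Gam -> G -> G) (beta : G -> Gam -> Gam).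
Hypotheses (alphaK : forall c, cancel (alpha c) (alpha c^-1%g))
  (alpha_1 : forall c, alpha c 1%g = 1%g).
Hypotheses (hG : hausdorff_space G) (finG : finite_set [set: G]).
Variable QG : bicrossed_product R alpha beta.
Local Notation C := (R[i]).
Local Notation a := (@bc_fun _ _ _ _ _ QG).
Local Notation u := (@bc_u _ _ _ _ _ QG).
Local Notation eps := (@bc_counit _ _ _ _ _ QG).
Local Notation cp := (bc_crossed_product QG).

Lemma finite_discrete (F : G -> cplx R) : continuous F.
Proof.
move=> x A FA; have : nbhs x [set x].
  apply: open_nbhs_nbhs; split=> //; rewrite -[X in open X]setCK; apply: closed_openC.
  apply: (accessible_finite_set_closed.1 (hausdorff_accessible hG)).
  exact: sub_finite_set finG.
by apply: filterS => _ ->; exact: nbhs_singleton FA.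
Qed.

Let delta : G -> cplx R := fun x => if x == 1%g then 1 else 0.

Lemma delta_mul F : (fun x => F x * delta x)%R = (fun x => F 1%g * delta x + 0)%R.
Proof.
apply/funext => x; rewrite addr0 /delta; case: eqP => [->//|_].
by rewrite !mulr0.
Qed.

Lemma bc_fun0 : a (fun=> 0%R) = 0.
Proof.
have := fh_linear (cp_function cp) 1%R (@finite_discrete (fun=> 0%R)) (@finite_discrete (fun=> 0%R)).
rewrite scale1r (_ : (fun x => _) = fun=> 0%R); last by apply/funext => x; rewrite mulr0 addr0.
by move=> h; apply: (addrI (a (fun=> 0%R))); rewrite addr0 -h.
Qed.

Lemma bc_fun_delta F : a F ** a delta = F 1%g *: a delta.
Proof.
rewrite -(fh_mul (cp_function cp)); try exact: finite_discrete.
rewrite delta_mul (fh_linear (cp_function cp)); try exact: finite_discrete.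
by rewrite bc_fun0 addr0.
Qed.

Section Rep.
Variables (H : hilbertType R) (pi : QG -> H -> H).
Hypothesis hpi : representation pi.
Local Notation P := (pi (a delta)).
Local Notation U := (fun c => pi (u c)).

Lemma corner_idem x : P (P x) = P x.
Proof.
have := congr1 (@^~ x) (rep_mul hpi (a delta) (a delta)) => /= <-.
by rewrite bc_fun_delta /delta eqxx scale1r.
Qed.

Lemma corner_adj x y : ip (P x) y = ip x (P y).
Proof.
rewrite (rep_star hpi) -(fh_star (cp_function cp)); last exact: finite_discrete.
congr (ip x (pi (a _) y)); apply/funext => g; rewrite /delta.
by case: eqP => _; rewrite ?rmorph1 ?rmorph0.
Qed.

Lemma corner_commutes c x : pi (u c) (P x) = P (pi (u c) x).
Proof.
have e : u c ** a delta ** (u c)^† = a delta.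
  rewrite (cp_covariant cp c (@finite_discrete delta)); congr (a _).
  apply/funext => g; rewrite /delta /=; congr (if _ then _ else _).
  apply/eqP/eqP => [h|->]; last exact: alpha_1.
  by rewrite -[LHS](alphaK c^-1%g) h alpha_1.
have := rep_mul hpi (u c) (a delta) => /(congr1 (@^~ x)) /= <-.
have := rep_mul hpi (a delta) (u c) => /(congr1 (@^~ x)) /= <-.
by rewrite -[in RHS]e -!cmulA (cp_unitaryl cp) cmul1r.
Qed.

Lemma bc_u_ip c x y : ip (pi (u c) x) (pi (u c) y) = ip x y.
Proof.
rewrite (rep_star hpi); have := rep_mul hpi (u c)^† (u c) => /(congr1 (@^~ y)) /= <-.
by rewrite (cp_unitaryl cp) (rep_one hpi).
Qed.

(** The form [<P x, y>], where [P] is the projection given by the indicator function of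
    the identity; completing [H] for it gives the range of [P]. *)
Definition corner_form (x y : H) : C := ip (P x) y.

Lemma corner_form_ip x y : corner_form x y = ip (P x) (P y).
Proof. by rewrite -corner_adj corner_idem. Qed.

Lemma corner_form_semi : semi_inner setT corner_form.
Proof.
have lP := (rep_bounded hpi (a delta)).1.
split=> //.
- by move=> c x y z _ _ _; rewrite /corner_form lP ip_linear.
- by move=> x y _ _; rewrite !corner_form_ip ip_conj.
- by move=> x _; rewrite corner_form_ip ip_norm exprn_ge0.
Qed.

Lemma corner_form_snorm x : snorm corner_form x = nrm (P x).
Proof. by rewrite -nrm_snorm /snorm /snorm2 corner_form_ip. Qed.

Lemma corner_le x : (nrm (P x) <= nrm x)%R.
Proof.
have := ip_le (P x) x.
have -> : ip (P x) x = ip (P x) (P x) by rewrite -[RHS]corner_adj corner_idem.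
rewrite ip_norm nrmE -rmorphXn nrm_real ?sqr_ge0//.
have [->|nz] := eqVneq (nrm (P x)) 0%R; first by rewrite nrm_ge0.
by rewrite expr2 ler_pM2l// lt_neqAle eq_sym nz nrm_ge0.
Qed.

Lemma bc_u_bounded c : bounded_on setT corner_form (pi (u c)) 1.
Proof.
have lU := (rep_bounded hpi (u c)).1; split=> //.
  by move=> k x y _ _; exact: lU.
by move=> x _; rewrite mul1r /snorm /snorm2 /corner_form -corner_commutes bc_u_ip.
Qed.

Definition corner_rep (c : Gam) : completion corner_form_semi -> completion corner_form_semi :=
  cext (pi (u c)).

Lemma corner_unitary : unitary_rep corner_rep.
Proof.
split.
- by move=> c; exact: cext_linear (bc_u_bounded c).
- move=> c x y; apply: cext_isometry (bc_u_bounded c) _ => v w _ _.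
  by rewrite /corner_form -corner_commutes bc_u_ip.
- move=> c d; apply/funext => x /=.
  rewrite /corner_rep (cext_comp _ (bc_u_bounded c) (bc_u_bounded d)).
  by rewrite (cp_mul cp) (rep_mul hpi).
- by apply/funext => x; apply: cext_id => v _; rewrite bc_u1 (rep_one hpi).
Qed.

(** As the [xi n] are almost fixed by [P], the vectors [P (xi n)] have norm at least
    [1/2] for large [n], and normalizing them multiplies distances by at most [2]. *)
Lemma corner_almost_invariant (xi : nat -> H) : (forall n, nrm (xi n) = 1%R) ->
  (forall x, vanish (fun n => nrm (pi x (xi n) - eps x *: xi n))) ->
  forall (Q : set Gam) (e : R[i]), finite_set Q -> (0 < e)%R ->
    exists2 eta : completion corner_form_semi, (`|eta| = 1)%R &
      forall c, Q c -> (`|corner_rep c eta - eta| < e)%R.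
Proof.
move=> xi1 hxi Q e finQ; rewrite ltcE/= => /andP[/eqP Ime e0].
have Ee : e = (complex.Re e)%:C by rewrite [LHS]complexE Ime mulr0 addr0.
set r := complex.Re e in e0 Ee.
have r2 : (0 < r / 2)%R by rewrite divr_gt0.
have hP : \forall n \near \oo, (nrm (P (xi n) - xi n) < 2^-1)%R.
  have := hxi (a delta) 2^-1%R; rewrite (counit_fun QG (@finite_discrete delta)) /delta eqxx.
  by rewrite invr_gt0 => /(_ (ltr0Sn _ 1)); apply: filterS => n; rewrite scale1r.
have hU c : \forall n \near \oo, (nrm (pi (u c) (xi n) - xi n) < r / 2)%R.
  by have := hxi (u c) _ r2; rewrite (counit_u QG); apply: filterS => n; rewrite scale1r.
have [s sQ] : exists s : seq Gam, forall c, Q c -> c \in s.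
  by move/finite_seqP: finQ => [s ->]; exists s.
have hs : \forall n \near \oo, forall c, c \in s -> (nrm (pi (u c) (xi n) - xi n) < r / 2)%R.
  elim: (s) => [|c s' IH]; first by near=> n.
  near=> n; move=> c'; rewrite inE => /predU1P[->|]; first by near: n; exact: hU.
  by move: c'; near: n; exact: IH.
have [n [hn hQ]] := filter_ex (filterI hP hs).
pose k := (nrm (P (xi n)))^-1.
have Pn : (2^-1 < nrm (P (xi n)))%R.
  have : (nrm (xi n) <= nrm (P (xi n) - xi n) + nrm (P (xi n)))%R.
    by rewrite [nrm (_ - xi n)]nrmB -{1}(subrK (P (xi n)) (xi n)) nrmD.
  by rewrite xi1; move: hn; set b := nrm _; set d := nrm _; lra.
have Pn0 : (0 < nrm (P (xi n)))%R by rewrite (lt_trans _ Pn)// invr_gt0.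
have k0 : (0 <= k)%R by rewrite invr_ge0 ltW.
have k2 : (k < 2)%R by rewrite /k -[ltRHS]invrK ltf_pV2 ?posrE ?invr_gt0.
have [eta heta] := scauchy_reps corner_form_semi (scauchy_cst corner_form_semi (I : setT (k%:C *: xi n))).
have z0 := represents0 corner_form_semi : reps (Ss := corner_form_semi) _ 0.
exists eta.
  have := creps_dist heta z0; rewrite !subr0 nrmE => ->.
  by rewrite (snormZ corner_form_semi)// corner_form_snorm nrm_real// mulVf// gt_eqF.
move=> c Qc; rewrite Ee nrmE ltcR.
have := creps_dist (reps_cext (bc_u_bounded c) heta : reps (Ss := corner_form_semi) (fun=> pi (u c) (k%:C *: xi n)) _) heta.
rewrite -/(corner_rep c) => ->.
have lU := (rep_bounded hpi (u c)).1.
have U0 : pi (u c) 0 = 0 by have := lU (-1)%R 0 0; rewrite scaler0 addr0 scaleN1r addNr.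
have -> : pi (u c) (k%:C *: xi n) - k%:C *: xi n = k%:C *: (pi (u c) (xi n) - xi n).
  by have := lU k%:C (xi n) 0; rewrite U0 !addr0 => ->; rewrite scalerBr.
rewrite (snormZ corner_form_semi)// corner_form_snorm nrm_real//.
apply: (@le_lt_trans _ _ (k * nrm (pi (u c) (xi n) - xi n))%R).
  by rewrite ler_wpM2l// corner_le.
have := hQ c (sQ c Qc); have := nrm_ge0 (pi (u c) (xi n) - xi n).
set b := nrm _ => b0 b1.
apply: (@le_lt_trans _ _ (2 * b)%R); first by rewrite ler_wpM2r// ltW.
by rewrite mulrC -ltr_pdivlMr.
Unshelve. all: by end_near. Qed.

(** The vector of [H] is the limit of [P (v n)], for a sequence [v] that represents
    [phi]: the completion for [<P x, y>] is isometric to the range of [P]. *)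
Lemma corner_invariant (phi : completion corner_form_semi) : phi <> 0 ->
  (forall c, corner_rep c phi = phi) ->
  exists2 zeta : H, zeta <> 0 & P zeta = zeta /\ forall c, pi (u c) zeta = zeta.
Proof.
move=> phi0 hphi; have hv := crepP phi; set v := crep phi in hv.
have lP := (rep_bounded hpi (a delta)).1.
have PB x y : P (x - y) = P x - P y by rewrite addrC -scaleN1r lP scaleN1r addrC.
have [zeta hz] : exists zeta, vanish (fun n => nrm (P (v n) - zeta)).
  apply: normed_cauchy => e e0; have [_ /(_ e e0)[N hN]] := reps_scauchy hv.
  by exists N => m Nm; have := hN m Nm; rewrite corner_form_snorm PB.
have limit_eq x y : (forall n, (nrm (x - y) <= nrm (P (v n) - zeta) + nrm (P (v n) - zeta))%R) -> x = y.
  by move=> h; apply/subr0_eq/nrm_eq0/le_anti; rewrite nrm_ge0 andbT; exact: (vanish_ge0_le h hz hz).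
have Pz : P zeta = zeta.
  apply: limit_eq => n.
  rewrite -(subrKA (P (v n))); apply: le_trans (nrmD _ _) _; rewrite lerD2r.
  by rewrite nrmB -{1}corner_idem -PB corner_le.
exists zeta.
  move=> z0; apply: phi0; apply/nrm_eq0/le_anti; rewrite nrm_ge0 andbT cnrmE.
  rewrite leNgt; apply/negP => phi_gt0.
  have p2 : (0 < snorm (@cip _ _ _ _ corner_form_semi) phi / 2)%R by rewrite divr_gt0.
  have [N _ hN] := hz _ p2.
  have : (snorm (@cip _ _ _ _ corner_form_semi) phi <= snorm (@cip _ _ _ _ corner_form_semi) phi / 2)%R.
    apply: (reps_snorm_le (N := N) hv); first exact: ltW.
    by move=> n Nn; have := hN n Nn; rewrite z0 subr0 corner_form_snorm => /ltW.
  by rewrite leNgt gtr_pMr// invf_lt1// ltr1n.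
split=> // c; have lU := (rep_bounded hpi (u c)).1.
have UB x y : pi (u c) (x - y) = pi (u c) x - pi (u c) y by rewrite addrC -scaleN1r lU scaleN1r addrC.
have U_nrm x : nrm (pi (u c) x) = nrm x.
  by rewrite -!nrm_snorm /snorm /snorm2 bc_u_ip.
have hU := reps_cext (bc_u_bounded c) hv; rewrite -/(corner_rep c) hphi in hU.
have hUv := reps_eq hU hv.
apply/subr0_eq/nrm_eq0/le_anti; rewrite nrm_ge0 andbT.
apply: (vanish_ge0_le _ (vanishD hz hz) hUv) => n /=.
rewrite corner_form_snorm PB -corner_commutes.
have e : pi (u c) zeta - zeta = pi (u c) (zeta - P (v n)) + (P (v n) - zeta) +
    (pi (u c) (P (v n)) - P (v n)).
  by rewrite UB addrAC !subrKA.
rewrite e; apply: le_trans (nrmD _ _) _; rewrite lerD2r.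
by apply: le_trans (nrmD _ _) _; rewrite U_nrm lerD2r nrmB.
Qed.

End Rep.

(** On the range of [P], the function [F] acts as [F * delta = F 1 * delta], where
    [delta] is the indicator function of the identity. *)
Lemma group_property_T_dual : group_property_T R Gam -> dual_property_T QG.
Proof.
move=> T H pi hpi [xi xi1 hxi].
have hxi' x : vanish (fun n => nrm (pi x (xi n) - eps x *: xi n)).
  move=> e e0; have e0' : (0 < e%:C)%R by rewrite -[0%R]/(0%:C) ltcR.
  move/cvgrPdist_lt: (hxi x) => /(_ _ e0'); apply: filterS => n.
  by rewrite sub0r normrN normr_id nrmE ltcR.
have xi1' n : nrm (xi n) = 1%R by rewrite /nrm xi1.
have [phi phi0 hphi] := T _ _ (corner_unitary hpi) (corner_almost_invariant hpi xi1' hxi').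
have [zeta zeta0 [Pz Uz]] := corner_invariant phi0 hphi.
exists zeta => // x.
have : vanish (fun _ : nat => nrm (pi x zeta - eps x *: zeta)).
  apply: (almost_invariant_counit hpi (nrm_ge0 zeta)) => // [F cF|c].
    apply: vanish_le (@vanish0 R) => _.
    rewrite -{1}Pz; have := rep_mul hpi (a F) (a delta) => /(congr1 (@^~ zeta)) /= <-.
    have -> : a F ** a delta = F 1%g *: a delta + 0 by rewrite bc_fun_delta addr0.
    have pi0 : pi 0 zeta = 0.
      have := rep_linear hpi 1%R 0 0 zeta; rewrite !scale1r addr0 => h.
      by apply: (addrI (pi 0 zeta)); rewrite addr0 -h.
    by rewrite (rep_linear hpi) pi0 addr0 Pz subrr nrm0.
  by apply: vanish_le (@vanish0 R) => _; rewrite Uz subrr nrm0.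
move=> /vanish_cst h; apply/subr0_eq/nrm_eq0/le_anti.
by rewrite h nrm_ge0.
Qed.

End FinitePart.

Theorem theorem4p3 (R : realType) (Gam G : topGroupType)
    (Gam_countable : countable [set: Gam]) (Gam_discrete : forall S : set Gam, open S)
    (G_compact : compact [set: G]) (G_hausdorff : hausdorff_space G)
    (G_second_countable : @second_countable G)
    (mp : matched_pair R Gam G)
    (alpha : Gam -> G -> G) (beta : G -> Gam -> Gam)
    (mp_alpha_beta : mp_actions mp alpha beta)
    (QG : bicrossed_product R alpha beta) :
  [/\ dual_property_T QG ->
        group_property_T R Gam /\
        finite_set [set g : G | forall c : Gam, alpha c g = g],
      dual_property_T QG -> compact_action alpha ->
        group_property_T R Gam /\ finite_set [set: G] &
      group_property_T R Gam -> finite_set [set: G] -> dual_property_T QG].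
Proof.
have hT : dual_property_T QG -> group_property_T R Gam.
  exact (dual_property_T_group Gam_countable (alpha_1 mp_alpha_beta) (QG := QG)).
split=> [T|T hca|T finG].
- split; first exact: hT.
  exact (fixed_points_finite mp_alpha_beta G_compact G_hausdorff G_second_countable T).
- split; first exact: hT.
  have [mu hmu null] := mp_null_complement mp.
  have [N [hN [decN baseN]]] := countable_nbhs_base G_compact G_hausdorff G_second_countable.
  have [d dense_d] := dense_sequence G_second_countable.
  have charged n := invariant_nbhd_charged mp_alpha_beta G_compact G_hausdorff hca
    hN decN baseN dense_d (haarG_left (mp := mp) hmu) (hN n).1 (hN n).2 (haarG_gt0 Gam_countable hmu null).
  apply: (haarG_atom_finite (mp := mp) G_compact G_hausdorff hmu).
  apply: (@test_measure R Gam G alpha beta QG G_compact G_hausdorff (alpha1 mp_alpha_beta)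
    (alphaM mp_alpha_beta) _ (haarG mu) (haarG_fin G_compact hmu) _ G_second_countable
    (fun n => [set g | forall c, N n (alpha c g)]) T).
  + by move=> c; exact (alpha_continuous mp_alpha_beta G_hausdorff G_compact).
  + by move=> c A mA; exact: (haarG_alpha mp_alpha_beta).
  + by move=> n; case: (charged n).
  + by move=> n; case: (charged n).
  + move=> n c g; split=> /= h c'; last by rewrite -(alphaM mp_alpha_beta).
    by have := h (c' * c^-1)%g; rewrite -(alphaM mp_alpha_beta) mulgVK.
  + move=> W /baseN[n nW]; exists n => m nm g /(_ 1%g).
    by rewrite (alpha1 mp_alpha_beta) => /(decN _ _ nm)/nW.
- exact: (group_property_T_dual (alphaK mp_alpha_beta) (alpha_1 mp_alpha_beta) G_hausdorff finG).
Qed.
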